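(* Let $V=\mathbb{R}^4$ be equipped with its standard symplectic form $\omega$ and let $G=\mathrm{Sp}(4,\mathbb{R})$ act linearly on $V$. Let the tangent vectors $v_0^{\parallel},w^{\parallel}$, the normal vectors $v_0^\perp,w^\perp$, the covectors $\sigma_1,\sigma_2$ and the quadratic forms $Q_1,Q_2$ attached to a generic 2-jet of a surface in $V$ be as defined in the context, let $$I_{2a}=\sigma_1(v_0^\perp),\quad I_{2b}=Q_2(v_0^\parallel,v_0^\parallel),\quad I_{2c}=Q_2(v_0^\parallel,w^\parallel),\quad I_{2d}=Q_2(w^\parallel,w^\parallel),$$ and let $\nabla_1,\nabla_2$ be the invariant derivations corresponding to the horizontal fields $v_0^\parallel$, $w^\parallel$. Then for the $G$-action on the space $J^\infty(V,2)$ of infinite jets of surfaces in $V$, the algebra $\mathcal{A}$ of differential invariants is generated by the differential invariants $I_{2a},I_{2b},I_{2c},I_{2d}$ and the invariant derivations $\nabla_1,\nabla_2$.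
   Context: Jets and invariants. $J^k(V,2)$ is the space of $k$-jets of 2-dimensional submanifolds $\Sigma\subset V$, with the partial derivatives of a local graph representation as jet-coordinates. $G$ acts on it by prolongation. A differential invariant of order $k$ is a function on $J^k(V,2)$ constant on orbits of the prolonged action; differential invariants are taken to be rational functions on the jet space, polynomial in jet-variables of order $>2$. $\mathcal{A}$ is the algebra of all differential invariants. An invariant derivation is a combination of total derivatives, with coefficients functions on a finite jet space, commuting with the prolonged action. A field of vectors tangent to $\Sigma$ determined by a finite jet of $\Sigma$ is identified with a horizontal derivation. 'Generated' (Lie–Tresse sense) means that every element of $\mathcal{A}$ is a rational expression in finitely many functions $\nabla_J I$, with $I$ one of the listed invariants and $\nabla_J$ iterated compositions of $\nabla_1,\nabla_2$. Construction (all for a generic 2-jet of $\Sigma$ at $p$). Let $v_0$ be the position vector of $p$ from the origin. Generically $\omega|_{T_p\Sigma}$ is nondegenerate, so $T_pV=T_p\Sigma\oplus T_p\Sigma^{\perp\omega}$; write $v=v^\parallel+v^\perp$ for the corresponding decomposition of $v\in T_pV$. For $\sigma\in\mathrm{Ann}(T_p\Sigma)\subset T_p^*V$ let $f$ be a function vanishing on $\Sigma$ with $d_pf=\sigma$; the quadratic form $d^2_pf|_{T_p\Sigma}$ (restriction of the Hessian) depends only on $\sigma$ and is said to correspond to $\sigma$. This gives a linear isomorphism of $\mathrm{Ann}(T_p\Sigma)$ with a 2-dimensional space $\mathcal{Q}$ of quadratic forms on $T_p\Sigma$. The form $Q_1\in\mathcal{Q}$ and the vector $w^\parallel\in T_p\Sigma$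 are determined uniquely by $Q_1(v_0^\parallel,v_0^\parallel)=0$, $\omega(v_0^\parallel,w^\parallel)=1$, $Q_1(w^\parallel,w^\parallel)=0$, $Q_1(v_0^\parallel,w^\parallel)=1$. Let $\sigma_1\in\mathrm{Ann}(T_p\Sigma)$ be the covector to which $Q_1$ corresponds. The vector $w^\perp\in T_p\Sigma^{\perp\omega}$ is determined by $\sigma_1(w^\perp)=0$, $\omega(v_0^\perp,w^\perp)=1$. The covector $\sigma_2\in\mathrm{Ann}(T_p\Sigma)$ is determined by $\sigma_2(v_0^\perp)=0$, $\sigma_2(w^\perp)=1$, and $Q_2\in\mathcal{Q}$ is the quadratic form corresponding to $\sigma_2$. *)

(* Defs.v *)
From HB Require Import structures.
From mathcomp Require Import all_boot all_order all_algebra.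
From mathcomp Require Import fraction mpoly reals.
From mathcomp Require Import zify.

Set Implicit Arguments.
Unset Strict Implicit.
Unset Printing Implicit Defensive.

Import GRing.Theory.

Local Open Scope ring_scope.

(* V is the space of column vectors of size 2 + 2, with
   coordinates (x_0, x_1, u_0, u_1).  On V we use the symplectic form
   dx_0 /\ dx_1 + du_0 /\ du_1, and surfaces are written as graphs
   u = u(x_0, x_1): such jets form a dense affine chart of J^k(V, 2), which
   therefore carries the field of rational functions of J^k(V, 2). *)

Section JetCoordinates.

Local Open Scope nat_scope.

(* The coordinates of J^k are numbered by 0, ..., jdim k - 1: first x_0, x_1,
   then the derivatives d^(i+j) u_a / dx_0^i dx_1^j, by increasing order i + j.
   In this way J^k -> J^m (m <= k) keeps the first jdim m coordinates. *)
Definition jdim (k : nat) : nat := (k.+1 * k.+2).+2.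

Definition jidx (a i j : nat) : nat :=
  ((i + j) * (i + j).+1 + 2 * j + a).+2.

Lemma jidx_lt (a i j k : nat) : a < 2 -> (jidx a i j < jdim k) = (i + j <= k).
Proof. rewrite /jidx /jdim => ha; apply/idP/idP => h; nia. Qed.

Lemma jidx_inj (a i j a' i' j' : nat) : a < 2 -> a' < 2 ->
  jidx a i j = jidx a' i' j' -> [/\ a = a', i = i' & j = j'].
Proof.
rewrite /jidx => ha ha' h.
have e : i + j = i' + j' by nia.
by rewrite e in h; split; lia.
Qed.

Lemma jidx_surj (k n : nat) : 2 <= n -> n < jdim k ->
  exists a i j, [/\ a < 2, i + j <= k & n = jidx a i j].
Proof.
rewrite /jdim => n2; elim: k => [|k IH] hn.
  by exists (n - 2), 0, 0; rewrite /jidx; split; lia.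
have [/IH [a [i [j [? ? ->]]]] | hk] := ltnP n (k.+1 * k.+2).+2.
  by exists a, i, j; split=> //; lia.
pose r := n - (k.+1 * k.+2).+2.
have hr : n = r + (k.+1 * k.+2).+2 by rewrite /r; lia.
have r2 : r < 2 * k.+2 by nia.
exists (r %% 2), (k.+1 - r %/ 2), (r %/ 2).
have jk : r %/ 2 <= k.+1 by lia.
rewrite /jidx subnK //; split; lia.
Qed.

End JetCoordinates.

Definition jet (F : Type) (k : nat) : Type := 'I_(jdim k) -> F.

(* Surfaces are polynomially parametrized germs (F^2, 0) -> V; every k-jet is
   the k-jet of such a surface.  F is the field of real numbers for actual jets,
   and the function field of J^2 for the generic 2-jet. *)
Section Surfaces.

Variable F : fieldType.

Definition surface : Type := 'I_(2 + 2) -> {mpoly F[2]}.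

Definition at0 {n : nat} (p : {mpoly F[n]}) : F := p.@[fun=> 0].

Definition eq_upto (k n : nat) (p q : {mpoly F[n]}) : Prop :=
  forall m : 'X_{1..n}, (mdeg m <= k)%N -> p@_m = q@_m.

Definition taylor (k : nat) (th : jet F k) (a : 'I_2) : {mpoly F[2]} :=
  \sum_(i < k.+1) \sum_(j < k.+1 | (i + j <= k)%N)
    (th (inord (jidx a i j)) / ((i`! * j`!)%N)%:R) *:
      ('X_ord0 ^+ i * 'X_ord_max ^+ j).

Definition graph (k : nat) (th : jet F k) : surface := fun s =>
  match split s with
  | inl e => (th (inord e))%:MP + 'X_e
  | inr a => taylor th a
  end.

(* th is the k-jet at the parameter 0 of the surface phi, which has to be a
   graph u = u(x) near that point *)
Definition has_jet (k : nat) (phi : surface) (th : jet F k) : Prop :=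
  let X (e : 'I_2) := phi (lshift 2 e) in
  let U (a : 'I_2) := phi (rshift 2 a) in
  [/\ forall e : 'I_2, at0 (X e) = th (inord e),
      \det (\matrix_(e < 2, e' < 2) at0 (X e)^`M(e')) != 0
    & forall a : 'I_2,
        eq_upto k (U a)
          (taylor th a \mPo [tuple X e - (at0 (X e))%:MP | e < 2])].

Definition omega_mx : 'M[F]_(2 + 2) :=
  let J : 'M[F]_2 :=
    \matrix_(i, j) (((i == 0) && (j == 1))%:R - ((i == 1) && (j == 0))%:R) in
  block_mx J 0 0 J.

End Surfaces.

Section SymplecticFrame.

Variable F : fieldType.

Definition omega (v w : 'cV[F]_(2 + 2)) : F := (v^T *m omega_mx F *m w) 0 0.

Definition symplectic (g : 'M[F]_(2 + 2)) : Prop :=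
  forall v w, omega (g *m v) (g *m w) = omega v w.

Definition act (g : 'M[F]_(2 + 2)) (phi : surface F) : surface F :=
  fun i => \sum_j g i j *: phi j.

Definition pairing (s : 'rV[F]_(2 + 2)) (v : 'cV[F]_(2 + 2)) : F := (s *m v) 0 0.

Variable th : jet F 2.

Definition base_point : 'cV[F]_(2 + 2) := \col_i at0 (graph th i).

(* its columns are the basis d/dx_0, d/dx_1 of the tangent plane T of the graph *)
Definition tangent_mx : 'M[F]_(2 + 2, 2) :=
  \matrix_(i < 2 + 2, e < 2) at0 (graph th i)^`M(e).

Definition tangent (v : 'cV[F]_(2 + 2)) : Prop :=
  exists c : 'cV[F]_2, v = tangent_mx *m c.

Definition normal (v : 'cV[F]_(2 + 2)) : Prop :=
  forall t, tangent t -> omega v t = 0.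

Definition annihilator (s : 'rV[F]_(2 + 2)) : Prop :=
  forall t, tangent t -> pairing s t = 0.

(* Quadratic forms on T are given by their Gram matrices in the basis
   tangent_mx, in which the coordinates of a tangent vector are its first two
   entries. *)
Definition qform (Q : 'M[F]_2) (v w : 'cV[F]_(2 + 2)) : F :=
  ((usubmx v)^T *m Q *m usubmx w) 0 0.

(* Q is the restriction to T of the Hessian of a function f which vanishes on
   the surface and has differential s at the base point.  Only the 2-jet of the
   surface is given, so f vanishes on it up to order 2. *)
Definition corresponds (s : 'rV[F]_(2 + 2)) (Q : 'M[F]_2) : Prop :=
  let p i := base_point i 0 in
  exists f : {mpoly F[2 + 2]},
    [/\ eq_upto 2 (f \mPo [tuple graph th i | i < 2 + 2]) 0,
        s = \row_i (f^`M(i)).@[p]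
      & Q = tangent_mx^T *m (\matrix_(i, j) (f^`M(i)^`M(j)).@[p])
              *m tangent_mx].

Record frame : Type := Frame {
  vpar : 'cV[F]_(2 + 2);
  vperp : 'cV[F]_(2 + 2);
  wpar : 'cV[F]_(2 + 2);
  wperp : 'cV[F]_(2 + 2);
  sigma1 : 'rV[F]_(2 + 2);
  sigma2 : 'rV[F]_(2 + 2);
  Q1 : 'M[F]_2;
  Q2 : 'M[F]_2
}.

Definition is_frame (fr : frame) : Prop :=
  [/\ [/\ base_point = vpar fr + vperp fr, tangent (vpar fr)
        & normal (vperp fr)],
      [/\ tangent (wpar fr), qform (Q1 fr) (vpar fr) (vpar fr) = 0,
          omega (vpar fr) (wpar fr) = 1, qform (Q1 fr) (wpar fr) (wpar fr) = 0
        & qform (Q1 fr) (vpar fr) (wpar fr) = 1],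
      annihilator (sigma1 fr) /\ corresponds (sigma1 fr) (Q1 fr),
      [/\ normal (wperp fr), pairing (sigma1 fr) (wperp fr) = 0
        & omega (vperp fr) (wperp fr) = 1]
    & [/\ annihilator (sigma2 fr), pairing (sigma2 fr) (vperp fr) = 0,
          pairing (sigma2 fr) (wperp fr) = 1
        & corresponds (sigma2 fr) (Q2 fr)]].

Definition I2a (fr : frame) : F := pairing (sigma1 fr) (vperp fr).
Definition I2b (fr : frame) : F := qform (Q2 fr) (vpar fr) (vpar fr).
Definition I2c (fr : frame) : F := qform (Q2 fr) (vpar fr) (wpar fr).
Definition I2d (fr : frame) : F := qform (Q2 fr) (wpar fr) (wpar fr).

End SymplecticFrame.

Section Invariants.

Variable R : realType.

Definition jring (k : nat) : Type := {mpoly R[jdim k]}.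

Definition jfield (k : nat) : Type := {fraction {mpoly R[jdim k]}}.

HB.instance Definition _ k := GRing.IntegralDomain.on (jring k).
HB.instance Definition _ k := GRing.Field.on (jfield k).

Definition tofield {k : nat} (P : jring k) : jfield k := tofrac P.

Definition num {k : nat} (f : jfield k) : jring k := \n_(repr f).
Definition den {k : nat} (f : jfield k) : jring k := \d_(repr f).

(* pull-back of functions along J^m -> J^k, meaningful for k <= m only *)
Definition pwiden {k : nat} (m : nat) (P : jring k) : jring m :=
  P \mPo [tuple 'X_(inord i) | i < jdim k].

Definition widen {k : nat} (m : nat) (f : jfield k) : jfield m :=
  tofield (pwiden m (num f)) / tofield (pwiden m (den f)).

(* D_e = d/dx_e + sum_(a, i, j) u_(a, (i, j) + e) d/du_(a, (i, j)) *)
Definition pD {k : nat} (e : 'I_2) (P : jring k) : jring k.+1 :=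
  pwiden k.+1 (P^`M(inord e)) +
  \sum_(a < 2) \sum_(i < k.+1) \sum_(j < k.+1 | (i + j <= k)%N)
    'X_(inord (jidx a (i + (e == ord0)) (j + (e == ord_max)))) *
      pwiden k.+1 (P^`M(inord (jidx a i j))).

Definition D {k : nat} (e : 'I_2) (f : jfield k) : jfield k.+1 :=
  let n := num f in let d := den f in
  tofield (pD e n * pwiden k.+1 d - pwiden k.+1 n * pD e d) /
    tofield (pwiden k.+1 d ^+ 2).

(* The 2-jet over the function field of J^2 whose coordinates are the coordinate
   functions themselves: the objects attached to it are those attached to a
   generic 2-jet, as rational functions of that jet. *)
Definition generic_jet : jet (jfield 2) 2 := fun i => tofield 'X_i.

(* The horizontal derivation of a tangent field v depending on the 2-jet: the
   total derivative D_e projects to d/dx_e, so that the components of v along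
   D_0, D_1 are its first two entries. *)
Definition nabla (v : 'cV[jfield 2]_(2 + 2)) {k : nat} (f : jfield k.+1) :
    jfield k.+2 :=
  \sum_(e < 2) widen k.+2 (v (lshift 2 e) 0) * D e f.

(* g maps the k-jet th of a surface phi to the k-jet th' of g phi.  This is a
   relation because the image of th may lie outside of the graph chart. *)
Definition prolonged {k : nat} (g : 'M[R]_(2 + 2)) (th th' : jet R k) : Prop :=
  exists phi : surface R, has_jet phi th /\ has_jet (act g phi) th'.

Definition value {k : nat} (f : jfield k) (th : jet R k) (c : R) : Prop :=
  exists P Q : jring k,
    [/\ Q.@[th] != 0, f = tofield P / tofield Q & c = P.@[th] / Q.@[th]].

(* f'(th) = f(g th) wherever both sides are defined, i.e. on a dense subset, so
   that f' = g^* f as rational functions *)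
Definition pullback {k : nat} (g : 'M[R]_(2 + 2)) (f f' : jfield k) : Prop :=
  forall (th th' : jet R k) (c c' : R), prolonged g th th' ->
    value f' th c -> value f th' c' -> c = c'.

(* polynomial in the jet variables of order > 2, with coefficients rational in
   the coordinates of order <= 2, which are the first jdim 2 ones *)
Definition poly_above2 {k : nat} (f : jfield k) : Prop :=
  exists P Q : jring k,
    [/\ Q != 0,
        forall (m : 'X_{1..jdim k}) (i : 'I_(jdim k)),
          m \in msupp Q -> (jdim 2 <= i)%N -> m i = 0%N
      & f = tofield P / tofield Q].

Definition differential_invariant {k : nat} (f : jfield k) : Prop :=
  poly_above2 f /\ (forall g, symplectic g -> pullback g f f).

Definition invariant_derivation (v : 'cV[jfield 2]_(2 + 2)) : Prop :=
  forall g, symplectic g ->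
  forall (k : nat) (f f' : jfield k.+1),
    pullback g f f' -> pullback g (nabla v f) (nabla v f').

(* the iterated derivative along J, where the letter e stands for nabla (v e) *)
Fixpoint nablas (v : 'I_2 -> 'cV[jfield 2]_(2 + 2)) (J : seq 'I_2)
    (f : jfield 2) : jfield (size J).+2 :=
  match J return jfield (size J).+2 with
  | [::] => f
  | e :: J' => nabla (v e) (nablas v J' f)
  end.

Definition eval_expr {n m : nat} (z : 'I_n -> jfield m) (P : {mpoly R[n]}) :
    jfield m :=
  mmap (fun c : R => tofield c%:MP) z P.

(* f is a rational expression in finitely many functions nabla_J I with I in
   the list s; the equality takes place in the function field of some J^m *)
Definition generated (s : seq (jfield 2)) (v : 'I_2 -> 'cV[jfield 2]_(2 + 2))
    {k : nat} (f : jfield k) : Prop :=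
  exists (n m : nat) (J : 'I_n -> seq 'I_2) (I : 'I_n -> jfield 2)
         (P Q : {mpoly R[n]}),
    let z i := widen m (nablas v (J i) (I i)) in
    [/\ (k <= m)%N,
        forall i, ((size (J i)).+2 <= m)%N,
        forall i, I i \in s,
        eval_expr z Q != 0
      & widen m f = eval_expr z P / eval_expr z Q].

Definition horizontal (fr : frame (jfield 2)) : 'I_2 -> 'cV[jfield 2]_(2 + 2) :=
  fun e => if e == 0 then vpar fr else wpar fr.

Definition listed (fr : frame (jfield 2)) : seq (jfield 2) :=
  [:: I2a fr; I2b fr; I2c fr; I2d fr].

End Invariants.

(* Main.v *)
From HB Require Import structures.
Require Import Defs.
From mathcomp Require Import all_boot all_order all_algebra.
From mathcomp Require Import fraction mpoly reals.
From mathcomp Require Import generic_quotient boolp.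
From mathcomp Require Import zify ring.

Set Implicit Arguments.
Unset Strict Implicit.
Unset Printing Implicit Defensive.

Import Order.TTheory GRing.Theory Num.Theory.

Local Open Scope ring_scope.
(** The proof follows the method of the moving frame. The vectors attached to a
    generic 2-jet, e1 = v_0^par, e2 = w^par, e3 = v_0^perp, e4 = w^perp, form a
    symplectic basis of V ([frame_basis]). They are determined by the 2-jet, and
    the conditions that determine them are preserved by linear symplectic maps:
    the frame of the image of a surface under g is the image of its frame
    ([pull_frame]). Therefore I_2a, ..., I_2d are invariant ([pull_I2]) and the
    derivations along e1 and e2 commute with the action ([pull_nab]).

    Generation rests on the structure coefficients omega (nabla_v ei, ej), for
    v = e1, e2. The derivative along v of the position vector e1 + e3 is v, and
    the normal part of nabla_v w, for w tangent to the surface, is the second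
    fundamental form; with the relations omega (ei, ej) = 0 or 1 this expresses
    all the coefficients but four by I_2a, ..., I_2d ([structure1],
    [structure2]). The other four satisfy linear equations coming from the
    integrability conditions ([codazzi], [structure_solve]), which can be solved
    because I_2b and I_2b I_2d - I_2c^2 are not identically zero
    ([generic_frame]). So every coefficient is a rational expression in the
    iterated derivatives of I_2a, ..., I_2d ([fgen_cf]). Consequently, the field
    generated by these iterated derivatives and by the entries of the matrix E
    with columns e1, ..., e4 is closed under e1 and e2, hence under the total
    derivatives D_0, D_1. Since it contains the coordinates of the point
    e1 + e3, it contains all the jet coordinates ([fgE_all]).

    A differential invariant F is therefore P (s, E) / Q (s, E), where P, Q are
    polynomials and s is a finite list of iterated derivatives. A symplectic
    matrix g fixes F and s and replaces E by g E. Given a constant symplectic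
    matrix m, one can choose g at each jet so that g E = m there; since this
    holds at almost all jets, F = P (s, m) / Q (s, m) ([separation]). If m is
    the value of E at a suitable jet, the denominator is not zero.

    All the rational functions of jets of all orders are elements of one field
    FF, which is the union of the function fields of the spaces J^k
    ([jet_field_exists]). The pull-back by g is the endomorphism of FF that
    sends each jet coordinate to that coordinate of the prolonged jet, computed
    with the derivations with respect to the new independent variables ([gjet],
    [pull_exists]). By [pullbackP] this agrees with the pull-back defined by the
    action on jets of surfaces; to see this, jets are read off the germ of a
    parametrized surface, by taking derivatives with respect to x_0, x_1 along
    the surface, and then values at the origin ([has_jetP],
    [surface_action]). *)

(** * Polynomials and fractions *)

Lemma mpoly_gen_ind (A : nzRingType) (n : nat) (P : {mpoly A[n]} -> Prop) :
    (forall c, P c%:MP) -> (forall i, P 'X_i) ->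
    (forall p q, P p -> P q -> P (p + q)) ->
    (forall p q, P p -> P q -> P (p * q)) ->
  forall p, P p.
Proof.
move=> PC PX PD PM p; rewrite [p]mpolyE.
apply: (big_ind P) => [|//|m _]; first by rewrite -mpolyC0.
rewrite -mul_mpolyC; apply: (PM) => //; rewrite mpolyXE_id.
apply: (big_ind P) => [|//|i _]; first by rewrite -mpolyC1.
elim: (m _) => [|k IH]; first by rewrite expr0 -mpolyC1.
by rewrite exprS; apply: PM.
Qed.

Lemma mpoly_hom_uniq (A : nzRingType) (n : nat) (S : nzRingType)
    (h h' : {rmorphism {mpoly A[n]} -> S}) :
    (forall c, h c%:MP = h' c%:MP) -> (forall i, h 'X_i = h' 'X_i) ->
  h =1 h'.
Proof.
move=> hC hX; apply: mpoly_gen_ind => // p q hp hq.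
  by rewrite !rmorphD hp hq.
by rewrite !rmorphM hp hq.
Qed.

(** A polynomial in n + 1 variables, seen as a polynomial in the last one; the
    form with a morphism h covers both the evaluation at a point and the
    identity. *)
Lemma muni_horner (A : comNzRingType) (n : nat) (S : comNzRingType)
    (f : {rmorphism {mpoly A[n]} -> S}) (t : S)
    (h : {rmorphism {mpoly A[n.+1]} -> S}) :
    (forall c, h c%:MP = f c%:MP) ->
    (forall i, h 'X_(widen_ord (leqnSn n) i) = f 'X_i) -> h 'X_ord_max = t ->
  forall p, h p = (map_poly f (muni p)).[t].
Proof.
move=> hC hX hm p.
rewrite -[RHS]/((horner_eval t \o map_poly f \o @muni n A) p).
apply: mpoly_hom_uniq => [c|i] /=.
  by rewrite /horner_eval muniC map_polyC hornerC.
rewrite /horner_eval /muni mmapX mmap1U.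
case: splitP => j /= ej.
  rewrite map_polyC hornerC /=.
  have -> : i = widen_ord (leqnSn n) j by apply: val_inj.
  exact: hX.
rewrite map_polyX hornerX -hm; congr (h 'X_ _); apply: val_inj.
by rewrite /= ej ord1 addn0.
Qed.

(** By induction on n: for fixed values of the other variables, the polynomial in
    the last variable has infinitely many roots, hence its coefficients vanish at
    all points. *)
Lemma mpoly_vanish (A : numDomainType) (n : nat) (p : {mpoly A[n]}) :
  (forall v, p.@[v] = 0) -> p = 0.
Proof.
elim: n p => [|n IH] p hp.
  have [c ec] : exists c, p = c%:MP.
    apply: (mpoly_gen_ind (P := fun p => exists c, p = c%:MP)) => [c|[]//|_ _ [a ->] [b ->]|_ _ [a ->] [b ->]].
    - by exists c.
    - by exists (a + b); rewrite rmorphD.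
    - by exists (a * b); rewrite rmorphM.
  by have := hp (fun=> 0); rewrite ec mevalC => ->; rewrite mpolyC0.
have muni_p : muni p = 0.
  apply/polyP => k; rewrite coef0; apply: IH => v.
  suff pv0 : map_poly (meval v) (muni p) = 0 by rewrite -coef_map pv0 coef0.
  apply: (roots_geq_poly_eq0 (rs := map (fun k => k%:R) (iota 0 (size (map_poly (meval v) (muni p)))))).
  - apply/allP => _ /mapP[t _ ->]; apply/rootP.
    pose w (i : 'I_n.+1) : A := if unlift ord_max i is Some j then v j else t%:R.
    rewrite -(@muni_horner _ _ _ _ _ (meval w)) => [|c|i|].
    - exact: hp.
    - by rewrite /= !mevalC.
    - rewrite /= !mevalXU.
      have -> : widen_ord (leqnSn n) i = lift ord_max i.
        by apply: val_inj; rewrite /= /bump leqNgt ltn_ord.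
      by rewrite /w liftK.
    - by rewrite /= mevalXU /w unlift_none.
  - by rewrite map_inj_uniq ?iota_uniq // => a b /eqP; rewrite eqr_nat => /eqP.
  - by rewrite size_map size_iota.
have <- : (map_poly (@mwiden n A) (muni p)).['X_ord_max] = p.
  rewrite -(@muni_horner _ _ _ _ _ idfun) //= => [c|i].
    by rewrite mwidenC.
  by rewrite mwidenX mnmwiden1.
by rewrite muni_p rmorph0 horner0.
Qed.

Lemma mpoly_nonvanish (A : numDomainType) (n : nat) (p : {mpoly A[n]}) :
  p != 0 -> exists v, p.@[v] != 0.
Proof.
move=> /eqP p0; apply: contrapT => h; apply: p0; apply: mpoly_vanish => v.
by apply: contrapT => /eqP pv; apply: h; exists v.
Qed.

Section FractionExtension.

Variables (A : idomainType) (L : fieldType) (h : {rmorphism A -> L}).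

(** The numerator and the denominator of the chosen representative of a fraction
    are accessible only through the quotient that defines fractions. *)
Lemma frac_split (x : {fraction A}) :
  x = @tofrac A \n_(repr x) / @tofrac A \d_(repr x).
Proof.
apply: (canRL (mulfK _)); first by rewrite tofrac_eq0; exact: denom_ratioP.
rewrite -{1}[x]reprK; set y := repr x.
have -> : @tofrac A \n_y = \pi_({fraction A})%qT (Ratio \n_y 1) by unlock tofrac.
have -> : @tofrac A \d_y = \pi_({fraction A})%qT (Ratio \d_y 1) by unlock tofrac.
rewrite -[LHS]FracField.pi_mul; apply/eqmodP.
have dy0 : \d_y != 0 by exact: denom_ratioP.
rewrite /= FracField.equivfE /FracField.mulf.
by rewrite !numden_Ratio ?mulf_neq0 ?oner_neq0 ?dy0 // !mulr1 mulrC.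
Qed.

Hypothesis h_inj : forall a, h a = 0 -> a = 0.

Lemma hom_neq0 a : a != 0 -> h a != 0.
Proof. by apply: contra_neq => /h_inj. Qed.

Definition frac_ext (x : {fraction A}) : L := h \n_(repr x) / h \d_(repr x).

Lemma frac_ext_div n d : d != 0 -> frac_ext (@tofrac A n / @tofrac A d) = h n / h d.
Proof.
move=> d0; set x := _ / _; have := frac_split x.
rewrite /frac_ext; move: (denom_ratioP (repr x)).
set n' := \n__; set d' := \d__ => d'0 /eqP.
rewrite /x eqr_div ?tofrac_eq0 // -!tofracM tofrac_eq => /eqP e.
apply/eqP; rewrite eqr_div ?hom_neq0 // -!rmorphM.
by rewrite (mulrC n') e mulrC.
Qed.

Lemma frac_ext_tofrac n : frac_ext (@tofrac A n) = h n.
Proof.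
by rewrite -[tofrac n]divr1 -tofrac1 frac_ext_div ?oner_neq0 // rmorph1 divr1.
Qed.

Lemma fracP (x : {fraction A}) :
  exists n d, d != 0 /\ x = @tofrac A n / @tofrac A d.
Proof.
by exists \n_(repr x), \d_(repr x); split; [exact: denom_ratioP|exact: frac_split].
Qed.

Lemma frac_ext_zmod : zmod_morphism frac_ext.
Proof.
move=> x y; have [n [d [d0 ->]]] := fracP x; have [n' [d' [d'0 ->]]] := fracP y.
rewrite -mulNr -tofracN addf_div ?tofrac_eq0 // -!tofracM -tofracD.
rewrite !frac_ext_div ?mulf_neq0 // rmorphD !rmorphM rmorphN.
by rewrite -mulNr addf_div ?hom_neq0 // mulNr.
Qed.

Lemma frac_ext_monoid : monoid_morphism frac_ext.
Proof.
split=> [|x y].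
  by rewrite -tofrac1 frac_ext_tofrac rmorph1.
have [n [d [d0 ->]]] := fracP x; have [n' [d' [d'0 ->]]] := fracP y.
by rewrite mulf_div -!tofracM !frac_ext_div ?mulf_neq0 // !rmorphM mulf_div.
Qed.

End FractionExtension.

(** * Functions of jets of finite order *)

Lemma jdim_le k m : (k <= m)%N -> (jdim k <= jdim m)%N.
Proof. by rewrite /jdim; nia. Qed.

Section FracHom.
Variables (A : idomainType) (L : fieldType) (h : {rmorphism A -> L}).
Hypothesis h_inj : forall a, h a = 0 -> a = 0.
(* The proof is an argument so that the morphism structures below can be found
   from the function alone. *)
Definition frac_hom (_ : forall a, h a = 0 -> a = 0) := frac_ext h.
HB.instance Definition _ :=
  GRing.isZmodMorphism.Build _ _ (frac_hom h_inj) (frac_ext_zmod h_inj).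
HB.instance Definition _ :=
  GRing.isMonoidMorphism.Build _ _ (frac_hom h_inj) (frac_ext_monoid h_inj).
End FracHom.

Section Evaluation.

Variables (R : realType) (L : comNzRingType) (j : {rmorphism R -> L}).

(** The value of a polynomial function at a sequence of jet coordinates: the
    same sequence serves for jets of all orders. *)
Definition ev (th : nat -> L) (k : nat) (P : {mpoly R[jdim k]}) : L :=
  mmap j (fun i => th i) P.

HB.instance Definition _ th k := GRing.RMorphism.copy (@ev th k)
  (mmap j (fun i : 'I_(jdim k) => th i)).

Lemma evC th k c : @ev th k c%:MP = j c.
Proof. by rewrite /ev mmapC. Qed.

Lemma evX th k i : @ev th k 'X_i = th i.
Proof. by rewrite /ev mmapX mmap1U. Qed.

Lemma ev_ext th th' k (P : {mpoly R[jdim k]}) :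
  (forall i, (i < jdim k)%N -> th i = th' i) -> ev th P = ev th' P.
Proof.
by move=> e; apply: mpoly_hom_uniq => [c|i]; rewrite /= ?evC ?evX // e.
Qed.

End Evaluation.

Section Widen.

Variable R : realType.

HB.instance Definition _ k m := GRing.RMorphism.copy (@pwiden R k m)
  (comp_mpoly [tuple 'X_(inord i) | i < jdim k]).

Lemma pwidenC k m c : @pwiden R k m c%:MP = c%:MP.
Proof. exact: comp_mpolyC. Qed.

Lemma pwidenX k m (i : 'I_(jdim k)) : @pwiden R k m 'X_i = 'X_(inord i).
Proof. by rewrite /pwiden comp_mpolyXU -tnth_nth tnth_mktuple. Qed.

Lemma ev_pwiden (L : comNzRingType) (j : {rmorphism R -> L}) th k m
    (P : {mpoly R[jdim k]}) :
  (k <= m)%N -> ev j th (pwiden m P) = ev j th P.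
Proof.
move=> km; rewrite -[LHS]/((@ev R L j th m \o @pwiden R k m) P).
apply: mpoly_hom_uniq => [c|i] /=; rewrite ?pwidenC ?evC //.
by rewrite pwidenX !evX inordK // (leq_trans (ltn_ord i)) ?jdim_le.
Qed.

Lemma ev_idfun (th : nat -> R) k (P : {mpoly R[jdim k]}) :
  ev (idfun : {rmorphism R -> R}) th P = P.@[fun i => th i].
Proof. by []. Qed.

Lemma pwiden_pwiden k m n (P : {mpoly R[jdim k]}) : (k <= m)%N -> (m <= n)%N ->
  pwiden n (pwiden m P) = pwiden n P.
Proof.
move=> km mn; rewrite -[LHS]/((@pwiden R m n \o @pwiden R k m) P).
apply: mpoly_hom_uniq => [c|i] /=; rewrite ?pwidenC // !pwidenX.
by rewrite inordK // (leq_trans (ltn_ord i)) ?jdim_le.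
Qed.

Lemma real_point_neq0 k (P : {mpoly R[jdim k]}) :
  P != 0 -> exists th, ev (idfun : {rmorphism R -> R}) th P != 0.
Proof.
move=> /mpoly_nonvanish[v Pv]; exists (fun n => v (inord n)); rewrite ev_idfun.
by rewrite (@meval_eq _ _ _ v) // => i; rewrite inord_val.
Qed.

Lemma pwiden_inj k m (P : {mpoly R[jdim k]}) : (k <= m)%N ->
  pwiden m P = 0 -> P = 0.
Proof.
move=> km e; apply/eqP; apply: contraT => /real_point_neq0[th].
by rewrite -(ev_pwiden _ _ _ km) e rmorph0 eqxx.
Qed.

Definition pwiden_frac k m : {rmorphism {mpoly R[jdim k]} -> {fraction {mpoly R[jdim m]}}} :=
  @tofrac _ \o @pwiden R k m.

Lemma pwiden_frac_inj k m (km : (k <= m)%N) P : pwiden_frac k m P = 0 -> P = 0.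
Proof. by move=> /eqP; rewrite /= tofrac_eq0 => /eqP /(pwiden_inj km). Qed.

Lemma widenE k m (km : (k <= m)%N) (f : jfield R k) :
  widen m f = frac_hom (pwiden_frac_inj km) f.
Proof. by []. Qed.

Lemma widen_div k m n d : (k <= m)%N -> d != 0 ->
  widen m (@tofield R k n / tofield d) = tofield (pwiden m n) / tofield (pwiden m d).
Proof. by move=> km; exact: (frac_ext_div (pwiden_frac_inj km)). Qed.

Lemma widen_tofield k m n : (k <= m)%N ->
  widen m (@tofield R k n) = tofield (pwiden m n).
Proof. by move=> km; exact: (frac_ext_tofrac (pwiden_frac_inj km)). Qed.

Lemma jfieldP k (f : jfield R k) :
  exists n d, d != 0 /\ f = tofield n / tofield d.
Proof. exact: fracP. Qed.

Lemma pwiden_neq0 k m (P : {mpoly R[jdim k]}) : (k <= m)%N -> P != 0 ->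
  pwiden m P != 0.
Proof. by move=> km; apply: contra_neq => /(pwiden_inj km). Qed.

Lemma widen_widen k m n (f : jfield R k) : (k <= m)%N -> (m <= n)%N ->
  widen n (widen m f) = widen n f.
Proof.
move=> km mn; have kn := leq_trans km mn.
have [p [d [d0 ->]]] := jfieldP f.
by rewrite !widen_div ?pwiden_neq0 // !pwiden_pwiden.
Qed.

End Widen.

(** * Union of a tower of fields *)

Section LimitField.

Variables (K : nat -> fieldType) (w : forall k m, K k -> K m).
Hypothesis w_hom : forall k m, (k <= m)%N ->
  exists h : {rmorphism K k -> K m}, h =1 @w k m.
Hypothesis w_comp : forall k m n f, (k <= m)%N -> (m <= n)%N ->
  w n (@w k m f) = w n f.

Lemma w_inj k m : (k <= m)%N -> injective (@w k m).
Proof. by move=> /w_hom[h hE] f g; rewrite -!hE => /fmorph_inj. Qed.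

Definition jpair : Type := {k : nat & K k}.
HB.instance Definition _ := Choice.copy jpair {k : nat & K k}.

(* Elements of the tower are compared at a common stage. *)
Definition jpair_eq (x y : jpair) : bool :=
  let m := maxn (tag x) (tag y) in
  w m (tagged x) == w m (tagged y).

Lemma jpair_eqE (x y : jpair) m : (tag x <= m)%N -> (tag y <= m)%N ->
  jpair_eq x y = (w m (tagged x) == w m (tagged y)).
Proof.
move=> xm ym; rewrite /jpair_eq; set n := maxn _ _.
have nm : (n <= m)%N by rewrite geq_max xm ym.
rewrite -(inj_eq (w_inj nm)).
by rewrite !w_comp ?leq_maxl ?leq_maxr.
Qed.

Lemma jpair_eq_refl : reflexive jpair_eq.
Proof. by move=> x; rewrite /jpair_eq eqxx. Qed.

Lemma jpair_eq_sym : ssrbool.symmetric jpair_eq.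
Proof.
move=> x y; rewrite (@jpair_eqE x y (maxn (tag x) (tag y))) ?leq_maxl ?leq_maxr //.
by rewrite (@jpair_eqE y x (maxn (tag x) (tag y))) ?leq_maxl ?leq_maxr // eq_sym.
Qed.

Lemma jpair_eq_trans : transitive jpair_eq.
Proof.
move=> y x z; set m := maxn (maxn (tag x) (tag y)) (tag z).
have [xm ym zm] : [/\ tag x <= m, tag y <= m & tag z <= m]%N.
  by rewrite /m !leq_max !leqnn ?orbT.
by rewrite !(@jpair_eqE _ _ m) // => /eqP -> /eqP ->.
Qed.

Canonical jpair_equiv := EquivRel jpair_eq jpair_eq_refl jpair_eq_sym jpair_eq_trans.

Definition jlim : Type := {eq_quot jpair_equiv}%qT.
HB.instance Definition _ : EqQuotient _ jpair_equiv jlim := EqQuotient.on jlim.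
HB.instance Definition _ := Choice.on jlim.

Definition jin k (f : K k) : jlim := (\pi_jlim (Tagged K f : jpair))%qT.

Lemma jinP (x : jlim) : exists k (f : K k), x = jin f.
Proof.
exists (tag (repr x)), (tagged (repr x)).
by rewrite /jin -[LHS]reprK; case: (repr x).
Qed.

Lemma jin_eq k m n (f : K k) (g : K m) : (k <= n)%N -> (m <= n)%N ->
  (jin f = jin g) <-> (w n f = w n g).
Proof.
move=> kn mn; split=> [/eqmodP /=|e].
  by rewrite (@jpair_eqE _ _ n) //= => /eqP.
by apply/eqmodP; rewrite /= (@jpair_eqE _ _ n) //= e.
Qed.

Lemma jin_w k m (f : K k) : (k <= m)%N -> jin (w m f) = jin f.
Proof. by move=> km; apply/(@jin_eq _ _ m) => //; rewrite w_comp. Qed.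

Lemma jin_inj k : injective (@jin k).
Proof. by move=> f g /(@jin_eq _ _ k _ _ (leqnn _) (leqnn _)) /(w_inj (leqnn k)). Qed.

Lemma jin_lift (x : jlim) : exists k, forall m, (k <= m)%N ->
  exists f : K m, x = jin f.
Proof.
have [k [f ->]] := jinP x; exists k => m km.
by exists (w m f); rewrite jin_w.
Qed.

Lemma jin2 (x y : jlim) : exists k (f g : K k), x = jin f /\ y = jin g.
Proof.
have [k hk] := jin_lift x; have [m hm] := jin_lift y.
have [f ->] := hk _ (leq_maxl k m); have [g ->] := hm _ (leq_maxr k m).
by exists (maxn k m), f, g.
Qed.

Lemma jin3 (x y z : jlim) : exists k (f g h : K k),
  [/\ x = jin f, y = jin g & z = jin h].
Proof.
have [k hk] := jin_lift x; have [m [g [h [-> ->]]]] := jin2 y z.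
have [f ->] := hk _ (leq_maxl k m).
exists (maxn k m), f, (w _ g), (w _ h).
by rewrite !jin_w ?leq_maxr.
Qed.

Definition jlim_op2 (op : forall k, K k -> K k -> K k)
    (x y : jlim) : jlim :=
  let m := maxn (tag (repr x)) (tag (repr y)) in
  jin (op m (w m (tagged (repr x))) (w m (tagged (repr y)))).

Lemma jin_repr (x : jlim) : jin (tagged (repr x)) = x.
Proof. by rewrite /jin -[RHS]reprK; case: (repr x). Qed.

Lemma jlim_op2E op k (f g : K k) :
    (forall k m (a b : K k), (k <= m)%N ->
      w m (op k a b) = op m (w m a) (w m b)) ->
  jlim_op2 op (jin f) (jin g) = jin (op k f g).
Proof.
move=> hop; rewrite /jlim_op2; set x := repr (jin f); set y := repr (jin g).
set m := maxn _ _; pose n := maxn m k.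
have [mn kn] : (m <= n /\ k <= n)%N by rewrite leq_maxl leq_maxr.
have [xm ym] : (tag x <= m /\ tag y <= m)%N by rewrite leq_maxl leq_maxr.
apply/(@jin_eq _ _ n) => //; rewrite !hop // !w_comp //; congr op.
  by apply/jin_eq => //; [apply: leq_trans mn|rewrite /x jin_repr].
by apply/jin_eq => //; [apply: leq_trans mn|rewrite /y jin_repr].
Qed.

Definition jlim_op1 (op : forall k, K k -> K k) (x : jlim) : jlim :=
  jin (op _ (tagged (repr x))).

Lemma jlim_op1E op k (f : K k) :
    (forall k m (a : K k), (k <= m)%N -> w m (op k a) = op m (w m a)) ->
  jlim_op1 op (jin f) = jin (op k f).
Proof.
move=> hop; rewrite /jlim_op1; set x := repr (jin f).
pose n := maxn (tag x) k.
have [xn kn] : (tag x <= n /\ k <= n)%N by rewrite leq_maxl leq_maxr.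
apply/(@jin_eq _ _ n) => //; rewrite !hop //; congr op.
by apply/jin_eq => //; rewrite /x jin_repr.
Qed.

Definition jlim_add := jlim_op2 (fun k f g => f + g).
Definition jlim_mul := jlim_op2 (fun k f g => f * g).
Definition jlim_opp := jlim_op1 (fun k f => - f).
Definition jlim_inv := jlim_op1 (fun k f => f^-1).
Definition jlim0 := @jin 0 0.
Definition jlim1 := @jin 0 1.

Lemma jin_add k (f g : K k) : jlim_add (jin f) (jin g) = jin (f + g).
Proof.
by rewrite /jlim_add jlim_op2E // => k' m' *; have [h hE] := @w_hom k' m' (ltac:(eassumption)); rewrite -!hE rmorphD.
Qed.

Lemma jin_mul k (f g : K k) : jlim_mul (jin f) (jin g) = jin (f * g).
Proof.
by rewrite /jlim_mul jlim_op2E // => k' m' *; have [h hE] := @w_hom k' m' (ltac:(eassumption)); rewrite -!hE rmorphM.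
Qed.

Lemma jin_opp k (f : K k) : jlim_opp (jin f) = jin (- f).
Proof.
by rewrite /jlim_opp jlim_op1E // => k' m' *; have [h hE] := @w_hom k' m' (ltac:(eassumption)); rewrite -!hE rmorphN.
Qed.

Lemma jin_inv k (f : K k) : jlim_inv (jin f) = jin (f^-1).
Proof.
by rewrite /jlim_inv jlim_op1E // => k' m' *; have [h hE] := @w_hom k' m' (ltac:(eassumption)); rewrite -!hE fmorphV.
Qed.

Lemma jin_0 k : jlim0 = @jin k 0.
Proof.
have [h hE] := @w_hom 0 k isT; have [h' hE'] := w_hom (leqnn k).
by apply/(@jin_eq 0 k k) => //; rewrite -hE -hE' !rmorph0.
Qed.

Lemma jin_1 k : jlim1 = @jin k 1.
Proof.
have [h hE] := @w_hom 0 k isT; have [h' hE'] := w_hom (leqnn k).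
by apply/(@jin_eq 0 k k) => //; rewrite -hE -hE' !rmorph1.
Qed.

Lemma jlim_addA : associative jlim_add.
Proof.
move=> x y z; have [k [f [g [h [-> -> ->]]]]] := jin3 x y z.
by rewrite !jin_add addrA.
Qed.
Lemma jlim_addC : commutative jlim_add.
Proof.
by move=> x y; have [k [f [g [-> ->]]]] := jin2 x y; rewrite !jin_add addrC.
Qed.
Lemma jlim_add0 : left_id jlim0 jlim_add.
Proof.
by move=> x; have [k [f ->]] := jinP x; rewrite (jin_0 k) jin_add add0r.
Qed.
Lemma jlim_addN : left_inverse jlim0 jlim_opp jlim_add.
Proof.
by move=> x; have [k [f ->]] := jinP x; rewrite (jin_0 k) jin_opp jin_add addNr.
Qed.
HB.instance Definition _ :=
  GRing.isZmodule.Build jlim jlim_addA jlim_addC jlim_add0 jlim_addN.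

Lemma jlim_mulA : associative jlim_mul.
Proof.
move=> x y z; have [k [f [g [h [-> -> ->]]]]] := jin3 x y z.
by rewrite !jin_mul mulrA.
Qed.
Lemma jlim_mulC : commutative jlim_mul.
Proof.
by move=> x y; have [k [f [g [-> ->]]]] := jin2 x y; rewrite !jin_mul mulrC.
Qed.
Lemma jlim_mul1 : left_id jlim1 jlim_mul.
Proof.
by move=> x; have [k [f ->]] := jinP x; rewrite (jin_1 k) jin_mul mul1r.
Qed.
Lemma jlim_mulDl : left_distributive jlim_mul jlim_add.
Proof.
move=> x y z; have [k [f [g [h [-> -> ->]]]]] := jin3 x y z.
by rewrite !(jin_mul, jin_add) mulrDl.
Qed.
Lemma jlim_1neq0 : jlim1 != jlim0.
Proof. by apply/eqP => /jin_inj /eqP; rewrite oner_eq0. Qed.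
HB.instance Definition _ :=
  GRing.Zmodule_isComNzRing.Build jlim jlim_mulA jlim_mulC jlim_mul1 jlim_mulDl jlim_1neq0.

Lemma jlim_mulV (x : jlim) : x != 0 -> jlim_mul (jlim_inv x) x = 1.
Proof.
have [k [f ->]] := jinP x => f0; rewrite -[1]/jlim1 (jin_1 k) jin_inv jin_mul mulVf //.
by apply: contra_neq f0 => ->; rewrite -(jin_0 k).
Qed.
Lemma jlim_inv0 : jlim_inv 0 = 0.
Proof. by rewrite -[0]/jlim0 jin_inv invr0. Qed.
HB.instance Definition _ := GRing.ComNzRing_isField.Build jlim jlim_mulV jlim_inv0.

Lemma jin_zmod k : zmod_morphism (@jin k).
Proof. by move=> f g; rewrite -jin_add -jin_opp. Qed.
Lemma jin_monoid k : monoid_morphism (@jin k).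
Proof. by split=> [|f g]; rewrite -?jin_mul -?jin_1. Qed.
HB.instance Definition _ k := GRing.isZmodMorphism.Build _ _ (@jin k) (@jin_zmod k).
HB.instance Definition _ k := GRing.isMonoidMorphism.Build _ _ (@jin k) (@jin_monoid k).

End LimitField.

Lemma tower_union (K : nat -> fieldType) (w : forall k m, K k -> K m) :
    (forall k m, (k <= m)%N -> exists h : {rmorphism K k -> K m}, h =1 @w k m) ->
    (forall k m n f, (k <= m)%N -> (m <= n)%N -> w m n (w k m f) = w k n f) ->
  exists (L : fieldType) (iota : forall k, {rmorphism K k -> L}),
    (forall k m f, (k <= m)%N -> iota m (w k m f) = iota k f) /\
    (forall x, exists k f, x = iota k f).
Proof.
move=> w_hom w_comp.
exists (jlim w_hom w_comp : fieldType).
exists (fun k => @jin K w w_hom w_comp k : {rmorphism _ -> _}); split.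
  by move=> k m f km; exact: jin_w.
by move=> x; exact: jinP.
Qed.

(** * The function field of infinite jets *)

(** The rational functions of jets of finite order form a tower of fields, since
    a function on J^k is also one on J^m for k <= m. *)
Lemma jet_field_exists (R : realType) :
  exists (FF : fieldType) (jF : {rmorphism R -> FF}) (gen : nat -> FF),
    (forall k (P : {mpoly R[jdim k]}), ev jF gen P = 0 -> P = 0) /\
    (forall x, exists k (P Q : {mpoly R[jdim k]}), Q != 0 /\
      x = ev jF gen P / ev jF gen Q).
Proof.
have [||] := @tower_union (fun k => {fraction {mpoly R[jdim k]}})
  (fun k m => @widen R k m).
- move=> k m km; exists (frac_hom (@pwiden_frac_inj R k m km)).
  by move=> f; rewrite widenE.
- by move=> k m n f km mn; exact: widen_widen.
move=> FF [iota [iota_w iota_surj]].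
pose jF : {rmorphism R -> FF} := iota 0 \o (@tofrac _ \o @mpolyC (jdim 0) R).
pose gen n := iota n (tofrac 'X_(inord n : 'I_(jdim n))).
have iota_pw k m (P : {mpoly R[jdim k]}) : (k <= m)%N ->
    iota m (tofrac (pwiden m P)) = iota k (tofrac P).
  by move=> km; rewrite -(iota_w k m) //; congr (iota m _); symmetry; exact: widen_tofield.
have ltn_jdim n : (n < jdim n)%N by rewrite /jdim; nia.
have evE k (P : {mpoly R[jdim k]}) : ev jF gen P = iota k (tofrac P).
  rewrite -[RHS]/((iota k \o (@tofrac _)) P); apply: mpoly_hom_uniq => [c|i].
    by rewrite /= evC /jF /= -(iota_pw 0 k) // pwidenC.
  rewrite /= evX /gen -(iota_pw i (maxn i k)) ?leq_maxl //.
  rewrite -(iota_pw k (maxn i k)) ?leq_maxr // !pwidenX inordK //.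
exists FF, jF, gen; split=> [k P|x].
  by rewrite evE => /eqP; rewrite fmorph_eq0 tofrac_eq0 => /eqP.
have [k [f ->]] := iota_surj x; have [P [Q [Q0 ->]]] := fracP f.
by exists k, P, Q; rewrite Q0 !evE fmorph_div.
Qed.

(** * Derivations *)

(** Derivations along a morphism h are needed to compare a derivation with its
    image under a field morphism. *)
Definition derivation_along (A L : nzRingType) (h d : A -> L) : Prop :=
  (forall x y, d (x + y) = d x + d y) /\
  (forall x y, d (x * y) = d x * h y + h x * d y).

Notation derivation := (derivation_along id).

Lemma mpoly_der_uniq (A : nzRingType) (n : nat) (L : nzRingType)
    (h d d' : {mpoly A[n]} -> L) :
    derivation_along h d -> derivation_along h d' ->
    (forall c, d c%:MP = d' c%:MP) -> (forall i, d 'X_i = d' 'X_i) ->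
  d =1 d'.
Proof.
move=> [dD dM] [d'D d'M] eC eX; apply: mpoly_gen_ind => // p q ep eq.
  by rewrite dD d'D ep eq.
by rewrite dM d'M ep eq.
Qed.

Section DerivationTheory.

Variables (K : fieldType) (d : K -> K).
Hypothesis dP : derivation d.

Lemma derD x y : d (x + y) = d x + d y. Proof. by case: dP. Qed.
Lemma derM x y : d (x * y) = d x * y + x * d y. Proof. by case: dP. Qed.
Lemma der0 : d 0 = 0.
Proof. by apply: (addrI (d 0)); rewrite -derD !addr0. Qed.
Lemma der1 : d 1 = 0.
Proof. by apply: (addrI (d 1)); rewrite addr0 -[in RHS](mulr1 1) derM mulr1 mul1r. Qed.
Lemma derN x : d (- x) = - d x.
Proof. by apply: (addrI (d x)); rewrite -derD !subrr der0. Qed.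
Lemma derB x y : d (x - y) = d x - d y.
Proof. by rewrite derD derN. Qed.
Lemma derV x : d x^-1 = - d x / x ^+ 2.
Proof.
have [->|x0] := eqVneq x 0; first by rewrite invr0 der0 oppr0 mul0r.
have := derM x x^-1; rewrite mulfV // der1 => /eqP.
rewrite eq_sym addr_eq0 => /eqP e.
have -> : d x^-1 = (x * d x^-1) / x by field.
have -> : x * d x^-1 = - (d x / x) by rewrite e opprK.
by field.
Qed.
Lemma derV2 x y : d (x / y) = (d x * y - x * d y) / y ^+ 2.
Proof.
have [->|y0] := eqVneq y 0.
  by rewrite invr0 mulr0 der0 expr0n invr0 mulr0.
by rewrite derM derV; field.
Qed.
Lemma der_nat n : d n%:R = 0.
Proof. by elim: n => [|n IH]; rewrite ?der0 // -addn1 natrD derD IH der1 addr0. Qed.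
Lemma der_sum (I : Type) (r : seq I) (P : pred I) (F : I -> K) :
  d (\sum_(i <- r | P i) F i) = \sum_(i <- r | P i) d (F i).
Proof. by apply: (big_morph d derD der0). Qed.

End DerivationTheory.

Lemma der_zero (K : nzRingType) : derivation (fun _ : K => 0).
Proof. by split=> x y; rewrite ?mul0r ?mulr0 ?addr0. Qed.

Lemma der_comb (K : fieldType) (d d' : K -> K) (a b : K) :
  derivation d -> derivation d' -> derivation (fun x => a * d x + b * d' x).
Proof.
by move=> dP d'P; split=> x y; rewrite ?(derD dP) ?(derM dP) ?(derD d'P) ?(derM d'P); ring.
Qed.

Lemma der_commutator (K : fieldType) (d d' : K -> K) :
  derivation d -> derivation d' -> derivation (fun x => d (d' x) - d' (d x)).
Proof.
move=> dP d'P; split=> x y.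
  by rewrite (derD d'P) (derD dP) (derD dP) (derD d'P); ring.
rewrite (derM d'P) (derM dP) !(derD d'P) !(derD dP) !(derM dP) !(derM d'P); ring.
Qed.

(** The extension to fractions is forced by the quotient rule. The derivation of
    the subring is given by its graph G, which spares the subring a type. *)
Lemma der_extend (K : fieldType) (G : K -> K -> Prop) :
    (forall p a b, G p a -> G p b -> a = b) ->
    (forall p q a b, G p a -> G q b -> G (p + q) (a + b)) ->
    (forall p q a b, G p a -> G q b -> G (p * q) (a * q + p * b)) ->
    (forall x, exists p q a b, [/\ q != 0, x = p / q, G p a & G q b]) ->
  exists d : K -> K, derivation d /\ forall p a, G p a -> d p = a.
Proof.
move=> Gfun GD GM Gspan.
have uniq p q a b p' q' a' b' : q != 0 -> q' != 0 -> p / q = p' / q' ->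
    G p a -> G q b -> G p' a' -> G q' b' ->
    (a * q - p * b) / q ^+ 2 = (a' * q' - p' * b') / q' ^+ 2.
  move=> q0 q'0 /eqP; rewrite eqr_div // => /eqP e Gp Gq Gp' Gq'.
  have {Gp Gq Gp' Gq'} := Gfun _ _ _ (GM _ _ _ _ Gp Gq') (eq_ind_r (G^~ _) (GM _ _ _ _ Gp' Gq) e).
  move=> e'; apply/eqP; rewrite eqr_div ?expf_neq0 //; apply/eqP.
  have -> : (a * q - p * b) * q' ^+ 2 = (a * q' + p * b') * q * q' - (p * q') * (b * q' + q * b') by ring.
  rewrite e' e; ring.
pose d x := let: exist p Hp := cid (Gspan x) in let: exist q Hq := cid Hp in
  let: exist a Ha := cid Hq in let: exist b _ := cid Ha in (a * q - p * b) / q ^+ 2.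
have dE p q a b : q != 0 -> G p a -> G q b -> d (p / q) = (a * q - p * b) / q ^+ 2.
  move=> q0 Gp Gq; rewrite /d; case: cid => p' Hp; case: cid => q' Hq; case: cid => a' Ha.
  by case: cid => b' [q'0 e Gp' Gq']; apply: uniq.
exists d; split; last first.
  move=> p a Gp; have [p' [q' [a' [b' [q'0 e Gp' Gq']]]]] := Gspan p.
  have p'E : p' = p * q' by rewrite e divfK.
  rewrite {1}e (dE _ _ _ _ q'0 Gp' Gq') (Gfun _ _ _ Gp' (eq_ind_r (G^~ _) (GM _ _ _ _ Gp Gq') p'E)) p'E.
  by field.
split=> x y; have [p [q [a [b [q0 -> Gp Gq]]]]] := Gspan x;
  have [p' [q' [a' [b' [q'0 -> Gp' Gq']]]]] := Gspan y.
  rewrite addf_div // (dE _ _ _ _ _ (GD _ _ _ _ (GM _ _ _ _ Gp Gq') (GM _ _ _ _ Gp' Gq))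
    (GM _ _ _ _ Gq Gq')) ?mulf_neq0 //.
  by rewrite (dE _ _ a b) // (dE _ _ a' b') //; field; rewrite q0 q'0.
rewrite mulf_div (dE _ _ _ _ _ (GM _ _ _ _ Gp Gp') (GM _ _ _ _ Gq Gq')) ?mulf_neq0 //.
by rewrite (dE _ _ a b) // (dE _ _ a' b') //; field; rewrite q0 q'0.
Qed.

(** * Jet coordinates *)

(** The inverse of the numbering of the jet coordinates: the coordinate n is the
    derivative of u_(ja n) of bidegree (ji n, jj n), of order jord n. *)
Definition jord (n : nat) : nat := count (fun k => (jdim k <= n)%N) (iota 0 n).
Definition jrest (n : nat) : nat := n - 2 - jord n * (jord n).+1.
Definition ja (n : nat) : nat := jrest n %% 2.
Definition jj (n : nat) : nat := jrest n %/ 2.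
Definition ji (n : nat) : nat := jord n - jj n.

Lemma jord_jidx a i j : (a < 2)%N -> jord (jidx a i j) = (i + j)%N.
Proof.
move=> a2; rewrite /jord.
rewrite (eq_count (a2 := fun k => k < i + j)%N); last first.
  by move=> k /=; rewrite leqNgt jidx_lt // -ltnNge.
have le : (i + j <= jidx a i j)%N by rewrite /jidx; nia.
rewrite -(subnKC le) iotaD count_cat add0n.
rewrite (eq_in_count (a2 := predT)); last by move=> k; rewrite mem_iota => /andP[].
rewrite count_predT size_iota (eq_in_count (a2 := pred0)) ?count_pred0 ?addn0 //.
by move=> k; rewrite mem_iota => /andP[h _]; rewrite ltnNge h.
Qed.

Lemma jdecode a i j : (a < 2)%N ->
  [/\ ja (jidx a i j) = a, ji (jidx a i j) = i & jj (jidx a i j) = j].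
Proof.
move=> a2; rewrite /ji /jj /ja /jrest jord_jidx //.
have -> : (jidx a i j - 2 - (i + j) * (i + j).+1 = 2 * j + a)%N by rewrite /jidx; lia.
have -> : ((2 * j + a) %/ 2 = j)%N by lia.
split=> //; lia.
Qed.

Lemma jcoord_ind (P : nat -> Prop) :
    P 0%N -> P 1%N -> (forall a i j, (a < 2)%N -> P (jidx a i j)) ->
  forall n, P n.
Proof.
move=> P0 P1 PJ [|[|n]] //.
have hn : (n.+2 < jdim n.+2)%N by rewrite /jdim; nia.
by have [a [i [j [a2 _ ->]]]] := @jidx_surj _ _ (isT : 1 < n.+2)%N hn; apply: PJ.
Qed.

(** The total derivative of the n-th jet coordinate: increasing one index for a
    derivative of u, and a constant for x_0 and x_1. *)
Definition dnext (L : nzRingType) (th : nat -> L) (e : 'I_2) (n : nat) : L :=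
  if (n < 2)%N then (n == e)%:R
  else th (jidx (ja n) (ji n + (e == ord0)) (jj n + (e == ord_max))).

Lemma dnext_base (L : nzRingType) (th : nat -> L) e n : (n < 2)%N ->
  dnext th e n = (n == e)%:R.
Proof. by rewrite /dnext => ->. Qed.

Lemma dnext_jidx (L : nzRingType) (th : nat -> L) e a i j : (a < 2)%N ->
  dnext th e (jidx a i j) = th (jidx a (i + (e == ord0)) (j + (e == ord_max))).
Proof. by move=> a2; rewrite /dnext; have [-> -> ->] := jdecode i j a2. Qed.

Lemma jdim_pos k : (1 < jdim k)%N.
Proof. by []. Qed.

Lemma jcoord_lt (P : nat -> Prop) k :
    P 0%N -> P 1%N -> (forall a i j, (a < 2)%N -> (i + j <= k)%N -> P (jidx a i j)) ->
  forall n, (n < jdim k)%N -> P n.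
Proof.
move=> P0 P1 PJ [|[|n]] // hn.
by have [a [i [j [a2 ij ->]]]] := @jidx_surj _ _ (isT : 1 < n.+2)%N hn; apply: PJ.
Qed.

(** * Substitutions and vector fields *)

Lemma rmorphism_of (A B : nzRingType) (f : A -> B) :
    (forall x y, f (x - y) = f x - f y) -> f 1 = 1 ->
    (forall x y, f (x * y) = f x * f y) ->
  exists h : {rmorphism A -> B}, h =1 f.
Proof.
move=> fB f1 fM.
pose add := GRing.isZmodMorphism.Build A B f fB.
pose mul := GRing.isMonoidMorphism.Build A B f (conj f1 fM).
by exists (HB.pack f add mul : {rmorphism A -> B}).
Qed.

(** The jet coordinates gen n are algebraically independent over the constants,
    and generate the field. *)
Definition jet_field (R : realType) (FF : fieldType) (jF : {rmorphism R -> FF})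
    (gen : nat -> FF) : Prop :=
  (forall k (P : {mpoly R[jdim k]}), ev jF gen P = 0 -> P = 0) /\
  (forall x, exists k (P Q : {mpoly R[jdim k]}), Q != 0 /\
      x = ev jF gen P / ev jF gen Q).

Section JetField.

Variables (R : realType) (FF : fieldType) (jF : {rmorphism R -> FF}).
Variable (gen : nat -> FF).
Hypothesis FFP : jet_field jF gen.

Lemma jet_indep k (P : {mpoly R[jdim k]}) : ev jF gen P = 0 -> P = 0.
Proof. by case: FFP => h _; exact: h. Qed.

Lemma jet_span x : exists k (P Q : {mpoly R[jdim k]}), Q != 0 /\
      x = ev jF gen P / ev jF gen Q.
Proof. by case: FFP => _. Qed.

Lemma jet_neq0 k (P : {mpoly R[jdim k]}) : P != 0 -> ev jF gen P != 0.
Proof. by apply: contra_neq => /jet_indep. Qed.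

Lemma jet_span_lift x : exists k, forall m, (k <= m)%N ->
  exists (P Q : {mpoly R[jdim m]}), Q != 0 /\ x = ev jF gen P / ev jF gen Q.
Proof.
have [k [P [Q [Q0 e]]]] := jet_span x; exists k => m km.
exists (pwiden m P), (pwiden m Q); split; first exact: pwiden_neq0.
by rewrite !ev_pwiden.
Qed.

Lemma jet_span2 x y : exists k (P Q P' Q' : {mpoly R[jdim k]}),
  [/\ Q != 0, Q' != 0, x = ev jF gen P / ev jF gen Q & y = ev jF gen P' / ev jF gen Q'].
Proof.
have [k hk] := jet_span_lift x; have [m hm] := jet_span_lift y.
have [P [Q [Q0 e]]] := hk _ (leq_maxl k m).
have [P' [Q' [Q'0 e']]] := hm _ (leq_maxr k m).
by exists (maxn k m), P, Q, P', Q'.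
Qed.

(** An equality of fractions in the independent elements gen n becomes, without
    denominators, an identity of polynomials, which holds at every point. *)
Lemma jet_cross k m (P Q : {mpoly R[jdim k]}) (P' Q' : {mpoly R[jdim m]})
    (L : comNzRingType) (j : {rmorphism R -> L}) (th : nat -> L) :
    Q != 0 -> Q' != 0 ->
    ev jF gen P / ev jF gen Q = ev jF gen P' / ev jF gen Q' ->
  ev j th P * ev j th Q' = ev j th P' * ev j th Q.
Proof.
move=> Q0 Q'0 /eqP; rewrite eqr_div ?jet_neq0 // => /eqP e.
have [kn mn] : (k <= maxn k m /\ m <= maxn k m)%N by rewrite leq_maxl leq_maxr.
rewrite -(ev_pwiden j th P kn) -(ev_pwiden j th Q' mn).
rewrite -(ev_pwiden j th P' mn) -(ev_pwiden j th Q kn) -!rmorphM /=; congr ev.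
apply/eqP; rewrite -subr_eq0; apply/eqP/jet_indep.
by rewrite rmorphB !rmorphM /= !ev_pwiden // e subrr.
Qed.

(** At algebraically independent points T n no denominator vanishes, so that all
    the rational functions can be evaluated there. *)
Lemma jet_subst (L : fieldType) (j : {rmorphism R -> L}) (T : nat -> L) :
    (forall k (P : {mpoly R[jdim k]}), ev j T P = 0 -> P = 0) ->
  exists h : {rmorphism FF -> L},
    (forall c, h (jF c) = j c) /\ (forall n, h (gen n) = T n).
Proof.
move=> Tind.
have Tn0 k (P : {mpoly R[jdim k]}) : P != 0 -> ev j T P != 0.
  by apply: contra_neq => /Tind.
pose f x := let: exist k Hk := cid (jet_span x) in let: exist P HP := cid Hk in
  let: exist Q _ := cid HP in ev j T P / ev j T Q.
have fE k (P Q : {mpoly R[jdim k]}) : Q != 0 ->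
    f (ev jF gen P / ev jF gen Q) = ev j T P / ev j T Q.
  move=> Q0; rewrite /f; case: cid => k' Hk; case: cid => P' HP; case: cid => Q' [Q'0 e].
  by apply/eqP; rewrite eqr_div ?Tn0 // (jet_cross j T Q'0 Q0 (esym e)).
have f1 k (P : {mpoly R[jdim k]}) : f (ev jF gen P) = ev j T P.
  by have := fE k P 1 (oner_neq0 _); rewrite !rmorph1 !divr1.
have [||x y|h hE] := @rmorphism_of FF L f.
- move=> x y; have [k [P [Q [P' [Q' [Q0 Q'0 -> ->]]]]]] := jet_span2 x y.
  rewrite -mulNr addf_div ?jet_neq0 // -rmorphN -!rmorphM -rmorphD.
  by rewrite !fE ?mulf_neq0 // rmorphD !rmorphM rmorphN -mulNr addf_div ?Tn0.
- by have := f1 0%N 1; rewrite !rmorph1.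
- have [k [P [Q [P' [Q' [Q0 Q'0 -> ->]]]]]] := jet_span2 x y.
  by rewrite mulf_div -!rmorphM !fE ?mulf_neq0 // !rmorphM mulf_div.
exists h; split=> [c|n]; rewrite hE.
  by have := f1 0%N c%:MP; rewrite !evC.
have hn : (n < jdim n)%N by rewrite /jdim; nia.
by have := f1 n 'X_(Ordinal hn); rewrite !evX.
Qed.

Lemma jet_hom_ev (L : fieldType) (h : {rmorphism FF -> L}) (j : {rmorphism R -> L})
    (T : nat -> L) k (P : {mpoly R[jdim k]}) :
    (forall c, h (jF c) = j c) -> (forall n, h (gen n) = T n) ->
  h (ev jF gen P) = ev j T P.
Proof.
move=> hc hg; rewrite -[LHS]/((h \o (@ev R FF jF gen k)) P).
by apply: mpoly_hom_uniq => [c|i]; rewrite /= ?evC ?evX.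
Qed.

(** The derivative of a polynomial along the vector field v. *)
Definition polyder (v : nat -> FF) k (P : {mpoly R[jdim k]}) : FF :=
  \sum_(i < jdim k) ev jF gen P^`M(i) * v i.

Lemma polyder_der v k : derivation_along (@ev R FF jF gen k) (@polyder v k).
Proof.
split=> P Q; rewrite /polyder.
  by rewrite -big_split /=; apply: eq_bigr => i _; rewrite mderivD rmorphD mulrDl.
rewrite mulr_suml mulr_sumr -big_split /=; apply: eq_bigr => i _.
by rewrite mderivM rmorphD !rmorphM /=; ring.
Qed.

Lemma polyderC v k c : @polyder v k c%:MP = 0.
Proof. by rewrite /polyder big1 // => i _; rewrite mderivC rmorph0 mul0r. Qed.

Lemma mderivXU (A : nzRingType) n (i j : 'I_n) : ('X_j : {mpoly A[n]})^`M(i) = (j == i)%:R.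
Proof.
rewrite mderivX mnmE; have [->|_] := eqVneq j i; last by rewrite scale0r.
suff -> : (U_(i) - U_(i))%MM = 0%MM by rewrite scale1r mpolyX0.
by apply/mnmP => l; rewrite mnmBE subnn mnmE.
Qed.

Lemma polyderX v k i : @polyder v k 'X_i = v i.
Proof.
rewrite /polyder (bigD1 i) //= big1 ?addr0 => [|l li].
  by rewrite mderivXU eqxx rmorph1 mul1r.
by rewrite mderivXU eq_sym (negbTE li) rmorph0 mul0r.
Qed.

(** A vector field on the jet space is a derivation of the rational functions. *)
Lemma jet_der_exists (v : nat -> FF) : exists d : FF -> FF,
  [/\ derivation d, forall c, d (jF c) = 0 & forall n, d (gen n) = v n].
Proof.
pose G p a := exists k (P : {mpoly R[jdim k]}), p = ev jF gen P /\ a = polyder v P.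
have pw k m (P : {mpoly R[jdim k]}) : (k <= m)%N -> polyder v (pwiden m P) = polyder v P.
  move=> km; apply: (@mpoly_der_uniq _ _ _ (@ev R FF jF gen k)
     (fun P => polyder v (pwiden m P)) _ _ (@polyder_der v k)) => [|c|i].
  - split=> p q; first by rewrite rmorphD (polyder_der v m).1.
    by rewrite rmorphM (polyder_der v m).2 !ev_pwiden.
  - by rewrite pwidenC !polyderC.
  - by rewrite pwidenX !polyderX inordK // (leq_trans (ltn_ord i)) ?jdim_le.
have G2 p q a b : G p a -> G q b -> exists k (P Q : {mpoly R[jdim k]}),
    [/\ p = ev jF gen P, a = polyder v P, q = ev jF gen Q & b = polyder v Q].
  move=> [k [P [-> ->]]] [m [Q [-> ->]]].
  exists (maxn k m), (pwiden _ P), (pwiden _ Q).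
  by rewrite !ev_pwiden ?pw ?leq_maxl ?leq_maxr.
have [||||d [dd dG]] := @der_extend FF G.
- move=> p a b Ga Gb; have [k [P [Q [-> -> + ->]]]] := G2 _ _ _ _ Ga Gb.
  move=> /eqP; rewrite -subr_eq0 -rmorphB => /eqP /jet_indep /eqP.
  by rewrite subr_eq0 => /eqP ->.
- move=> p q a b Ga Gb; have [k [P [Q [-> -> -> ->]]]] := G2 _ _ _ _ Ga Gb.
  by exists k, (P + Q); rewrite rmorphD (polyder_der v k).1.
- move=> p q a b Ga Gb; have [k [P [Q [-> -> -> ->]]]] := G2 _ _ _ _ Ga Gb.
  by exists k, (P * Q); rewrite rmorphM (polyder_der v k).2.
- move=> x; have [k [P [Q [Q0 ->]]]] := jet_span x.
  exists (ev jF gen P), (ev jF gen Q), (polyder v P), (polyder v Q).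
  by rewrite jet_neq0 //; split=> //; [exists k, P|exists k, Q].
exists d; split=> // [c|n]; apply: dG.
  by exists 0%N, c%:MP; rewrite evC polyderC.
have hn : (n < jdim n)%N by rewrite /jdim; nia.
by exists n, 'X_(Ordinal hn); rewrite evX polyderX.
Qed.

Lemma der_ev (L : fieldType) (j : {rmorphism R -> L}) (th : nat -> L) (d : L -> L) k (P : {mpoly R[jdim k]}) :
    derivation d -> (forall c, d (j c) = 0) ->
  d (ev j th P) = \sum_(i < jdim k) ev j th P^`M(i) * d (th i).
Proof.
move=> dd dj; move: P.
apply: (@mpoly_der_uniq _ _ _ (@ev R L j th k) (fun P => d (ev j th P))) => [||c|i].
- by split=> p q; rewrite (rmorphD, rmorphM) ?(derD dd) ?(derM dd).
- split=> P Q.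
    by rewrite -big_split /=; apply: eq_bigr => i _; rewrite mderivD rmorphD mulrDl.
  rewrite mulr_suml mulr_sumr -big_split /=; apply: eq_bigr => i _.
  by rewrite mderivM rmorphD !rmorphM /=; ring.
- by rewrite evC dj big1 // => i _; rewrite mderivC rmorph0 mul0r.
- rewrite evX (bigD1 i) //= big1 ?addr0 => [|l li].
    by rewrite mderivXU eqxx rmorph1 mul1r.
  by rewrite mderivXU eq_sym (negbTE li) rmorph0 mul0r.
Qed.

Lemma jet_der_uniq (L : fieldType) (h : {rmorphism FF -> L}) (d d' : FF -> L) :
    derivation_along h d -> derivation_along h d' ->
    (forall c, d (jF c) = d' (jF c)) -> (forall n, d (gen n) = d' (gen n)) ->
  d =1 d'.
Proof.
move=> dd dd' ec eg x; have [k [P [Q [Q0 ->]]]] := jet_span x.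
have e (p : {mpoly R[jdim k]}) : d (ev jF gen p) = d' (ev jF gen p).
  move: p; apply: (@mpoly_der_uniq _ _ _ (fun p => h (ev jF gen p))
    (fun p => d (ev jF gen p)) (fun p => d' (ev jF gen p))) => [||c|i].
  - by split=> p q; rewrite (rmorphD, rmorphM) (dd.1, dd.2).
  - by split=> p q; rewrite (rmorphD, rmorphM) (dd'.1, dd'.2).
  - by rewrite !evC.
  - by rewrite !evX.
set p := ev jF gen P; set q := ev jF gen Q.
have hq0 : h q != 0 by rewrite fmorph_eq0 jet_neq0.
have pE : p = p / q * q by rewrite divfK // jet_neq0.
have e1 : d p = d (p / q) * h q + h (p / q) * d q by rewrite -dd.2 -pE.
have e2 : d' p = d' (p / q) * h q + h (p / q) * d' q by rewrite -dd'.2 -pE.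
by move: e1; rewrite /p e -/p e2 /q e -/q => /addIr /(mulIf hq0) ->.
Qed.

End JetField.

(** * Total derivatives and values of rational functions *)

Definition total_derivatives (R : realType) (FF : fieldType)
    (jF : {rmorphism R -> FF}) (gen : nat -> FF) (D : 'I_2 -> FF -> FF) : Prop :=
  forall e, [/\ derivation (D e), forall c, D e (jF c) = 0
    & forall n, D e (gen n) = dnext gen e n].

Section TotalDerivatives.

Variables (R : realType) (FF : fieldType) (jF : {rmorphism R -> FF}).
Variable (gen : nat -> FF).
Hypothesis FFP : jet_field jF gen.

Lemma total_derivatives_exist : exists D, total_derivatives jF gen D.
Proof.
exists (fun e => sval (cid (jet_der_exists FFP (dnext gen e)))) => e.
by case: cid.
Qed.

Variable D : 'I_2 -> FF -> FF.
Hypothesis DP : total_derivatives jF gen D.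

Lemma D_der e : derivation (D e). Proof. by case: (DP e). Qed.
Lemma D_const e c : D e (jF c) = 0. Proof. by case: (DP e) => _ ->. Qed.
Lemma D_gen e n : D e (gen n) = dnext gen e n. Proof. by case: (DP e) => _ _ ->. Qed.

(** The commutator is a derivation, hence it suffices to see that it vanishes on
    the jet coordinates. *)
Lemma D_comm e e' x : D e (D e' x) = D e' (D e x).
Proof.
apply/eqP; rewrite -subr_eq0; apply/eqP; move: x.
apply: (@jet_der_uniq _ _ _ _ FFP FF idfun _ (fun=> 0)) => [||c|].
- by apply: der_commutator; exact: D_der.
- exact: der_zero.
- by rewrite !D_const !(der0 (D_der _)) subrr.
elim/jcoord_ind => [||a i j a2]; rewrite !D_gen.
- by rewrite !dnext_base // !(der_nat (D_der _)) subrr.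
- by rewrite !dnext_base // !(der_nat (D_der _)) subrr.
by rewrite !dnext_jidx ?ltn_mod // addnAC [(jj _ + _ + _)%N]addnAC subrr.
Qed.

Section Value.

(** The denominators have to take values in U: the nonzero reals for values at
    real jets, and the functions invertible at the origin for values along a
    surface. *)
Variables (L : fieldType) (j : {rmorphism R -> L}) (U : L -> Prop).
Hypotheses (U1 : U 1) (UM : forall x y, U x -> U y -> U (x * y)) (U0 : ~ U 0).

Definition at_jet (k : nat) (th : nat -> L) (f : FF) (c : L) : Prop :=
  exists P Q : {mpoly R[jdim k]}, [/\ U (ev j th Q),
    f = ev jF gen P / ev jF gen Q & c = ev j th P / ev j th Q].

Lemma U_neq0 x : U x -> x != 0.
Proof. by move=> Ux; apply: contra_notN U0 => /eqP <-. Qed.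

Lemma U_den k th (Q : {mpoly R[jdim k]}) : U (ev j th Q) -> Q != 0.
Proof. by move=> /U_neq0; apply: contra_neq => ->; rewrite rmorph0. Qed.

Lemma at_uniq k k' th f c c' : at_jet k th f c -> at_jet k' th f c' -> c = c'.
Proof.
move=> [P [Q [UQ -> ->]]] [P' [Q' [UQ' e ->]]].
apply/eqP; rewrite eqr_div ?U_neq0 //; apply/eqP.
exact: (jet_cross FFP j th (U_den UQ) (U_den UQ') e).
Qed.

Lemma at_le k m th f c : (k <= m)%N -> at_jet k th f c -> at_jet m th f c.
Proof.
move=> km [P [Q [UQ -> ->]]]; exists (pwiden m P), (pwiden m Q).
by rewrite !ev_pwiden.
Qed.

Lemma at_ext k th th' f c : (forall n, (n < jdim k)%N -> th n = th' n) ->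
  at_jet k th f c -> at_jet k th' f c.
Proof.
move=> e [P [Q [UQ -> ->]]]; exists P, Q.
by rewrite -!(ev_ext j _ e).
Qed.

Lemma at_poly k th (P : {mpoly R[jdim k]}) : at_jet k th (ev jF gen P) (ev j th P).
Proof. by exists P, 1; rewrite !rmorph1 !divr1. Qed.

Lemma at_const k th c : at_jet k th (jF c) (j c).
Proof. by have := @at_poly k th c%:MP; rewrite !evC. Qed.

Lemma at_gen k th n : (n < jdim k)%N -> at_jet k th (gen n) (th n).
Proof. by move=> h; have := @at_poly k th 'X_(Ordinal h); rewrite !evX. Qed.

Lemma at_add k th f g c d : at_jet k th f c -> at_jet k th g d ->
  at_jet k th (f + g) (c + d).
Proof.
move=> [P [Q [UQ -> ->]]] [P' [Q' [UQ' -> ->]]].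
exists (P * Q' + P' * Q), (Q * Q').
rewrite !rmorphD !rmorphM !addf_div ?U_neq0 ?(jet_neq0 FFP) ?(U_den UQ) ?(U_den UQ') //.
by split=> //; exact: UM.
Qed.

Lemma at_mul k th f g c d : at_jet k th f c -> at_jet k th g d ->
  at_jet k th (f * g) (c * d).
Proof.
move=> [P [Q [UQ -> ->]]] [P' [Q' [UQ' -> ->]]].
exists (P * P'), (Q * Q').
by rewrite !rmorphM !mulf_div; split=> //; exact: UM.
Qed.

Lemma at_opp k th f c : at_jet k th f c -> at_jet k th (- f) (- c).
Proof.
by move=> [P [Q [UQ -> ->]]]; exists (- P), Q; rewrite !rmorphN !mulNr.
Qed.

Lemma at_sub k th f g c d : at_jet k th f c -> at_jet k th g d ->
  at_jet k th (f - g) (c - d).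
Proof. by move=> hf hg; apply: at_add => //; exact: at_opp. Qed.

Lemma at_inv k th f c : at_jet k th f c -> U c -> at_jet k th f^-1 c^-1.
Proof.
move=> [P [Q [UQ -> ->]]] Uc; exists Q, P; rewrite !invf_div; split=> //.
by rewrite -(divfK (U_neq0 UQ) (ev j th P)); exact: UM.
Qed.

Lemma at_div k th f g c d : at_jet k th f c -> at_jet k th g d -> U d ->
  at_jet k th (f / g) (c / d).
Proof. by move=> hf hg Ud; apply: at_mul => //; exact: at_inv. Qed.

Lemma at_0 k th : at_jet k th 0 0.
Proof. by have := at_const k th 0; rewrite !rmorph0. Qed.

Lemma at_1 k th : at_jet k th 1 1.
Proof. by have := at_const k th 1; rewrite !rmorph1. Qed.

Lemma at_sum k th (I : Type) (r : seq I) (P : pred I) (F : I -> FF) (G : I -> L) :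
    (forall i, at_jet k th (F i) (G i)) ->
  at_jet k th (\sum_(i <- r | P i) F i) (\sum_(i <- r | P i) G i).
Proof.
move=> h; apply: (big_ind2 (at_jet k th)) => //; first exact: at_0.
by move=> *; exact: at_add.
Qed.

Lemma at_mmap k th n (F : 'I_n -> FF) (G : 'I_n -> L) (P : {mpoly R[n]}) :
    (forall i, at_jet k th (F i) (G i)) ->
  at_jet k th (mmap jF F P) (mmap j G P).
Proof.
move=> h; apply: (mpoly_gen_ind (P := fun P => at_jet k th (mmap jF F P) (mmap j G P))) => [c|i|p q|p q].
- by rewrite !mmapC; exact: at_const.
- by rewrite !mmapX !mmap1U.
- by rewrite !mmapD; exact: at_add.
- by rewrite !rmorphM; exact: at_mul.
Qed.

Lemma jidx_next_lt k n (e : 'I_2) : (n < jdim k)%N -> (1 < n)%N ->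
  (jidx (ja n) (ji n + (e == ord0)) (jj n + (e == ord_max)) < jdim k.+1)%N.
Proof.
elim/jcoord_lt => // a i l a2 il _; have [-> -> ->] := jdecode i l a2.
rewrite jidx_lt //; case: e => -[|[|//]] /= _; lia.
Qed.

Lemma at_dnext k th e n : (n < jdim k)%N ->
  at_jet k.+1 th (dnext gen e n) (dnext th e n).
Proof.
move=> hn; rewrite /dnext; case: ltnP => n2.
  have := at_const k.+1 th (n == e)%:R; rewrite !rmorph_nat //.
by apply: at_gen; exact: jidx_next_lt.
Qed.

(** If the jet th moves along a surface, with parameter derivation d, then the
    derivative of the value of f is the value of the total derivative, by the
    chain rule. *)
Lemma at_der k th (d : L -> L) e f c :
    derivation d -> (forall c, d (j c) = 0) ->
    (forall n, (n < jdim k)%N -> d (th n) = dnext th e n) ->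
  at_jet k th f c -> at_jet k.+1 th (D e f) (d c).
Proof.
move=> dd dj dth [P [Q [UQ -> ->]]].
have at_D (p : {mpoly R[jdim k]}) : at_jet k.+1 th (D e (ev jF gen p)) (d (ev j th p)).
  rewrite (der_ev _ _ (D_der e)); last exact: D_const.
  rewrite (der_ev _ _ dd) //; apply: at_sum => i; apply: at_mul.
    by apply: (@at_le k) => //; exact: at_poly.
  by rewrite D_gen dth //; exact: at_dnext.
rewrite (derV2 (D_der e)) (derV2 dd).
have at_p (p : {mpoly R[jdim k]}) : at_jet k.+1 th (ev jF gen p) (ev j th p).
  by apply: (@at_le k) => //; exact: at_poly.
apply: at_div; last by rewrite expr2; exact: UM.
  by apply: at_sub; apply: at_mul.
by rewrite !expr2; apply: at_mul.
Qed.

Lemma at_D_regular k th e f c : at_jet k th f c -> exists c', at_jet k.+1 th (D e f) c'.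
Proof.
move=> [P [Q [UQ -> _]]].
have at_D (p : {mpoly R[jdim k]}) : exists c', at_jet k.+1 th (D e (ev jF gen p)) c'.
  rewrite (der_ev _ _ (D_der e)); last exact: D_const.
  exists (\sum_(i < jdim k) ev j th p^`M(i) * dnext th e i); apply: at_sum => i; apply: at_mul.
    by apply: (@at_le k) => //; exact: at_poly.
  by rewrite D_gen; exact: at_dnext.
have at_p (p : {mpoly R[jdim k]}) : at_jet k.+1 th (ev jF gen p) (ev j th p).
  by apply: (@at_le k) => //; exact: at_poly.
have [cP hP] := at_D P; have [cQ hQ] := at_D Q.
exists ((cP * ev j th Q - ev j th P * cQ) / ev j th Q ^+ 2).
rewrite (derV2 (D_der e)); apply: at_div; last by rewrite expr2; exact: UM.
  by apply: at_sub; apply: at_mul.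
by rewrite !expr2; apply: at_mul.
Qed.

End Value.

(** The product W of all the denominators and of all the nonzero numerators is a
    nonzero polynomial, so it does not vanish at some real point. *)
Lemma regular_jet (s : seq FF) : exists k th, forall f, f \in s ->
  exists c, at_jet idfun (fun x : R => x != 0) k th f c /\ (f != 0 -> c != 0).
Proof.
have [k [W [W0 hW]]] : exists k (W : {mpoly R[jdim k]}), W != 0 /\
    forall f, f \in s -> exists P Q : {mpoly R[jdim k]},
      [/\ Q != 0, f = ev jF gen P / ev jF gen Q &
       forall th, ev idfun th W != 0 -> ev idfun th Q != 0 /\ (P != 0 -> ev idfun th P != 0)].
  elim: s => [|f s [k [W [W0 IH]]]]; first by exists 0%N, 1; rewrite oner_neq0.
  have [k' hk'] := jet_span_lift FFP f.
  have [P [Q [Q0 fE]]] := hk' _ (leq_maxr k k'); set m := maxn k k' in P Q Q0 fE.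
  have km : (k <= m)%N by rewrite leq_maxl.
  pose P' := if P == 0 then 1 else P.
  have P'0 : P' != 0 by rewrite /P'; case: ifP => [_|/negbT //]; rewrite oner_neq0.
  exists m, (pwiden m W * Q * P').
  split; first by rewrite !mulf_neq0 // pwiden_neq0.
  move=> g; rewrite inE => /orP[/eqP ->|/IH[P1 [Q1 [Q10 gE h]]]].
    exists P, Q; split=> // th; rewrite !rmorphM !mulf_eq0 !negb_or => /andP[/andP[_ Qth] P'th].
    by split=> // /negbTE P0; move: P'th; rewrite /P' P0.
  exists (pwiden m P1), (pwiden m Q1); split; [exact: pwiden_neq0|by rewrite !ev_pwiden|move=> th].
  rewrite !rmorphM /= !mulf_eq0 !negb_or !ev_pwiden // => /andP[/andP[hWth _] _].
  have [Q1n0 P1n0] := h th hWth.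
  split=> // pP1; apply: P1n0; move: pP1; apply: contra_neq => ->; exact: rmorph0.
have [th Wth] := real_point_neq0 W0.
exists k, th => f /hW[P [Q [Q0 fE h]]]; have [Qth Pth] := h th Wth.
exists (ev idfun th P / ev idfun th Q); split; first by exists P, Q.
move=> f0; rewrite mulf_neq0 ?invr_neq0 // Pth //.
by apply: contra_neq f0 => P0; rewrite fE P0 rmorph0 mul0r.
Qed.

End TotalDerivatives.

(** * Change of independent variables *)

Lemma ord2P (P : 'I_2 -> Prop) : P ord0 -> P ord_max -> forall e, P e.
Proof.
by move=> P0 P1 [[|[|n]] h] //; [move: P0|move: P1]; congr P; apply: val_inj.
Qed.

Section ChangeOfVariables.

Variables (K : fieldType) (d : 'I_2 -> K -> K).
Hypotheses (dP : forall e, derivation (d e))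
  (dC : forall e e' x, d e (d e' x) = d e' (d e x)).

Definition jacobian (X : nat -> K) : K :=
  d ord0 (X 0) * d ord_max (X 1) - d ord0 (X 1) * d ord_max (X 0).

(** The partial derivatives with respect to the new independent variables X 0
    and X 1, by Cramer's rule. *)
Definition dchange (X : nat -> K) (e : 'I_2) (f : K) : K :=
  if e == ord0 then
    (d ord_max (X 1) * d ord0 f - d ord0 (X 1) * d ord_max f) / jacobian X
  else (d ord0 (X 0) * d ord_max f - d ord_max (X 0) * d ord0 f) / jacobian X.

Lemma dchange_der X e : derivation (dchange X e).
Proof.
elim/ord2P: e; split=> x y; rewrite /dchange /=;
  rewrite ?(derD (dP ord0)) ?(derD (dP ord_max)) ?(derM (dP ord0)) ?(derM (dP ord_max)); ring.
Qed.

(** The inverse of the Jacobian matrix of X. *)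
Definition jac_inv (X : nat -> K) (e e' : 'I_2) : K :=
  if e == ord0 then
    (if e' == ord0 then d ord_max (X 1) else - d ord0 (X 1)) / jacobian X
  else (if e' == ord0 then - d ord_max (X 0) else d ord0 (X 0)) / jacobian X.

Lemma dchangeE X e f :
  dchange X e f = jac_inv X e ord0 * d ord0 f + jac_inv X e ord_max * d ord_max f.
Proof. by elim/ord2P: e; rewrite /dchange /jac_inv /=; ring. Qed.

Variable X : nat -> K.
Hypothesis jX : jacobian X != 0.

Lemma dchange_self e n : (n < 2)%N -> dchange X e (X n) = (n == e)%:R.
Proof.
case: n => [|[|n]] // _; by elim/ord2P: e; rewrite /dchange /=;
  move: jX; rewrite /jacobian => jX'; field; exact: jX'.
Qed.

Lemma dchange_expand e f :
  d e f = d e (X 0) * dchange X ord0 f + d e (X 1) * dchange X ord_max f.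
Proof.
by elim/ord2P: e; rewrite /dchange /=; move: jX; rewrite /jacobian => jX'; field; exact: jX'.
Qed.

(** The new partial derivatives commute because X 0, X 1 have constant ones. In
    the proof the commutation of d ord0 and d ord_max on x is written out with
    the chain rule, and the commutator appears multiplied by the Jacobian. *)
Lemma dchange_comm e e' x :
  dchange X e (dchange X e' x) = dchange X e' (dchange X e x).
Proof.
suff C : dchange X ord0 (dchange X ord_max x) = dchange X ord_max (dchange X ord0 x).
  by elim/ord2P: e; elim/ord2P: e'.
set y0 := dchange X ord0 x; set y1 := dchange X ord_max x.
have e01 : d ord0 x = d ord0 (X 0) * y0 + d ord0 (X 1) * y1 := dchange_expand ord0 x.
have e10 : d ord_max x = d ord_max (X 0) * y0 + d ord_max (X 1) * y1.
  exact: dchange_expand.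
clearbody y0 y1; have := dC ord0 ord_max x; rewrite e01 e10.
rewrite (derD (dP ord0)) (derD (dP ord_max)) !(derM (dP ord0)) !(derM (dP ord_max)).
rewrite (dC ord_max ord0 (X 0)) (dC ord_max ord0 (X 1)).
rewrite (dchange_expand ord0 y0) (dchange_expand ord0 y1).
rewrite (dchange_expand ord_max y0) (dchange_expand ord_max y1).
move: (dchange X ord0 y1) (dchange X ord_max y0) => u v h.
apply/eqP; rewrite -subr_eq0 -(mulrI_eq0 _ (mulfI jX)); apply/eqP.
by rewrite /jacobian; move: h => /eqP; rewrite -subr_eq0 => /eqP <-; ring.
Qed.

End ChangeOfVariables.

Lemma jacobian_dchange (K : fieldType) (d : 'I_2 -> K -> K) (X Y : nat -> K) :
  jacobian d X != 0 -> jacobian (dchange d X) Y = jacobian d Y / jacobian d X.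
Proof.
by rewrite /jacobian /dchange /= /jacobian => jX; field; exact: jX.
Qed.

Lemma dchange_trans (K : fieldType) (d : 'I_2 -> K -> K) (X Y : nat -> K) e f :
    jacobian d X != 0 -> jacobian d Y != 0 ->
  dchange (dchange d X) Y e f = dchange d Y e f.
Proof.
move=> jX jY; rewrite {1}/dchange jacobian_dchange //.
by elim/ord2P: e; rewrite /dchange /=; move: jX jY; rewrite /jacobian => jX jY;
  field; rewrite jX jY.
Qed.

(** The jet coordinates of the surface with point phi = (x_0, x_1, u_0, u_1),
    where d consists of the partial derivatives with respect to x_0, x_1. *)
Definition jet_seq (K : fieldType) (d : 'I_2 -> K -> K) (phi : nat -> K) (n : nat) : K :=
  if (n < 2)%N then phi n
  else iter (ji n) (d ord0) (iter (jj n) (d ord_max) (phi (ja n).+2)).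

Lemma jet_seq_base (K : fieldType) (d : 'I_2 -> K -> K) phi n : (n < 4)%N ->
  jet_seq d phi n = phi n.
Proof.
by case: n => [|[|[|[|//]]]] // _; rewrite /jet_seq.
Qed.

Lemma jet_seq_jidx (K : fieldType) (d : 'I_2 -> K -> K) phi a i j : (a < 2)%N ->
  jet_seq d phi (jidx a i j) = iter i (d ord0) (iter j (d ord_max) (phi a.+2)).
Proof. by move=> a2; rewrite /jet_seq; have [-> -> ->] := jdecode i j a2. Qed.

Lemma jet_seq_next (K : fieldType) (d : 'I_2 -> K -> K) phi e n :
    (forall e e' x, d e (d e' x) = d e' (d e x)) ->
    (forall e n, (n < 2)%N -> d e (phi n) = (n == e)%:R) ->
  d e (jet_seq d phi n) = dnext (jet_seq d phi) e n.
Proof.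
move=> dC dphi; move: n; elim/jcoord_ind => [||a i j a2].
- by rewrite dnext_base // dphi.
- by rewrite dnext_base // dphi.
rewrite dnext_jidx // !jet_seq_jidx //; elim/ord2P: e.
  by rewrite addn1 addn0.
rewrite addn0 addn1 /=; elim: i => //= i <-.
exact: dC.
Qed.

(** * Prolongation of linear maps *)

Definition linmap (R : nzRingType) (L : nzRingType) (j : R -> L) (g : 'M[R]_(2 + 2))
    (phi : nat -> L) (n : nat) : L :=
  \sum_(l < 2 + 2) j (g (inord n) l) * phi l.

Section Prolongation.

Variables (R : realType) (FF : fieldType) (jF : {rmorphism R -> FF}).
Variables (gen : nat -> FF) (D : 'I_2 -> FF -> FF).
Hypotheses (FFP : jet_field jF gen) (DP : total_derivatives jF gen D).
Variable g : 'M[R]_(2 + 2).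

(** gpoint is the image under g of a point of the surface, gD consists of the
    partial derivatives with respect to its first two coordinates, and gjet is
    the jet of the image surface there, as rational functions of the jet of the
    original surface. *)
Definition gpoint : nat -> FF := linmap jF g gen.
Definition gD : 'I_2 -> FF -> FF := dchange D gpoint.
Definition gjet : nat -> FF := jet_seq gD gpoint.

Section ProlongationValue.

Variables (L : fieldType) (j : {rmorphism R -> L}) (U : L -> Prop).
Hypotheses (U1 : U 1) (UM : forall x y, U x -> U y -> U (x * y)) (U0 : ~ U 0).
Local Notation at_ := (at_jet jF gen j U).

Lemma at_gpoint k th n : at_ k th (gpoint n) (linmap j g th n).
Proof.
apply: at_sum => // l; apply: at_mul => //; first exact: at_const.
by apply: at_gen => //; rewrite (leq_trans (ltn_ord l)) // /jdim; nia.
Qed.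

Lemma at_gD_regular k th e f c cj : at_ k th f c -> at_ 1 th (jacobian D gpoint) cj -> U cj ->
  exists c', at_ k.+1 th (gD e f) c'.
Proof.
move=> hf hj Uj.
have hD e' n : exists c', at_ k.+1 th (D e' (gpoint n)) c'.
  have [c' hc'] := at_D_regular FFP DP U1 UM U0 e' (at_gpoint 0 th n).
  by exists c'; apply: at_le hc'.
have hDf e' : exists c', at_ k.+1 th (D e' f) c'.
  exact: (at_D_regular FFP DP U1 UM U0 e' hf).
have [a0 h0] := hDf ord0; have [a1 h1] := hDf ord_max.
have {}hj : at_ k.+1 th (jacobian D gpoint) cj by apply: at_le hj.
rewrite /gD /dchange; case: ifP => _.
  have [b h] := hD ord_max 1%N; have [b' h'] := hD ord0 1%N.
  eexists; apply: at_div hj Uj => //.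
  by apply: at_sub => //; apply: at_mul => //; eassumption.
have [b h] := hD ord0 0%N; have [b' h'] := hD ord_max 0%N.
eexists; apply: at_div hj Uj => //.
by apply: at_sub => //; apply: at_mul => //; eassumption.
Qed.

Lemma at_gjet_regular th cj : at_ 1 th (jacobian D gpoint) cj -> U cj ->
  forall n, exists c, at_ (jord n) th (gjet n) c.
Proof.
move=> hj Uj; elim/jcoord_ind => [||a i l a2].
- by exists (linmap j g th 0); apply: at_gpoint.
- by exists (linmap j g th 1); apply: at_gpoint.
rewrite jord_jidx // /gjet jet_seq_jidx //.
elim: i => [|i [c IH]]; last by rewrite /= addSn; apply: at_gD_regular IH hj Uj.
rewrite add0n; elim: l => [|l [c IH]]; last by rewrite /=; apply: at_gD_regular IH hj Uj.
by exists (linmap j g th a.+2); apply: at_gpoint.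
Qed.

Lemma at_jacobian th (d : 'I_2 -> L -> L) :
    (forall e, derivation (d e)) -> (forall e c, d e (j c) = 0) ->
    (forall e n, d e (th n) = dnext th e n) ->
  at_ 1 th (jacobian D gpoint) (jacobian d (linmap j g th)).
Proof.
move=> dP dj dth; apply: at_sub => //; apply: at_mul => //;
  by apply: at_der => //; exact: at_gpoint.
Qed.

(** Along a surface, the prolonged jet is the jet of the image surface. *)
Lemma at_gjet th (d : 'I_2 -> L -> L) :
    (forall e, derivation (d e)) -> (forall e c, d e (j c) = 0) ->
    (forall e n, d e (th n) = dnext th e n) ->
    U (jacobian d (linmap j g th)) ->
  forall n, at_ (jord n) th (gjet n)
    (jet_seq (dchange d (linmap j g th)) (linmap j g th) n).
Proof.
move=> dP dj dth Uj.
have at_D k e f c : at_ k th f c -> at_ k.+1 th (D e f) (d e c).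
  by apply: at_der => //.
have hX k e n : at_ k.+1 th (D e (gpoint n)) (d e (linmap j g th n)).
  exact/at_D/at_gpoint.
have hj k : at_ k.+1 th (jacobian D gpoint) (jacobian d (linmap j g th)).
  by apply: (@at_le _ _ _ _ _ _ _ 1) => //; exact: at_jacobian.
have step k e f c : at_ k th f c -> at_ k.+1 th (gD e f) (dchange d (linmap j g th) e c).
  move=> hf; rewrite /gD /dchange.
  by case: ifP => _; apply: at_div => //; apply: at_sub => //; apply: at_mul => //; exact: at_D.
elim/jcoord_ind => [||a i l a2]; try exact: at_gpoint.
rewrite jord_jidx // /gjet !jet_seq_jidx //.
elim: i => [|i IH]; last exact: step.
rewrite add0n; elim: l => [|l IH]; last exact: step.
exact: at_gpoint.
Qed.

End ProlongationValue.

End Prolongation.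

(** * Values at the origin of functions of two parameters *)

Section ValueAtOrigin.

Variable R : realType.

Definition sfield : fieldType := {fraction {mpoly R[2]}}.
Definition sfrac : {rmorphism {mpoly R[2]} -> sfield} := @tofrac {mpoly R[2]}.
Definition sconst : {rmorphism R -> sfield} := sfrac \o @mpolyC 2 R.

Lemma sfracP (x : sfield) : exists p q, q != 0 /\ x = sfrac p / sfrac q.
Proof. exact: fracP. Qed.

Lemma sfrac_eq0 p : (sfrac p == 0) = (p == 0).
Proof. exact: tofrac_eq0. Qed.

Lemma sder_exists : exists d : 'I_2 -> sfield -> sfield, forall e,
  derivation (d e) /\ forall p, d e (sfrac p) = sfrac p^`M(e).
Proof.
have ex (e : 'I_2) : exists d : sfield -> sfield,
    derivation d /\ forall p, d (sfrac p) = sfrac p^`M(e).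
  pose G x y := exists p, x = sfrac p /\ y = sfrac p^`M(e).
  have [||||d [dd dG]] := @der_extend sfield G.
  - move=> _ _ b [p [-> ->]] [q [e1 ->]]; congr (sfrac (mderiv e _)).
    by apply/eqP; rewrite -subr_eq0 -sfrac_eq0 rmorphB e1 subrr.
  - move=> _ _ _ _ [p [-> ->]] [q [-> ->]]; exists (p + q).
    by rewrite mderivD !rmorphD.
  - move=> _ _ _ _ [p [-> ->]] [q [-> ->]]; exists (p * q).
    by rewrite mderivM rmorphD !rmorphM.
  - move=> x; have [p [q [q0 ->]]] := sfracP x.
    exists (sfrac p), (sfrac q), (sfrac p^`M(e)), (sfrac q^`M(e)).
    by rewrite sfrac_eq0 q0; split=> //; [exists p|exists q].
  by exists d; split=> // p; apply: dG; exists p.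
by exists (fun e => sval (cid (ex e))) => e; case: cid.
Qed.

(** The value at the origin is a relation, since a rational function may have a
    pole there. *)
Definition val0 (x : sfield) (c : R) : Prop :=
  exists p q, [/\ at0 q != 0, x = sfrac p / sfrac q & c = at0 p / at0 q].

Lemma at0M (p q : {mpoly R[2]}) : at0 (p * q) = at0 p * at0 q.
Proof. exact: mevalM. Qed.
Lemma at0D (p q : {mpoly R[2]}) : at0 (p + q) = at0 p + at0 q.
Proof. exact: mevalD. Qed.
Lemma at0C (c : R) : at0 (c%:MP : {mpoly R[2]}) = c.
Proof. exact: mevalC. Qed.

Lemma at0_neq0 (p : {mpoly R[2]}) : at0 p != 0 -> sfrac p != 0.
Proof. by rewrite sfrac_eq0; apply: contra_neq => ->; rewrite /at0 meval0. Qed.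

Lemma val0_uniq x c c' : val0 x c -> val0 x c' -> c = c'.
Proof.
move=> [p [q [q0 -> ->]]] [p' [q' [q'0 e ->]]].
move/eqP: e; rewrite eqr_div ?at0_neq0 // -!rmorphM => /eqP e.
apply/eqP; rewrite eqr_div // -!at0M; apply/eqP; congr at0.
by apply/eqP; rewrite -subr_eq0 -sfrac_eq0 rmorphB e subrr.
Qed.

Lemma val0_poly p : val0 (sfrac p) (at0 p).
Proof.
have at01 : at0 (1 : {mpoly R[2]}) = 1 by rewrite /at0 meval1.
by exists p, 1; rewrite at01 oner_neq0 rmorph1 !divr1.
Qed.

Lemma val0_const c : val0 (sconst c) c.
Proof. by have := val0_poly c%:MP; rewrite at0C. Qed.

Lemma val0_add x y c d : val0 x c -> val0 y d -> val0 (x + y) (c + d).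
Proof.
move=> [p [q [q0 -> ->]]] [p' [q' [q'0 -> ->]]].
exists (p * q' + p' * q), (q * q'); rewrite at0D !at0M mulf_neq0 //.
by rewrite !addf_div ?at0_neq0 // rmorphD !rmorphM.
Qed.

Lemma val0_mul x y c d : val0 x c -> val0 y d -> val0 (x * y) (c * d).
Proof.
move=> [p [q [q0 -> ->]]] [p' [q' [q'0 -> ->]]].
exists (p * p'), (q * q'); rewrite !at0M mulf_neq0 //.
by rewrite !mulf_div !rmorphM.
Qed.

Lemma val0_opp x c : val0 x c -> val0 (- x) (- c).
Proof.
by move=> h; rewrite -mulN1r -[- c]mulN1r -(rmorphN1 sconst); apply: val0_mul h;
  exact: val0_const.
Qed.

Lemma val0_sub x y c d : val0 x c -> val0 y d -> val0 (x - y) (c - d).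
Proof. by move=> hx hy; apply: val0_add => //; exact: val0_opp. Qed.

Lemma val0_div x y c d : val0 x c -> val0 y d -> d != 0 -> val0 (x / y) (c / d).
Proof.
move=> hx [p' [q' [q'0 -> ->]]] h; apply: val0_mul => //.
exists q', p'; rewrite !invf_div; split=> //.
by apply: contra_neq h => ->; rewrite mul0r.
Qed.

Lemma val0_neq0 x c : val0 x c -> c != 0 -> x != 0.
Proof.
move=> h; apply: contra_neq => x0; rewrite x0 in h.
by apply: val0_uniq h _; have := val0_const 0; rewrite rmorph0.
Qed.

Definition sunit (x : sfield) : Prop := exists c, val0 x c /\ c != 0.

Lemma sunit1 : sunit 1.
Proof. by exists 1; rewrite oner_neq0; split=> //; have := val0_const 1; rewrite rmorph1. Qed.
Lemma sunitM x y : sunit x -> sunit y -> sunit (x * y).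
Proof.
by move=> [c [hc c0]] [d [hd d0]]; exists (c * d); rewrite mulf_neq0 //; split=> //; exact: val0_mul.
Qed.
Lemma sunit0 : ~ sunit 0.
Proof. by move=> [c [/val0_neq0 h /h]]; rewrite eqxx. Qed.

Definition sreg (x : sfield) : Prop := exists c, val0 x c.

Lemma sregM x y : sreg x -> sreg y -> sreg (x * y).
Proof. by move=> [c hc] [d hd]; exists (c * d); exact: val0_mul. Qed.
Lemma sregB x y : sreg x -> sreg y -> sreg (x - y).
Proof. by move=> [c hc] [d hd]; exists (c - d); exact: val0_sub. Qed.
Lemma sreg_div x y : sreg x -> sunit y -> sreg (x / y).
Proof. by move=> [c hc] [d [hd d0]]; exists (c / d); exact: val0_div. Qed.
Lemma sreg_poly p : sreg (sfrac p).
Proof. by exists (at0 p); exact: val0_poly. Qed.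

(** Vanishing at the origin together with all the derivatives of order <= k. The
    family d is either the derivatives with respect to the parameters, or those
    with respect to x_0, x_1 along a surface. *)
Fixpoint vanish (d : 'I_2 -> sfield -> sfield) (k : nat) (x : sfield) : Prop :=
  val0 x 0 /\ if k is k'.+1 then forall e, vanish d k' (d e x) else True.

Definition regular_ders (d : 'I_2 -> sfield -> sfield) : Prop :=
  forall e, derivation (d e) /\ forall x, sreg x -> sreg (d e x).

Lemma vanish_le d k m x : (k <= m)%N -> vanish d m x -> vanish d k x.
Proof.
elim: m k x => [|m IH] [|k] x //= km [x0 h]; split=> // e; exact: IH.
Qed.

Lemma vanish_add d k x y : regular_ders d -> vanish d k x -> vanish d k y -> vanish d k (x + y).
Proof.
move=> dP; elim: k x y => [|k IH] x y /= [x0 hx] [y0 hy]; split=> //.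
- by rewrite -[0]addr0; exact: val0_add.
- by rewrite -[0]addr0; exact: val0_add.
by move=> e; rewrite (derD (dP e).1); apply: IH.
Qed.

Lemma vanish_mul d k a x : regular_ders d -> sreg a -> vanish d k x -> vanish d k (a * x).
Proof.
move=> dP; elim: k a x => [|k IH] a x /= [c ac] [x0 hx]; split=> //.
- by rewrite -(mulr0 c); exact: val0_mul.
- by rewrite -(mulr0 c); exact: val0_mul.
move=> e; rewrite (derM (dP e).1); apply: vanish_add => //; apply: IH => //.
- by apply: (dP e).2; exists c.
- by apply: (@vanish_le _ _ k.+1) => //.
- by exists c.
Qed.

(** By the Leibniz rule, a combination of derivatives with regular coefficients
    preserves the order of vanishing; so both families measure the same order. *)
Lemma vanish_change d d' k x (a : 'I_2 -> 'I_2 -> sfield) :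
    regular_ders d -> regular_ders d' -> (forall e e', sreg (a e e')) ->
    (forall e y, d' e y = a e ord0 * d ord0 y + a e ord_max * d ord_max y) ->
  vanish d k x -> vanish d' k x.
Proof.
move=> dP d'P ha d'E; elim: k x => [|k IH] x //= [x0 hx]; split=> // e.
by rewrite d'E; apply: IH; apply: vanish_add => //; apply: vanish_mul.
Qed.

Lemma vanish_iter d k x i l : vanish d k x -> (i + l <= k)%N ->
  val0 (iter i (d ord0) (iter l (d ord_max) x)) 0.
Proof.
have hl : forall i k x, vanish d k x -> (i <= k)%N -> val0 (iter i (d ord0) x) 0.
  elim=> [|n IH] [|m] y [y0 hy] nm //.
  by rewrite iterSr; apply: (IH m) => //; exact: hy.
elim: l k x => [|l IH] k x; first by rewrite addn0 => hx ik; apply: hl hx ik.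
case: k => [|k]; first by rewrite addnS.
by move=> [x0 hx]; rewrite addnS ltnS iterSr; apply: IH; exact: hx.
Qed.

Lemma iter_vanish d k x : (forall e e' x, d e (d e' x) = d e' (d e x)) ->
    (forall i l, (i + l <= k)%N -> val0 (iter i (d ord0) (iter l (d ord_max) x)) 0) ->
  vanish d k x.
Proof.
move=> dC; elim: k x => [|k IH] x hx; first by split=> //; apply: (hx 0 0)%N.
split; first by apply: (hx 0 0)%N.
have comm i y : iter i (d ord0) (d ord_max y) = d ord_max (iter i (d ord0) y).
  by elim: i => //= i ->; rewrite dC.
move=> e; apply: IH => i l il; elim/ord2P: e.
  have comm' : iter l (d ord_max) (d ord0 x) = d ord0 (iter l (d ord_max) x).
    by elim: (l) => //= l' ->; rewrite dC.
  by rewrite comm' -iterSr; apply: hx; rewrite addSn ltnS.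
by rewrite -iterSr; apply: hx; rewrite addnS ltnS.
Qed.

End ValueAtOrigin.

Global Opaque sfield sfrac.

Lemma at0_mcoeff (R : fieldType) n (p : {mpoly R[n]}) : at0 p = p@_0%MM.
Proof.
apply: (@mpoly_hom_uniq _ _ _ (meval (fun=> 0)) (mcoeff 0%MM)) => [c|i] /=.
  by rewrite mevalC mcoeffC eqxx mulr1.
by rewrite mevalXU mcoeffX mnm1_eq0.
Qed.

(** * Jets of parametrized surfaces *)

Section SurfaceJet.

Variables (R : realType) (ds : 'I_2 -> sfield R -> sfield R).
Hypothesis dsP : forall e, derivation (ds e) /\ forall p, ds e (sfrac R p) = sfrac R p^`M(e).
Local Notation sf := (sfrac R).

Lemma ds_comm e e' x : ds e (ds e' x) = ds e' (ds e x).
Proof.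
apply/eqP; rewrite -subr_eq0; apply/eqP.
have dd := der_commutator (dsP e).1 (dsP e').1.
have [p [q [q0 ->]]] := sfracP x.
rewrite [LHS](derV2 dd) !(dsP _).2 (mderiv_comm e e' p) (mderiv_comm e e' q).
by rewrite !subrr mul0r mulr0 subr0 mul0r.
Qed.

Lemma ds_regular : regular_ders ds.
Proof.
move=> e; split=> [|_ [c [p [q [q0 -> _]]]]]; first exact: (dsP e).1.
rewrite (derV2 (dsP e).1) !(dsP e).2; apply: sreg_div; last first.
  by rewrite expr2; apply: sunitM; exists (at0 q); split=> //; exact: val0_poly.
by apply: sregB; apply: sregM; exact: sreg_poly.
Qed.

Lemma vanish_poly k p : vanish ds k (sf p) <-> eq_upto k p 0.
Proof.
elim: k p => [|k IH] p; split.
- move=> [p0 _] m; rewrite leqn0 mdeg_eq0 => /eqP ->.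
  by rewrite mcoeff0 -at0_mcoeff; apply: val0_uniq p0; exact: val0_poly.
- move=> hp; split=> //; have := val0_poly p.
  by rewrite at0_mcoeff hp ?mcoeff0 // mdeg0.
- move=> [p0 hp] m hm; rewrite mcoeff0; have [->|m0] := eqVneq m 0%MM.
    by rewrite -at0_mcoeff; apply: val0_uniq p0; exact: val0_poly.
  have [e me] : exists e, m e != 0%N.
    apply/existsP; apply: contra_neqT m0 => /existsPn h.
    by apply/mnmP => e; rewrite mnm0E; have := h e; rewrite negbK => /eqP.
  have mE : m = (m - U_(e) + U_(e))%MM.
    by apply/esym/submK; apply/mnm_lepP => e'; rewrite mnm1E; case: eqVneq => [<-|//]; rewrite lt0n.
  have : (p^`M(e))@_(m - U_(e))%MM = 0.
    have := hp e; rewrite (dsP e).2 => /IH -> //; first by rewrite mcoeff0.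
    by move: hm; rewrite {1}mE mdegD mdeg1 addn1.
  by rewrite mcoeff_mderiv -mE => /eqP; rewrite mulrn_eq0 /= => /eqP.
- move=> hp; split.
    by have := val0_poly p; rewrite at0_mcoeff hp ?mcoeff0 // mdeg0.
  move=> e; rewrite (dsP e).2; apply/IH => m hm.
  by rewrite mcoeff_mderiv hp ?mcoeff0 ?mul0rn // mdegD mdeg1 addn1.
Qed.

Variable phi : surface R.

(** A parametrized surface phi as functions of the parameters; sD consists of the
    partial derivatives with respect to x_0, x_1 along the surface, and sjet of
    its jet coordinates. *)
Definition sphi (n : nat) : sfield R := sf (phi (inord n)).

Definition sdet : R :=
  \det (\matrix_(e < 2, e' < 2) at0 (phi (lshift 2 e))^`M(e')).

Lemma sphi_l (e : 'I_2) : phi (inord e) = phi (lshift 2 e).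
Proof. by congr phi; apply: val_inj; rewrite /= inordK // (leq_trans (ltn_ord e)). Qed.

Lemma sphi_r (a : 'I_2) : phi (inord a.+2) = phi (rshift 2 a).
Proof. by congr phi; apply: val_inj; rewrite /= inordK // ltnS ltnS. Qed.

Lemma val0_jac : val0 (jacobian ds sphi) sdet.
Proof.
have -> : sdet = at0 (phi (lshift 2 ord0))^`M(ord0) * at0 (phi (lshift 2 ord_max))^`M(ord_max)
   - at0 (phi (lshift 2 ord_max))^`M(ord0) * at0 (phi (lshift 2 ord0))^`M(ord_max).
  rewrite /sdet (expand_det_row _ ord0) big_ord_recl big_ord1 /cofactor !det_mx11 !mxE /=.
  have -> : lift ord0 ord0 = ord_max :> 'I_2 by apply: val_inj.
  have -> : lift ord_max ord0 = ord0 :> 'I_2 by apply: val_inj.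
  by rewrite expr0 expr1 mul1r mulN1r mulrN [X in _ - X]mulrC.
have e0 : phi (inord 0) = phi (lshift 2 ord0) := sphi_l ord0.
have e1 : phi (inord 1) = phi (lshift 2 ord_max) := sphi_l ord_max.
rewrite /jacobian /sphi e0 e1 !(dsP _).2.
by apply: val0_sub; apply: val0_mul; exact: val0_poly.
Qed.

Hypothesis det0 : sdet != 0.

Definition sD : 'I_2 -> sfield R -> sfield R := dchange ds sphi.
Definition sjet : nat -> sfield R := jet_seq sD sphi.

Lemma jac_sunit : sunit (jacobian ds sphi).
Proof. by exists sdet; split=> //; exact: val0_jac. Qed.

Lemma jac_neq0 : jacobian ds sphi != 0.
Proof. exact: val0_neq0 val0_jac det0. Qed.

Lemma sphi_reg n : sreg (sphi n). Proof. exact: sreg_poly. Qed.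

Lemma sD_regular : regular_ders sD.
Proof.
move=> e; split=> [|x hx].
  by apply: dchange_der => e'; exact: (dsP e').1.
have h e' y : sreg y -> sreg (ds e' y) by exact: (ds_regular e').2.
rewrite /sD /dchange; case: ifP => _; apply: sreg_div jac_sunit;
  by apply: sregB; apply: sregM; apply: h => //; exact: sphi_reg.
Qed.

Lemma sD_der e : derivation (sD e). Proof. exact: (sD_regular e).1. Qed.

Lemma sD_comm e e' x : sD e (sD e' x) = sD e' (sD e x).
Proof.
exact: (dchange_comm (fun e => (dsP e).1) ds_comm jac_neq0).
Qed.

Lemma sD_sphi e n : (n < 2)%N -> sD e (sphi n) = (n == e)%:R.
Proof.
by move=> n2; apply: dchange_self => //; exact: jac_neq0.
Qed.

Lemma ds_const e c : ds e (sconst R c) = 0.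
Proof. by rewrite (dsP e).2 mderivC rmorph0. Qed.

Lemma sD_const e c : sD e (sconst R c) = 0.
Proof. by rewrite /sD /dchange !ds_const !mulr0 subrr mul0r if_same. Qed.

Lemma sjet_next e n : sD e (sjet n) = dnext sjet e n.
Proof. by apply: jet_seq_next; [exact: sD_comm|exact: sD_sphi]. Qed.

Lemma sjet_reg n : sreg (sjet n).
Proof.
have it e i x : sreg x -> sreg (iter i (sD e) x).
  by move=> hx; elim: i => //= i IH; exact: (sD_regular e).2.
rewrite /sjet /jet_seq; case: ifP => _; first exact: sphi_reg.
by apply: (it); apply: (it); exact: sphi_reg.
Qed.

Lemma vanish_sD k x : vanish ds k x <-> vanish sD k x.
Proof.
have h e' n : sreg (ds e' (sphi n)) by apply: (ds_regular e').2; exact: sphi_reg.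
split.
  apply: (@vanish_change _ _ _ _ _ (jac_inv ds sphi)).
  - exact: ds_regular.
  - exact: sD_regular.
  - move=> e e'; have hN y : sreg y -> sreg (- y).
      by move=> [c hc]; exists (- c); exact: val0_opp.
    by rewrite /jac_inv; case: ifP => _; apply: sreg_div jac_sunit; case: ifP => _; [|apply: hN|apply: hN|]; exact: h.
  - by move=> e y; exact: dchangeE.
apply: (@vanish_change _ _ _ _ _ (fun e e' => ds e (sphi e'))).
- exact: sD_regular.
- exact: ds_regular.
- by move=> e e'; exact: h.
- move=> e y; apply: dchange_expand; exact: jac_neq0.
Qed.

Definition centered : 2.-tuple {mpoly R[2]} :=
  [tuple phi (lshift 2 e) - (at0 (phi (lshift 2 e)))%:MP | e < 2].

Lemma at0_centered p : at0 (p \mPo centered) = at0 p.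
Proof.
rewrite /at0 comp_mpoly_meval; apply: meval_eq => e.
by rewrite tnth_mktuple mevalB mevalC subrr.
Qed.

(** The chain rule: a function of x_0, x_1, centered at the base point, has the
    expected derivatives along the surface. *)
Lemma sD_comp e p : sD e (sf (p \mPo centered)) = sf (p^`M(e) \mPo centered).
Proof.
move: p; pose h : {rmorphism _ -> _} := sf \o comp_mpoly centered.
apply: (@mpoly_der_uniq _ _ _ h (fun p => sD e (h p)) (fun p => h p^`M(e))) => [||c|i].
- split=> p q; cbv beta; first by rewrite (rmorphD h) (derD (sD_der e)).
  by rewrite (rmorphM h) (derM (sD_der e)).
- split=> p q; cbv beta; first by rewrite mderivD (rmorphD h).
  by rewrite mderivM (rmorphD h) !(rmorphM h).
- by rewrite /= comp_mpolyC mderivC rmorph0 (sD_const e c).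
rewrite mderivXU rmorph_nat /h /= comp_mpolyXU -tnth_nth tnth_mktuple rmorphB.
rewrite (derB (sD_der e)) (sD_const e) subr0 -sphi_l.
by rewrite -[sf _]/(sphi i) sD_sphi // val_eqE.
Qed.

Lemma sD_iter_comp i l p :
  iter i (sD ord0) (iter l (sD ord_max) (sf (p \mPo centered))) =
  sf (iter i (mderiv ord0) (iter l (mderiv ord_max) p) \mPo centered).
Proof.
elim: i => [|i IH] /=; last by rewrite IH sD_comp.
by elim: l => [|l IH] //=; rewrite IH sD_comp.
Qed.

End SurfaceJet.

Lemma mpoly2_monomial (A : comNzRingType) (i l : nat) :
  'X_ord0 ^+ i * 'X_ord_max ^+ l = 'X_[U_(ord0) *+ i + U_(ord_max) *+ l] :> {mpoly A[2]}.
Proof. by rewrite mpolyXD !mpolyXn. Qed.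

Lemma mnm2_eq (i l i' l' : nat) :
  ((U_(ord0) *+ i + U_(ord_max) *+ l)%MM == (U_(ord0) *+ i' + U_(ord_max) *+ l')%MM :> 'X_{1..2})
  = (i == i') && (l == l').
Proof.
apply/eqP/andP => [e|[/eqP -> /eqP ->]] //.
have := congr1 (fun m : 'X_{1..2} => m ord0) e.
have := congr1 (fun m : 'X_{1..2} => m ord_max) e.
by rewrite /= !mnmDE !mulmnE !mnm1E /= !mul1n !mul0n !addn0 !add0n => -> ->.
Qed.

Lemma taylor_mcoeff (F : fieldType) k (th : jet F k) (a : 'I_2) i l : (i + l <= k)%N ->
  (taylor th a)@_(U_(ord0) *+ i + U_(ord_max) *+ l) =
  th (inord (jidx a i l)) / ((i`! * l`!)%N)%:R.
Proof.
move=> il; rewrite /taylor raddf_sum /=.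
have ik : (i < k.+1)%N by lia.
have lk : (l < k.+1)%N by lia.
rewrite (bigD1 (Ordinal ik)) //= [X in _ + X]big1 ?addr0.
  rewrite raddf_sum /= (bigD1 (Ordinal lk)) //= [X in _ + X]big1 ?addr0.
    by rewrite mcoeffZ mpoly2_monomial mcoeffX mnm2_eq !eqxx mulr1.
  move=> l' /andP[_ ne]; rewrite mcoeffZ mpoly2_monomial mcoeffX mnm2_eq.
  by rewrite -val_eqE in ne; rewrite (negbTE ne) andbF mulr0.
move=> i' ne; rewrite raddf_sum /= big1 // => l' _.
rewrite mcoeffZ mpoly2_monomial mcoeffX mnm2_eq.
by rewrite -val_eqE in ne; rewrite (negbTE ne) mulr0.
Qed.

Lemma at0_iter_mderiv (F : fieldType) (p : {mpoly F[2]}) i l :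
  at0 (iter i (mderiv ord0) (iter l (mderiv ord_max) p)) =
  p@_(U_(ord0) *+ i + U_(ord_max) *+ l) * ((i`! * l`!)%N)%:R.
Proof.
rewrite at0_mcoeff -!mderivn_iter -mderivmDm mcoeff_mderivm addm0 [(_ + _)%MM]addmC.
rewrite mulr_natr; congr (_ *+ _); rewrite big_ord_recl big_ord1.
have -> : lift ord0 ord0 = ord_max :> 'I_2 by apply: val_inj.
by rewrite !mnmDE !mulmnE !mnm1E /= !mul1n !mul0n ?addn0 ?add0n !ffactnn.
Qed.

Lemma taylor_deriv (R : realType) k (th : jet R k) (a : 'I_2) i l : (i + l <= k)%N ->
  at0 (iter i (mderiv ord0) (iter l (mderiv ord_max) (taylor th a))) =
  th (inord (jidx a i l)).
Proof.
move=> il; rewrite at0_iter_mderiv taylor_mcoeff // divfK //.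
by rewrite pnatr_eq0 muln_eq0 negb_or -!lt0n !fact_gt0.
Qed.

Section HasJet.

Variables (R : realType) (ds : 'I_2 -> sfield R -> sfield R).
Hypothesis dsP : forall e, derivation (ds e) /\ forall p, ds e (sfrac R p) = sfrac R p^`M(e).
Variable phi : surface R.

Lemma eq_upto_sjet k (th : jet R k) (a : 'I_2) : sdet phi != 0 ->
  eq_upto k (phi (rshift 2 a)) (taylor th a \mPo centered phi) <->
  (forall i l, (i + l <= k)%N -> val0 (sjet ds phi (jidx a i l)) (th (inord (jidx a i l)))).
Proof.
move=> det0.
have e1 : eq_upto k (phi (rshift 2 a)) (taylor th a \mPo centered phi) <->
    eq_upto k (phi (rshift 2 a) - (taylor th a \mPo centered phi)) 0.
  split=> h m hm; first by rewrite mcoeffB h // subrr mcoeff0.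
  by apply/eqP; rewrite -subr_eq0 -mcoeffB h // mcoeff0.
have itB e i x y : iter i (sD ds phi e) (x - y) = iter i (sD ds phi e) x - iter i (sD ds phi e) y.
  by elim: i => //= i ->; rewrite (derB (sD_der dsP det0 e)).
have e2 i l : iter i (sD ds phi ord0) (iter l (sD ds phi ord_max)
      (sfrac R (phi (rshift 2 a) - (taylor th a \mPo centered phi)))) =
    sjet ds phi (jidx a i l) - sfrac R (iter i (mderiv ord0) (iter l (mderiv ord_max) (taylor th a)) \mPo centered phi).
  by rewrite rmorphB !itB (sD_iter_comp dsP det0) /sjet jet_seq_jidx // /sphi sphi_r.
apply: (iff_trans e1); apply: (iff_trans (iff_sym (vanish_poly dsP k _))).
apply: (iff_trans (vanish_sD dsP det0 k _)); split=> [hv i l il|hv].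
  have := vanish_iter hv il; rewrite e2 => /val0_add h.
  have := h _ _ (val0_poly (iter i (mderiv ord0) (iter l (mderiv ord_max) (taylor th a)) \mPo centered phi)).
  by rewrite subrK add0r at0_centered taylor_deriv.
apply: iter_vanish => [|i l il]; first exact: sD_comm.
rewrite e2; have := val0_sub (hv i l il) (val0_poly (iter i (mderiv ord0) (iter l (mderiv ord_max) (taylor th a)) \mPo centered phi)).
by rewrite at0_centered taylor_deriv // subrr.
Qed.

(** Contact of order k means that u minus the Taylor polynomial, as a function of
    x_0, x_1, vanishes to order k in the parameters. This order can be measured
    with the derivatives in x_0, x_1 as well, and these are the jet coordinates
    of the surface minus the prescribed ones. *)
Lemma has_jetP k (th : jet R k) : has_jet phi th <-> sdet phi != 0 /\
  forall n, (n < jdim k)%N -> val0 (sjet ds phi n) (th (inord n)).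
Proof.
have base e : val0 (sjet ds phi (e : 'I_2)) (at0 (phi (lshift 2 e))).
  rewrite /sjet jet_seq_base; last exact: ltn_trans (ltn_ord e) _.
  by rewrite /sphi sphi_l; exact: val0_poly.
split=> [[hX hd hU]|[hd hJ]].
  split=> // n; elim/jcoord_lt => [||a i l a2 il].
  - by have := base ord0; rewrite hX.
  - by have := base ord_max; rewrite hX.
  by have /(eq_upto_sjet th _ hd) h := hU (Ordinal a2); exact: h.
split=> // [e|a].
  apply: val0_uniq (base e) (hJ _ _).
  by apply: leq_trans (ltn_ord e) _.
by apply/(eq_upto_sjet th a hd) => i l il; apply: hJ; rewrite jidx_lt.
Qed.

End HasJet.

(** * Symplectic matrices *)

Section Symplectic.

Variable F : fieldType.

Definition i0 : 'I_(2 + 2) := inord 0.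
Definition i1 : 'I_(2 + 2) := inord 1.
Definition i2 : 'I_(2 + 2) := inord 2.
Definition i3 : 'I_(2 + 2) := inord 3.

Lemma sum4 (V : nmodType) (f : 'I_(2 + 2) -> V) : \sum_i f i = f i0 + f i1 + f i2 + f i3.
Proof.
rewrite 4!big_ord_recl big_ord0 addr0 !addrA.
do 4?[congr (_ + _)]; congr f; apply: val_inj; rewrite /= /i0 /i1 /i2 /i3 ?inordK //.
Qed.

Lemma ord4P (P : 'I_(2 + 2) -> Prop) : P i0 -> P i1 -> P i2 -> P i3 -> forall i, P i.
Proof.
move=> P0 P1 P2 P3 [[|[|[|[|n]]]] h] //; [move: P0|move: P1|move: P2|move: P3];
  congr P; apply: val_inj; by rewrite /= inordK.
Qed.

Lemma omega_mxE (i l : 'I_(2 + 2)) : omega_mx F i l =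
  ((i == i0) && (l == i1))%:R - ((i == i1) && (l == i0))%:R
  + ((i == i2) && (l == i3))%:R - ((i == i3) && (l == i2))%:R.
Proof.
have e0 : i0 = lshift 2 ord0 by apply: val_inj; rewrite /= inordK.
have e1 : i1 = lshift 2 ord_max by apply: val_inj; rewrite /= inordK.
have e2 : i2 = rshift 2 ord0 by apply: val_inj; rewrite /= inordK.
have e3 : i3 = rshift 2 ord_max by apply: val_inj; rewrite /= inordK.
rewrite /omega_mx e0 e1 e2 e3.
elim/ord4P: i; elim/ord4P: l; rewrite ?e0 ?e1 ?e2 ?e3;
  rewrite ?(block_mxEul, block_mxEur, block_mxEdl, block_mxEdr) !mxE -!val_eqE /=; ring.
Qed.

Lemma omegaE (v w : 'cV[F]_(2 + 2)) : omega v w =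
  v i0 0 * w i1 0 - v i1 0 * w i0 0 + v i2 0 * w i3 0 - v i3 0 * w i2 0.
Proof.
rewrite /omega mxE sum4 ![(_ *m _) _ _]mxE !sum4 ![_^T _ _]mxE !omega_mxE.
rewrite -!val_eqE /= !inordK //=; ring.
Qed.

Lemma omega_mx_sq : omega_mx F *m omega_mx F = - 1%:M.
Proof.
apply/matrixP => i l; rewrite ![(_ *m _) _ _]mxE sum4 !omega_mxE !mxE -!val_eqE /= !inordK //=.
elim/ord4P: i; elim/ord4P: l; rewrite !inordK //=; ring.
Qed.

Lemma symplectic_mx (g : 'M[F]_(2 + 2)) :
  symplectic g <-> g^T *m omega_mx F *m g = omega_mx F.
Proof.
split=> [h|h v w]; last first.
  by rewrite /omega trmx_mul !mulmxA -(mulmxA _ g^T) -(mulmxA _ _ g) h.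
apply/matrixP => i l; have := h (delta_mx i 0) (delta_mx l 0).
have entry (A : 'M[F]_(2 + 2)) : ((delta_mx i 0)^T *m A *m delta_mx l 0 : 'M_1) 0 0 = A i l.
  by rewrite trmx_delta -rowE -colE !mxE.
have -> : omega (g *m delta_mx i 0) (g *m delta_mx l 0) =
    ((delta_mx i 0)^T *m (g^T *m omega_mx F *m g) *m delta_mx l 0 : 'M_1) 0 0.
  by rewrite /omega trmx_mul !mulmxA.
by rewrite entry /omega entry.
Qed.

Lemma symplectic_inv (g : 'M[F]_(2 + 2)) : symplectic g ->
  exists g', [/\ symplectic g', g' *m g = 1%:M & g *m g' = 1%:M].
Proof.
move=> hg; have /symplectic_mx h := hg.
pose g' := - (omega_mx F *m g^T *m omega_mx F).
have g'g : g' *m g = 1%:M.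
  by rewrite /g' mulNmx -!mulmxA (mulmxA g^T) h omega_mx_sq opprK.
have gg' := mulmx1C g'g.
exists g'; split=> // v w.
by rewrite -(hg (g' *m v)) !mulmxA gg' !mul1mx.
Qed.

Lemma symplectic_tr (g : 'M[F]_(2 + 2)) : symplectic g -> symplectic g^T.
Proof.
move=> hg; have /symplectic_mx h := hg; apply/symplectic_mx; rewrite trmxK.
have : g *m (- (omega_mx F *m g^T *m omega_mx F)) = 1%:M.
  by apply: mulmx1C; rewrite mulNmx -!mulmxA (mulmxA g^T) h omega_mx_sq opprK.
move=> /(congr1 (mulmx^~ (omega_mx F))); rewrite mul1mx => e; rewrite -[RHS]e.
by rewrite mulmxN mulNmx -!mulmxA omega_mx_sq !mulmxN mulmx1 !opprK mulmxA.
Qed.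

(** The first two rows are paired like the first two columns, because the
    transpose of a symplectic matrix is symplectic. *)
Lemma symplectic_rows (g : 'M[F]_(2 + 2)) : symplectic g ->
  g i0 i0 * g i1 i1 - g i0 i1 * g i1 i0 + g i0 i2 * g i1 i3 - g i0 i3 * g i1 i2 = 1.
Proof.
move=> /symplectic_tr /(_ (delta_mx i0 0) (delta_mx i1 0)).
rewrite -!colE !omegaE !mxE. rewrite -!val_eqE /= !inordK //= => ->; ring.
Qed.

End Symplectic.

(** * The action on jets *)

Definition restr (R : Type) (k : nat) (th : nat -> R) : jet R k := fun i => th i.

Definition nonzero (R : nzRingType) (x : R) : Prop := x != 0.

Lemma jord_lt k n : (n < jdim k)%N -> (jord n <= k)%N.
Proof. by elim/jcoord_lt => // a i l a2 il; rewrite jord_jidx. Qed.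

Section Action.

Variables (R : realType) (FF : fieldType) (jF : {rmorphism R -> FF}).
Variables (gen : nat -> FF) (D : 'I_2 -> FF -> FF).
Hypotheses (FFP : jet_field jF gen) (DP : total_derivatives jF gen D).

Local Notation at_R := (at_jet jF gen (idfun : {rmorphism R -> R}) (@nonzero R)).
Local Notation at_S := (at_jet jF gen (sconst R) (@sunit R)).

Lemma nz1 : @nonzero R 1. Proof. exact: oner_neq0. Qed.
Lemma nzM (x y : R) : nonzero x -> nonzero y -> nonzero (x * y).
Proof. exact: mulf_neq0. Qed.
Lemma nz0 : ~ @nonzero R 0. Proof. by rewrite /nonzero eqxx. Qed.

Lemma at_R_uniq k k' th f c c' : at_R k th f c -> at_R k' th f c' -> c = c'.
Proof. exact: (at_uniq FFP nz0). Qed.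

Lemma val0_ev (psi : nat -> sfield R) (th : nat -> R) k (P : {mpoly R[jdim k]}) :
  (forall n, val0 (psi n) (th n)) ->
  val0 (ev (sconst R) psi P) (ev (idfun : {rmorphism R -> R}) th P).
Proof.
move=> h; apply: (mpoly_gen_ind (P := fun P =>
  val0 (ev (sconst R) psi P) (ev (idfun : {rmorphism R -> R}) th P))) => [c|i|p q hp hq|p q hp hq].
- by rewrite !evC; exact: val0_const.
- by rewrite !evX.
- by rewrite !rmorphD; exact: val0_add.
- by rewrite !rmorphM; exact: val0_mul.
Qed.

(** Evaluation at the origin of the surface turns values along the surface
    into values at its jet. *)
Lemma at_origin (psi : nat -> sfield R) (th : nat -> R) k f C :
    (forall n, val0 (psi n) (th n)) -> at_S k psi f C ->
  exists c, val0 C c /\ at_R k th f c.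
Proof.
move=> h [P [Q [[q [hq q0]] -> ->]]].
have {hq q0} Q0 : ev (idfun : {rmorphism R -> R}) th Q != 0.
  by rewrite -(val0_uniq hq (val0_ev Q h)).
exists (ev (idfun : {rmorphism R -> R}) th P / ev (idfun : {rmorphism R -> R}) th Q).
split; last by exists P, Q.
by apply: val0_div => //; exact: val0_ev.
Qed.

Variable g : 'M[R]_(2 + 2).
Local Notation gjet := (gjet jF gen D g).
Local Notation gjac := (jacobian D (gpoint jF gen g)).

Variable ds : 'I_2 -> sfield R -> sfield R.
Hypothesis dsP : forall e, derivation (ds e) /\ forall p, ds e (sfrac R p) = sfrac R p^`M(e).

Lemma linmap_sphi (phi : surface R) :
  linmap (sconst R) g (sjet ds phi) = sphi (act g phi).
Proof.
apply: funext => n; rewrite /linmap /sphi /act raddf_sum; apply: eq_bigr => l _.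
rewrite /sjet jet_seq_base // /sphi inord_val -mul_mpolyC.
by rewrite [RHS](rmorphM (sfrac R)).
Qed.

(** The jet of the image surface is the value of gjet along the surface; this is
    where the algebraic prolongation meets the surfaces. The image is a graph
    exactly if the Jacobian of the change of variables is invertible. *)
Lemma surface_action (phi : surface R) : sdet phi != 0 ->
  at_S 1 (sjet ds phi) gjac (jacobian (sD ds phi) (sphi (act g phi))) /\
  (sdet (act g phi) != 0 ->
    sunit (jacobian (sD ds phi) (sphi (act g phi)))) /\
  (sunit (jacobian (sD ds phi) (sphi (act g phi))) ->
    sdet (act g phi) != 0 /\
    forall n, at_S (jord n) (sjet ds phi) (gjet n) (sjet ds (act g phi) n)).
Proof.
move=> det0; have dX := fun e => sD_der dsP det0 e.
have jX := jac_neq0 dsP det0.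
have jE : jacobian ds (sphi (act g phi)) =
    jacobian (sD ds phi) (sphi (act g phi)) * jacobian ds (sphi phi).
  by rewrite jacobian_dchange // divfK.
split.
  rewrite -linmap_sphi; apply: (at_jacobian FFP DP); try exact: dX.
  - exact: sunit1.
  - exact: sunitM.
  - exact: sunit0.
  - exact: (sD_const dsP).
  - exact: sjet_next.
split=> [det0'|Uj].
  have [c [hc c0]] := jac_sunit dsP det0; have [c' [hc' c'0]] := jac_sunit dsP det0'.
  exists (c' / c); split; last by rewrite mulf_neq0 ?invr_neq0.
  by rewrite jacobian_dchange //; apply: val0_div.
have [c [hc c0]] := sunitM Uj (jac_sunit dsP det0); rewrite -jE in hc.
have det0' : sdet (act g phi) != 0 by rewrite (val0_uniq (val0_jac dsP _) hc).
split=> // n.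
have -> : sjet ds (act g phi) n =
    jet_seq (dchange (sD ds phi) (linmap (sconst R) g (sjet ds phi))) (linmap (sconst R) g (sjet ds phi)) n.
  rewrite linmap_sphi /sjet; congr (jet_seq _ _ n).
  apply: funext => e; apply: funext => x.
  by rewrite /sD (dchange_trans _ _ jX (jac_neq0 dsP det0')).
apply: (at_gjet FFP DP).
- exact: sunit1.
- exact: sunitM.
- exact: sunit0.
- exact: dX.
- exact: (sD_const dsP).
- exact: sjet_next.
- by rewrite linmap_sphi.
Qed.

Lemma prolonged_at k (th th' : jet R k) : prolonged g th th' ->
  exists t t' : nat -> R, [/\ th = restr t, th' = restr t',
    exists c, at_R 1 t gjac c /\ c != 0 & forall n, at_R (jord n) t (gjet n) (t' n)].
Proof.
move=> [phi [/(has_jetP dsP)[det0 hth] /(has_jetP dsP)[det0' hth']]].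
have [hj [hU hJ]] := surface_action det0.
have {}hU := hU det0'; have [_ {}hJ] := hJ hU.
pose t n := sval (cid (sjet_reg dsP det0 n)).
pose t' n := sval (cid (sjet_reg dsP det0' n)).
have ht n : val0 (sjet ds phi n) (t n) by rewrite /t; case: cid.
have ht' n : val0 (sjet ds (act g phi) n) (t' n) by rewrite /t'; case: cid.
exists t, t'; split.
- by apply: funext => i; apply: val0_uniq (ht i); rewrite -[th i](congr1 th (inord_val i)); exact: hth.
- by apply: funext => i; apply: val0_uniq (ht' i); rewrite -[th' i](congr1 th' (inord_val i)); exact: hth'.
- have [c [hc hc']] := at_origin ht hj; exists c; split=> //.
  by have [c' [h c'0]] := hU; rewrite (val0_uniq hc h).
- by move=> n; have [c [h1 h2]] := at_origin ht (hJ n); rewrite (val0_uniq (ht' n) h1).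
Qed.

Lemma has_jet_graph k (th : jet R k) : has_jet (graph th) th.
Proof.
have hX (e : 'I_2) : graph th (lshift 2 e) = (th (inord e))%:MP + 'X_e.
  rewrite /graph; case: splitP => l /= h; first by rewrite (ord_inj h).
  by have := ltn_ord e; rewrite h.
have hU (a : 'I_2) : graph th (rshift 2 a) = taylor th a.
  rewrite /graph; case: splitP => l /= h; last by rewrite (ord_inj (addnI h)).
  by have := ltn_ord l; rewrite -h.
have h0 e : at0 (graph th (lshift 2 e)) = th (inord e).
  by rewrite hX /at0 mevalD mevalC mevalXU addr0.
split=> // [|a].
  have -> : (\matrix_(e < 2, e' < 2) at0 (graph th (lshift 2 e))^`M(e')) = 1%:M.
    apply/matrixP => e e'; rewrite !mxE hX mderivD mderivC add0r mderivXU.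
    by case: eqP => _; rewrite /at0 ?meval1 ?meval0.
  by rewrite det1 oner_neq0.
move=> m _; rewrite hU; congr mcoeff; rewrite -[LHS]comp_mpoly_id; congr comp_mpoly.
by apply: eq_from_tnth => e; rewrite !tnth_mktuple h0 hX addrAC subrr add0r.
Qed.

(** The converse of [prolonged_at], for the jets at which the Jacobian does
    not vanish: the surface is the graph of the Taylor polynomial. One order more
    than k is kept because the Jacobian depends on the 1-jet. *)
Lemma at_prolonged t c : at_R 1 t gjac c -> c != 0 ->
  exists t' : nat -> R, (forall n, at_R (jord n) t (gjet n) (t' n)) /\
    forall k, prolonged g (restr (k := k) t) (restr t').
Proof.
move=> hc c0.
have reg := at_gjet_regular FFP DP nz1 nzM nz0 hc c0.
pose t' n := sval (cid (reg n)).
have ht' n : at_R (jord n) t (gjet n) (t' n) by rewrite /t'; case: cid.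
exists t'; split=> // k; pose phi := graph (restr (k := k.+1) t).
have /(has_jetP dsP)[det0 hphi] : has_jet phi (restr (k := k.+1) t) by exact: has_jet_graph.
pose t0 n := sval (cid (sjet_reg dsP det0 n)).
have ht0 n : val0 (sjet ds phi n) (t0 n) by rewrite /t0; case: cid.
have t0E n : (n < jdim k.+1)%N -> t0 n = t n.
  move=> hn; apply: val0_uniq (ht0 n) _; have := hphi n hn.
  by rewrite /restr inordK.
have [hj [_ hJ]] := surface_action det0.
have [cj [hcj hcj']] := at_origin ht0 hj.
have Uj : sunit (jacobian (sD ds phi) (sphi (act g phi))).
  exists cj; split=> //; suff -> : cj = c by [].
  apply: at_R_uniq hcj' _; apply: at_ext hc => n hn; rewrite t0E //.
  by apply: leq_trans hn _; exact: jdim_le.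
have [det0' {}hJ] := hJ Uj.
exists phi; split; apply/(has_jetP dsP); split=> // n hn.
  have hn' : (n < jdim k.+1)%N := leq_trans hn (jdim_le (leqnSn k)).
  by rewrite /restr inordK //; have := hphi n hn'; rewrite /restr inordK.
have [c' [h1 h2]] := at_origin ht0 (hJ n).
rewrite /restr inordK //; suff <- : c' = t' n by [].
apply: at_R_uniq h2 _; apply: at_ext (ht' n) => m hm; rewrite t0E //.
apply: leq_trans hm _; apply: jdim_le; apply: leq_trans (jord_lt hn) _; exact: leqnSn.
Qed.

End Action.

(** * Pull-back of rational functions *)

Section PullBack.

Variables (R : realType) (FF : fieldType) (jF : {rmorphism R -> FF}).
Variables (gen : nat -> FF) (D : 'I_2 -> FF -> FF).
Hypotheses (FFP : jet_field jF gen) (DP : total_derivatives jF gen D).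

Local Notation at_R := (at_jet jF gen (idfun : {rmorphism R -> R}) (@nonzero R)).
Local Notation gjet g := (gjet jF gen D g).
Local Notation gjac g := (jacobian D (gpoint jF gen g)).
Local Notation Dg g := (gD jF gen D g).

Definition jemb k : {rmorphism {fraction {mpoly R[jdim k]}} -> FF} :=
  frac_hom (@jet_indep R FF jF gen FFP k).

Lemma jemb_div k (P Q : {mpoly R[jdim k]}) : Q != 0 ->
  jemb k (tofrac P / tofrac Q) = ev jF gen P / ev jF gen Q.
Proof. exact: (frac_ext_div (@jet_indep R FF jF gen FFP k)). Qed.

Lemma jemb_tofrac k (P : {mpoly R[jdim k]}) : jemb k (tofrac P) = ev jF gen P.
Proof. exact: (frac_ext_tofrac (@jet_indep R FF jF gen FFP k)). Qed.

Let atR_const k t c : at_R k t (jF c) c.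
Proof. exact: (at_const jF gen (idfun : {rmorphism R -> R}) (nz1 R)). Qed.
Let atR_sub k t f h c d : at_R k t f c -> at_R k t h d -> at_R k t (f - h) (c - d).
Proof. exact: (at_sub FFP (@nzM R) (@nz0 R)). Qed.
Let atR_mul k t f h c d : at_R k t f c -> at_R k t h d -> at_R k t (f * h) (c * d).
Proof. exact: (at_mul (@nzM R)). Qed.
Let atR_div k t f h c d : at_R k t f c -> at_R k t h d -> d != 0 -> at_R k t (f / h) (c / d).
Proof. exact: (at_div (@nzM R) (@nz0 R)). Qed.
Let atR_le k m t f c : (k <= m)%N -> at_R k t f c -> at_R m t f c.
Proof. exact: at_le. Qed.
Let atR_uniq k k' t f c c' : at_R k t f c -> at_R k' t f c' -> c = c'.
Proof. exact: (at_R_uniq FFP). Qed.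

Lemma at_gjac g t : at_R 1 t (gjac g)
  ((\sum_l g i0 l * dnext t ord0 l) * (\sum_l g i1 l * dnext t ord_max l)
   - (\sum_l g i1 l * dnext t ord0 l) * (\sum_l g i0 l * dnext t ord_max l)).
Proof.
have h e n : at_R 1 t (D e (gpoint jF gen g n)) (\sum_l g (inord n) l * dnext t e l).
  rewrite /gpoint /linmap (der_sum (D_der DP e)).
  apply: (at_sum FFP (nz1 R) (@nzM R) (@nz0 R)) => l.
  rewrite (derM (D_der DP e)) (D_const DP) mul0r add0r (D_gen DP).
  apply: atR_mul; first exact: atR_const.
  apply: (@at_dnext _ _ _ _ _ _ _ (nz1 R) 0); exact: ltn_ord.
by apply: atR_sub; apply: atR_mul.
Qed.

(** At the 1-jet with slopes p, q, r, s the Jacobian is the determinant E p q r s,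
    which tells whether the image of the tangent plane is a graph. An
    alternating combination of its values at four planes is the product of the
    first two rows of g under omega, which is 1. *)
Lemma gjac_neq0 g : symplectic g -> gjac g != 0.
Proof.
move=> /symplectic_rows hg; apply/eqP => j0.
pose slope (p q r s : R) n : R := if n == 4%N then p else if n == 5%N then r else
  if n == 6%N then q else if n == 7%N then s else 0.
have z p q r s : (g i0 i0 + g i0 i2 * p + g i0 i3 * r) * (g i1 i1 + g i1 i2 * q + g i1 i3 * s)
    - (g i1 i0 + g i1 i2 * p + g i1 i3 * r) * (g i0 i1 + g i0 i2 * q + g i0 i3 * s) = 0.
  have h := at_gjac g (slope p q r s); rewrite j0 in h.
  have h0 : at_R 1 (slope p q r s) 0 0 by have := atR_const 1 (slope p q r s) 0; rewrite rmorph0.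
  have {h0 h} := atR_uniq h0 h; rewrite !sum4.
  have [k0 k1 k2 k3] : [/\ dnext (slope p q r s) ord0 i0 = 1, dnext (slope p q r s) ord0 i1 = 0,
     dnext (slope p q r s) ord0 i2 = p & dnext (slope p q r s) ord0 i3 = r].
    by rewrite /i0 /i1 /i2 /i3 !inordK.
  have [l0 l1 l2 l3] : [/\ dnext (slope p q r s) ord_max i0 = 0, dnext (slope p q r s) ord_max i1 = 1,
     dnext (slope p q r s) ord_max i2 = q & dnext (slope p q r s) ord_max i3 = s].
    by rewrite /i0 /i1 /i2 /i3 !inordK.
  by rewrite k0 k1 k2 k3 l0 l1 l2 l3 !(mulr0, mulr1, addr0, add0r) => <-.
suff : (1 : R) = 0 by move/eqP; rewrite oner_eq0.
pose E p q r s : R := (g i0 i0 + g i0 i2 * p + g i0 i3 * r) * (g i1 i1 + g i1 i2 * q + g i1 i3 * s)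
    - (g i1 i0 + g i1 i2 * p + g i1 i3 * r) * (g i0 i1 + g i0 i2 * q + g i0 i3 * s).
have -> : 1 = E 1 0 0 1 - E 1 0 0 0 - E 0 0 0 1 + E 0 0 0 0 *+ 2.
  by rewrite -{1}hg /E; ring.
by rewrite /E !z !subr0 mul0rn addr0.
Qed.

Lemma prolonged_sym g g' k (th th' : jet R k) :
  g' *m g = 1%:M -> prolonged g th th' -> prolonged g' th' th.
Proof.
move=> gg [phi [h h']]; exists (act g phi); split; first exact: h'.
suff -> : act g' (act g phi) = phi by [].
apply: funext => i; rewrite /act.
under eq_bigr do rewrite scaler_sumr.
rewrite exchange_big /= (bigD1 i) //= [X in _ + X]big1 ?addr0 => [|l li].
  under eq_bigr do rewrite scalerA.
  rewrite -scaler_suml; have := congr1 (fun A : 'M_(2 + 2) => A i i) gg.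
  by rewrite !mxE eqxx => ->; rewrite scale1r.
under eq_bigr do rewrite scalerA.
rewrite -scaler_suml; have := congr1 (fun A : 'M_(2 + 2) => A i l) gg.
by rewrite !mxE eq_sym (negbTE li) => ->; rewrite scale0r.
Qed.

Lemma at_ev_gjet g k t t' (P : {mpoly R[jdim k]}) :
    (forall n, at_R (jord n) t (gjet g n) (t' n)) ->
  at_R k t (ev jF (gjet g) P) (ev (idfun : {rmorphism R -> R}) t' P).
Proof.
move=> h; apply: (at_mmap FFP (nz1 R) (@nzM R) (@nz0 R)) => i.
by apply: atR_le (h i); apply: jord_lt.
Qed.

(** Almost every jet is the image of some jet, so that no polynomial vanishes on
    all the images. *)
Lemma gjet_indep g k (P : {mpoly R[jdim k]}) : symplectic g ->
  ev jF (gjet g) P = 0 -> P = 0.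
Proof.
move=> hg Pg; have [g' [hg' g'g gg']] := symplectic_inv hg.
have [ds dsP] := sder_exists R.
apply/eqP; apply: contraT => P0.
have [k0 [t ht]] := regular_jet FFP [:: ev jF gen P; gjac g'].
have [c [hc /(_ (jet_neq0 FFP P0)) c0]] := ht _ (mem_head _ _).
have [cj [hcj /(_ (gjac_neq0 hg')) cj0]] : exists c, at_R k0 t (gjac g') c /\ (gjac g' != 0 -> c != 0).
  by apply: ht; rewrite !inE eqxx orbT.
have hj := at_gjac g' t; have cE := atR_uniq hj hcj; rewrite cE in hj.
have [t' [ht' pr]] := at_prolonged FFP DP dsP hj cj0.
have [s [s' [_ es' _ hs]]] := prolonged_at FFP DP dsP (prolonged_sym gg' (pr k)).
have := at_ev_gjet P hs; rewrite Pg => h.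
have e0 : ev (idfun : {rmorphism R -> R}) s' P = 0.
  have z : at_R k s 0 0 by have := atR_const k s 0; rewrite rmorph0.
  exact: (atR_uniq h z).
have hcP := at_poly jF gen (idfun : {rmorphism R -> R}) (nz1 R) t P.
have et n : (n < jdim k)%N -> s' n = t n.
  by move=> hn; exact: (congr1 (fun f : jet R k => f (Ordinal hn)) (esym es')).
by move: c0; rewrite (atR_uniq hc hcP) -(ev_ext _ _ et) e0 eqxx.
Qed.

(** As the coordinates of the prolonged jet are algebraically independent, they
    can be substituted in all the rational functions. *)
Lemma pull_exists g : symplectic g -> exists h : {rmorphism FF -> FF},
  (forall c, h (jF c) = jF c) /\ (forall n, h (gen n) = gjet g n).
Proof. by move=> hg; apply: (jet_subst FFP) => k P; exact: gjet_indep. Qed.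

Section Pull.

Variables (g : 'M[R]_(2 + 2)) (h : {rmorphism FF -> FF}).
Hypotheses (hg : symplectic g) (hC : forall c, h (jF c) = jF c)
  (hX : forall n, h (gen n) = gjet g n).

Lemma gjet_next e n : Dg g e (gjet g n) = dnext (gjet g) e n.
Proof.
apply: jet_seq_next => [e1 e2 x|e1 m m2].
  exact: (dchange_comm (D_der DP) (D_comm FFP DP) (gjac_neq0 hg)).
by apply: dchange_self => //; exact: gjac_neq0.
Qed.

Lemma gD_der e : derivation (Dg g e).
Proof. exact: (dchange_der (D_der DP)). Qed.

Lemma gD_const e c : Dg g e (jF c) = 0.
Proof. by rewrite /gD /dchange !(D_const DP) !mulr0 subrr mul0r if_same. Qed.

(** Both sides are derivations along h, and on the jet coordinates the claim says
    that the prolonged jet is the jet of a surface. *)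
Lemma pull_D e f : h (D e f) = Dg g e (h f).
Proof.
move: f; apply: (jet_der_uniq FFP (h := h)) => [||c|n].
- split=> x y; first by rewrite (derD (D_der DP e)) rmorphD.
  by rewrite (derM (D_der DP e)) rmorphD !rmorphM.
- split=> x y; first by rewrite rmorphD (derD (gD_der e)).
  by rewrite rmorphM (derM (gD_der e)).
- by rewrite (D_const DP) hC gD_const rmorph0.
rewrite (D_gen DP) hX gjet_next /dnext; case: ifP => // _; exact: rmorph_nat.
Qed.

Lemma value_at k (f : jfield R k) t c : value f (restr t) c -> at_R k t (jemb k f) c.
Proof.
move=> [P [Q [Q0 -> ->]]]; exists P, Q; split=> //; apply: jemb_div.
by apply: contra_neq Q0 => ->; rewrite meval0.
Qed.

Lemma pull_jemb_div k (P Q : {mpoly R[jdim k]}) : Q != 0 ->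
  h (jemb k (tofrac P / tofrac Q)) = ev jF (gjet g) P / ev jF (gjet g) Q.
Proof.
by move=> Q0; rewrite jemb_div // fmorph_div !(@jet_hom_ev _ _ _ _ _ h jF (gjet g)).
Qed.

(** If the identity failed, it would fail at a jet where all the functions are
    regular and which g maps to a jet; there it contradicts the equality of the
    values. The converse evaluates the identity at the jets of a surface. *)
Lemma pullbackP k (f f' : jfield R k) : pullback g f f' <-> jemb k f' = h (jemb k f).
Proof.
have [ds dsP] := sder_exists R; split=> [pb|e th th' c c' pr].
  have [P [Q [Q0 fE]]] := fracP f; have [P' [Q' [Q'0 f'E]]] := fracP f'.
  apply/eqP; rewrite -subr_eq0; apply: contraT => ne.
  have gQ0 : ev jF (gjet g) Q != 0 by apply: contra_neq Q0 => /(gjet_indep hg).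
  have [k0 [t ht]] := regular_jet FFP [:: jemb k f' - h (jemb k f); ev jF gen Q'; gjac g;
     ev jF (gjet g) Q].
  have [c1 [hc1 /(_ ne) c10]] := ht _ (mem_head _ _).
  have [c2 [hc2 /(_ (jet_neq0 FFP Q'0)) c20]] : exists c, at_R k0 t (ev jF gen Q') c /\ (ev jF gen Q' != 0 -> c != 0).
    by apply: ht; rewrite !inE eqxx !orbT.
  have [c3 [hc3 /(_ (gjac_neq0 hg)) c30]] : exists c, at_R k0 t (gjac g) c /\ (gjac g != 0 -> c != 0).
    by apply: ht; rewrite !inE eqxx !orbT.
  have [c4 [hc4 /(_ gQ0) c40]] : exists c, at_R k0 t (ev jF (gjet g) Q) c /\ (ev jF (gjet g) Q != 0 -> c != 0).
    by apply: ht; rewrite !inE eqxx !orbT.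
  have hj := at_gjac g t; have cE := atR_uniq hj hc3; rewrite cE in hj.
  have [t' [ht' pr]] := at_prolonged FFP DP dsP hj c30.
  have hP := at_ev_gjet P ht'; have hQ := at_ev_gjet Q ht'.
  have hP' := at_poly jF gen (idfun : {rmorphism R -> R}) (nz1 R) t P'.
  have hQ' := at_poly jF gen (idfun : {rmorphism R -> R}) (nz1 R) t Q'.
  have Qt' : ev (idfun : {rmorphism R -> R}) t' Q != 0 by rewrite (atR_uniq hQ hc4).
  have Q't : ev (idfun : {rmorphism R -> R}) t Q' != 0 by rewrite (atR_uniq hQ' hc2).
  have v' : value f' (restr t) (ev (idfun : {rmorphism R -> R}) t P' / ev (idfun : {rmorphism R -> R}) t Q').
    by exists P', Q'; split.
  have v : value f (restr t') (ev (idfun : {rmorphism R -> R}) t' P / ev (idfun : {rmorphism R -> R}) t' Q).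
    by exists P, Q; split.
  have e := pb _ _ _ _ (pr k) v' v.
  have hf := value_at v'.
  have hhf : at_R k t (h (jemb k f)) (ev (idfun : {rmorphism R -> R}) t' P / ev (idfun : {rmorphism R -> R}) t' Q).
    by rewrite fE pull_jemb_div //; apply: atR_div.
  by move: c10; rewrite (atR_uniq hc1 (atR_sub hf hhf)) e subrr eqxx.
have [t [t' [-> -> _ ht]]] := prolonged_at FFP DP dsP pr => v' [P [Q [Q0 fE ->]]].
have hf' := value_at v'; rewrite e fE in hf'.
apply: atR_uniq hf' _; rewrite pull_jemb_div.
  by apply: atR_div => //; exact: at_ev_gjet.
by apply: contra_neq Q0 => ->; rewrite meval0.
Qed.

End Pull.

End PullBack.

(** * Total derivatives of functions of finite order *)

Section Comparison.

Variables (R : realType) (FF : fieldType) (jF : {rmorphism R -> FF}).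
Variables (gen : nat -> FF) (D : 'I_2 -> FF -> FF).
Hypotheses (FFP : jet_field jF gen) (DP : total_derivatives jF gen D).

Local Notation jemb := (jemb FFP).

Lemma jemb_widen k m (f : jfield R k) : (k <= m)%N -> jemb m (widen m f) = jemb k f.
Proof.
move=> km; have [P [Q [Q0 ->]]] := jfieldP f.
rewrite (widen_div P km Q0).
have h := jemb_div FFP (pwiden m P) (pwiden_neq0 km Q0).
have h' := jemb_div FFP P Q0.
by rewrite !ev_pwiden // in h; rewrite -h' in h; exact: h.
Qed.

(** Both sides are derivations of the polynomials, and agree on the coordinates. *)
Lemma ev_pD e k (P : {mpoly R[jdim k]}) :
  ev jF gen (pD e P) = D e (ev jF gen P).
Proof.
have De := D_der DP e.
pose h : {rmorphism _ -> FF} := @ev R FF jF gen k.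
have pwE (p : {mpoly R[jdim k]}) : ev jF gen (pwiden k.+1 p) = ev jF gen p.
  exact: ev_pwiden.
pose S (p : {mpoly R[jdim k]}) : FF := ev jF gen p^`M(inord e) +
   \sum_(a < 2) \sum_(i < k.+1) \sum_(l < k.+1 | (i + l <= k)%N)
     gen (jidx a (i + (e == ord0)) (l + (e == ord_max))) * ev jF gen (p^`M(inord (jidx a i l))).
have pDE : ev jF gen (pD e P) = S P.
  rewrite /pD rmorphD /= pwE; congr (_ + _); rewrite rmorph_sum; apply: eq_bigr => a _.
  rewrite rmorph_sum; apply: eq_bigr => i _.
  rewrite rmorph_sum; apply: eq_bigr => l il.
  rewrite rmorphM /= pwE evX inordK // jidx_lt //.
  case: (e) => -[|[|//]] /= _; lia.
rewrite pDE; move: (P); apply: (@mpoly_der_uniq _ _ _ h S (fun p => D e (ev jF gen p))) => [||c|i].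
- split=> p q; rewrite /S.
    rewrite mderivD rmorphD addrACA; congr (_ + _).
    rewrite -big_split /=; apply: eq_bigr => a _; rewrite -big_split /=; apply: eq_bigr => i _.
    by rewrite -big_split /=; apply: eq_bigr => l _; rewrite mderivD rmorphD mulrDr.
  rewrite mderivM rmorphD !rmorphM /= mulrDl mulrDr addrACA; congr (_ + _).
  rewrite mulr_suml mulr_sumr -big_split /=; apply: eq_bigr => a _.
  rewrite mulr_suml mulr_sumr -big_split /=; apply: eq_bigr => i _.
  rewrite mulr_suml mulr_sumr -big_split /=; apply: eq_bigr => l _.
  by rewrite mderivM rmorphD !rmorphM /=; ring.
- by split=> p q; cbv beta; rewrite (rmorphD h, rmorphM h) ?(derD De) ?(derM De).
- rewrite evC (D_const DP) /S mderivC rmorph0 add0r.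
  apply: big1 => a _; rewrite big1 // => i _; rewrite big1 // => l _.
  by rewrite mderivC rmorph0 mulr0.
rewrite evX (D_gen DP) /S mderivXU.
have inordE n : (n < jdim k)%N -> (i == inord n :> 'I_(jdim k)) = (nat_of_ord i == n).
  by move=> hn; rewrite -val_eqE /= inordK.
have he : (e < jdim k)%N := (leq_trans (ltn_ord e) (jdim_pos k)).
have -> : \sum_(a < 2) \sum_(i' < k.+1) \sum_(l < k.+1 | (i' + l <= k)%N)
     gen (jidx a (i' + (e == ord0)) (l + (e == ord_max))) * ev jF gen ('X_i)^`M(inord (jidx a i' l)) =
   \sum_(a < 2) \sum_(i' < k.+1) \sum_(l < k.+1 | (i' + l <= k)%N)
     gen (jidx a (i' + (e == ord0)) (l + (e == ord_max))) * (nat_of_ord i == jidx a i' l)%:R.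
  apply: eq_bigr => a _; apply: eq_bigr => i' _; apply: eq_bigr => l il.
  by rewrite mderivXU inordE ?jidx_lt // rmorph_nat.
rewrite inordE // rmorph_nat.
move: (nat_of_ord i) (ltn_ord i); apply: jcoord_lt => [||a i' l a2 il].
- rewrite dnext_base // big1 ?addr0 // => a _; rewrite big1 // => i' _.
  by rewrite big1 // => l _; rewrite mulr0.
- rewrite dnext_base // big1 ?addr0 // => a _; rewrite big1 // => i' _.
  by rewrite big1 // => l _; rewrite mulr0.
have -> : (jidx a i' l == e) = false by apply/negbTE; rewrite neq_ltn (leq_trans (ltn_ord e)) ?orbT.
have ik : (i' < k.+1)%N by lia.
have lk : (l < k.+1)%N by lia.
have ne (a' i1 l1 : nat) : (a' < 2)%N -> (jidx a i' l == jidx a' i1 l1) = [&& a == a', i' == i1 & l == l1].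
  by move=> a'2; apply/eqP/and3P => [/jidx_inj[]// -> -> ->|[/eqP -> /eqP -> /eqP ->]//]; split.
rewrite add0r (bigD1 (Ordinal a2)) //= (bigD1 (Ordinal ik)) //= (bigD1 (Ordinal lk)) //=.
rewrite eqxx mulr1 !big1 ?addr0 ?dnext_jidx //.
- move=> a' na; rewrite big1 // => i1 _; rewrite big1 // => l1 _.
  by rewrite -val_eqE /= in na; rewrite ne // [a == _]eq_sym (negbTE na) mulr0.
- move=> i1 ni; rewrite big1 // => l1 _.
  by rewrite -val_eqE /= in ni; rewrite ne // [i' == _]eq_sym (negbTE ni) andbF mulr0.
- move=> l1 /andP[_ nl]; rewrite -val_eqE /= in nl.
  by rewrite ne // [l == _]eq_sym (negbTE nl) !andbF mulr0.
Qed.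

Lemma jemb_D e k (f : jfield R k) : jemb k.+1 (Defs.D e f) = D e (jemb k f).
Proof.
have d0 : den f != 0 by exact: denom_ratioP.
have fE : jemb k f = ev jF gen (num f) / ev jF gen (den f) by [].
have pwE (p : {mpoly R[jdim k]}) : ev jF gen (pwiden k.+1 p) = ev jF gen p.
  exact: ev_pwiden.
rewrite fE (derV2 (D_der DP e)).
have numE : ev jF gen (pD e (num f) * pwiden k.+1 (den f) - pwiden k.+1 (num f) * pD e (den f)) =
    D e (ev jF gen (num f)) * ev jF gen (den f) - ev jF gen (num f) * D e (ev jF gen (den f)).
  by rewrite rmorphB !rmorphM /= !pwE !ev_pD.
have denE : ev jF gen (pwiden k.+1 (den f) ^+ 2) = ev jF gen (den f) ^+ 2.
  by rewrite rmorphXn /= pwE.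
rewrite -numE -denE; apply: (jemb_div FFP).
exact: (expf_neq0 2 (pwiden_neq0 (leqnSn k) d0)).
Qed.

Lemma jemb_nabla (v : 'cV[jfield R 2]_(2 + 2)) k (f : jfield R k.+1) :
  jemb k.+2 (nabla v f) =
  \sum_(e < 2) jemb 2 (v (lshift 2 e) 0) * D e (jemb k.+1 f).
Proof.
rewrite /nabla [LHS](rmorph_sum (jemb k.+2)); apply: eq_bigr => e _.
by rewrite [LHS](rmorphM (jemb k.+2)) jemb_widen // jemb_D.
Qed.

End Comparison.

Lemma comp_mderiv (F : fieldType) m n (p : {mpoly F[n]}) (G : n.-tuple {mpoly F[m]}) e :
  (p \mPo G)^`M(e) = \sum_i (p^`M(i) \mPo G) * (tnth G i)^`M(e).
Proof.
move: p; pose h : {rmorphism _ -> _} := @comp_mpoly n F m G.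
have hE p : h p = p \mPo G by [].
pose S p := \sum_i h p^`M(i) * (tnth G i)^`M(e).
apply: (@mpoly_der_uniq _ _ _ h (fun p => (h p)^`M(e)) S) => [||c|i].
- split=> p q; cbv beta; first by rewrite rmorphD mderivD.
  by rewrite rmorphM mderivM.
- split=> p q; rewrite /S.
    by rewrite -big_split /=; apply: eq_bigr => i _; rewrite mderivD rmorphD mulrDl.
  rewrite mulr_suml mulr_sumr -big_split /=; apply: eq_bigr => i _.
  by rewrite mderivM rmorphD !rmorphM /=; ring.
- by rewrite /S /h /= comp_mpolyC mderivC big1 // => i _; rewrite mderivC comp_mpoly0 mul0r.
rewrite /S (bigD1 i) //= big1 ?addr0 => [|l li].
  by rewrite mderivXU eqxx rmorph1 mul1r /h /= comp_mpolyXU -tnth_nth.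
by rewrite mderivXU eq_sym (negbTE li) rmorph0 mul0r.
Qed.

(** * Symplectic frames attached to a 2-jet *)

Section ScalarFrames.

Variables (F : fieldType) (th : nat -> F).
Implicit Types (v w : 'cV[F]_(2 + 2)) (s : 'rV[F]_(2 + 2)).

(** The first derivatives of u_0, u_1 are the jet coordinates 4, 6 and 5, 7;
    the second ones are 8, 10, 12 and 9, 11, 13. *)
Definition stangent v : Prop :=
  v i2 0 = th 4 * v i0 0 + th 6 * v i1 0 /\ v i3 0 = th 5 * v i0 0 + th 7 * v i1 0.

Definition snormal v : Prop :=
  v i1 0 = th 5 * v i2 0 - th 4 * v i3 0 /\ v i0 0 = th 6 * v i3 0 - th 7 * v i2 0.

Definition sann s : Prop :=
  s 0 i0 = - (s 0 i2 * th 4 + s 0 i3 * th 5) /\ s 0 i1 = - (s 0 i2 * th 6 + s 0 i3 * th 7).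

(** The second fundamental form, paired with a covector. *)
Definition sform s v w : F :=
  - (s 0 i2 * (th 8 * v i0 0 * w i0 0 + th 10 * (v i0 0 * w i1 0 + v i1 0 * w i0 0) + th 12 * v i1 0 * w i1 0)
     + s 0 i3 * (th 9 * v i0 0 * w i0 0 + th 11 * (v i0 0 * w i1 0 + v i1 0 * w i0 0) + th 13 * v i1 0 * w i1 0)).

Definition sgram s : 'M[F]_2 := \matrix_(e, e')
  - (s 0 i2 * th (jidx 0 ((e == ord0) + (e' == ord0)) ((e == ord_max) + (e' == ord_max)))
     + s 0 i3 * th (jidx 1 ((e == ord0) + (e' == ord0)) ((e == ord_max) + (e' == ord_max)))).

Lemma sum2 (V : nmodType) (f : 'I_2 -> V) : \sum_i f i = f ord0 + f ord_max.
Proof. by rewrite !big_ord_recl big_ord0 addr0; congr (_ + f _); apply: val_inj. Qed.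

Lemma lshift_i : (lshift 2 ord0 = i0 :> 'I_(2 + 2)) * (lshift 2 (ord_max : 'I_2) = i1 :> 'I_(2 + 2))
  * (rshift 2 ord0 = i2 :> 'I_(2 + 2)) * (rshift 2 (ord_max : 'I_2) = i3 :> 'I_(2 + 2)).
Proof. by do !split; apply: val_inj; rewrite /= inordK. Qed.

Lemma qform_gram s v w : qform (sgram s) v w = sform s v w.
Proof.
rewrite /qform /sform mxE !sum2 ![(_ *m _) _ _]mxE !sum2 !mxE /= !lshift_i.
rewrite -[jidx 0 2 0]/8%N -[jidx 0 1 1]/10%N -[jidx 0 0 2]/12%N.
rewrite -[jidx 1 2 0]/9%N -[jidx 1 1 1]/11%N -[jidx 1 0 2]/13%N.
ring.
Qed.

Lemma pairingE s v : pairing s v = s 0 i0 * v i0 0 + s 0 i1 * v i1 0 + s 0 i2 * v i2 0 + s 0 i3 * v i3 0.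
Proof. by rewrite /pairing mxE sum4. Qed.

(** The same conditions as in the definition of the frames of a jet, in
    coordinates, so that they can be transported along field morphisms. *)
Definition sframe (fr : frame F) : Prop :=
  [/\ [/\ forall i : 'I_(2 + 2), th i = vpar fr i 0 + vperp fr i 0, stangent (vpar fr)
        & snormal (vperp fr)],
      [/\ stangent (wpar fr), sform (sigma1 fr) (vpar fr) (vpar fr) = 0,
          omega (vpar fr) (wpar fr) = 1, sform (sigma1 fr) (wpar fr) (wpar fr) = 0
        & sform (sigma1 fr) (vpar fr) (wpar fr) = 1],
      sann (sigma1 fr) /\ Q1 fr = sgram (sigma1 fr),
      [/\ snormal (wperp fr), pairing (sigma1 fr) (wperp fr) = 0
        & omega (vperp fr) (wperp fr) = 1]
    & [/\ sann (sigma2 fr), pairing (sigma2 fr) (vperp fr) = 0,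
          pairing (sigma2 fr) (wperp fr) = 1
        & Q2 fr = sgram (sigma2 fr)]].

End ScalarFrames.

Section FrameEquations.

Variables (F : fieldType) (th : jet F 2).
Hypothesis F2 : (2%:R : F) != 0.

Definition jcoord (n : nat) : F := th (inord n).

Lemma graph_l (e : 'I_2) : graph th (lshift 2 e) = (th (inord e))%:MP + 'X_e.
Proof.
rewrite /graph; case: splitP => l /= h; first by rewrite (ord_inj h).
by have := ltn_ord e; rewrite h.
Qed.

Lemma graph_r (a : 'I_2) : graph th (rshift 2 a) = taylor th a.
Proof.
rewrite /graph; case: splitP => l /= h; last by rewrite (ord_inj (addnI h)).
by have := ltn_ord l; rewrite -h.
Qed.

Lemma taylor_at0 (a : 'I_2) i l : (i + l <= 2)%N ->
  at0 (iter i (mderiv ord0) (iter l (mderiv ord_max) (taylor th a))) = jcoord (jidx a i l).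
Proof.
move=> il; rewrite at0_iter_mderiv taylor_mcoeff // divfK //.
have : ((i`! * l`!)%N == 1%N) || ((i`! * l`!)%N == 2%N).
  by move: i l il => [|[|[|i]]] [|[|[|l]]].
by case/orP => /eqP ->; rewrite ?oner_neq0.
Qed.

Lemma splitr4P (P : 'I_(2 + 2) -> Prop) :
  (forall e : 'I_2, P (lshift 2 e)) -> (forall a : 'I_2, P (rshift 2 a)) -> forall i, P i.
Proof.
move=> hl hr i; rewrite -(splitK i); case: (split i) => [e|a]; [exact: hl|exact: hr].
Qed.

Lemma base_pointE i : base_point th i 0 = jcoord i.
Proof.
rewrite mxE; elim/splitr4P: i => [e|a].
  by rewrite graph_l /at0 mevalD mevalC mevalXU addr0.
by rewrite graph_r (@taylor_at0 a 0 0).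
Qed.

Lemma tangent_mxl e e' : tangent_mx th (lshift 2 e) e' = (e == e')%:R.
Proof.
rewrite mxE graph_l mderivD mderivC add0r mderivXU.
by case: eqP => _; rewrite /at0 ?meval1 ?meval0.
Qed.

Lemma tangent_mxr a e : tangent_mx th (rshift 2 a) e = jcoord (jidx a (e == ord0) (e == ord_max)).
Proof.
rewrite mxE graph_r; elim/ord2P: e; first exact: (@taylor_at0 a 1 0).
exact: (@taylor_at0 a 0 1).
Qed.

Lemma tmx : (tangent_mx th i0 ord0 = 1) * (tangent_mx th i0 ord_max = 0)
  * (tangent_mx th i1 ord0 = 0) * (tangent_mx th i1 ord_max = 1)
  * (tangent_mx th i2 ord0 = jcoord 4) * (tangent_mx th i2 ord_max = jcoord 6)
  * (tangent_mx th i3 ord0 = jcoord 5) * (tangent_mx th i3 ord_max = jcoord 7).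
Proof. by rewrite -!lshift_i !tangent_mxl !tangent_mxr. Qed.

Lemma tangentP v : tangent th v <-> stangent jcoord v.
Proof.
split=> [[c ->]|[h2 h3]].
  by split; rewrite ![(_ *m _) _ _]mxE !sum2 !tmx; ring.
exists (\col_e v (lshift 2 e) 0); apply/matrixP => i z; rewrite ord1 [RHS]mxE sum2 ![(\col__ _) _ _]mxE !lshift_i.
by elim/ord4P: i; rewrite !tmx ?h2 ?h3; ring.
Qed.

Lemma tangent_col e i : (tangent_mx th *m (delta_mx e 0 : 'cV_2)) i 0 = tangent_mx th i e.
Proof. by rewrite -colE [LHS]mxE. Qed.

Lemma normalP v : normal th v <-> snormal jcoord v.
Proof.
split=> [h|[h1 h0] t /tangentP[t2 t3]].
  have := h (tangent_mx th *m delta_mx ord0 0); have := h (tangent_mx th *m delta_mx ord_max 0).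
  rewrite !omegaE !tangent_col !tmx => /(_ (ex_intro _ _ erefl)) e1 /(_ (ex_intro _ _ erefl)) e0.
  split; apply/eqP; rewrite -subr_eq0; apply/eqP; [rewrite -[RHS]oppr0 -{1}e0|rewrite -[RHS]e1]; ring.
by rewrite omegaE h0 h1 t2 t3; ring.
Qed.

Lemma annihilatorP s : annihilator th s <-> sann jcoord s.
Proof.
split=> [h|[h0 h1] t /tangentP[t2 t3]].
  have := h (tangent_mx th *m delta_mx ord0 0); have := h (tangent_mx th *m delta_mx ord_max 0).
  rewrite !pairingE !tangent_col !tmx => /(_ (ex_intro _ _ erefl)) e1 /(_ (ex_intro _ _ erefl)) e0.
  split; apply/eqP; rewrite -subr_eq0; apply/eqP; [rewrite -[RHS]e0|rewrite -[RHS]e1]; ring.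
by rewrite pairingE h0 h1 t2 t3; ring.
Qed.

Lemma hess_graph_l (e e1 e2 : 'I_2) : (graph th (lshift 2 e))^`M(e1)^`M(e2) = 0.
Proof.
rewrite graph_l mderivD mderivC add0r mderivXU.
by case: eqP => _; rewrite ?mderiv0 // -mpolyC1 mderivC.
Qed.

Lemma hess_graph_r (a e1 e2 : 'I_2) : at0 (graph th (rshift 2 a))^`M(e1)^`M(e2) =
  jcoord (jidx a ((e1 == ord0) + (e2 == ord0)) ((e1 == ord_max) + (e2 == ord_max))).
Proof.
rewrite graph_r; elim/ord2P: e1; elim/ord2P: e2.
- exact: (@taylor_at0 a 2 0).
- by rewrite mderiv_comm; exact: (@taylor_at0 a 1 1).
- exact: (@taylor_at0 a 1 1).
- exact: (@taylor_at0 a 0 2).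
Qed.

Let G : (2 + 2).-tuple {mpoly F[2]} := [tuple graph th i | i < 2 + 2].
Let p0 (i : 'I_(2 + 2)) : F := base_point th i 0.

Lemma at0_compG (p : {mpoly F[2 + 2]}) : at0 (p \mPo G) = p.@[p0].
Proof.
by rewrite /at0 comp_mpoly_meval; apply: meval_eq => i; rewrite tnth_mktuple /p0 mxE.
Qed.

(** The chain rule of order two; sgram is minus the pairing of a covector with
    the second derivatives of the surface. *)
Lemma hess_comp (f : {mpoly F[2 + 2]}) e e' :
  at0 (f \mPo G)^`M(e)^`M(e') =
  (((tangent_mx th)^T *m (\matrix_(i, j) (f^`M(i)^`M(j)).@[p0]) *m tangent_mx th)
   - sgram jcoord (\row_i (f^`M(i)).@[p0])) e e'.
Proof.
rewrite comp_mderiv raddf_sum /=.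
under eq_bigr do rewrite mderivM comp_mderiv.
have compG p : (p \mPo G).@[fun=> 0] = p.@[p0] by exact: at0_compG.
rewrite big_split /= /at0 mevalD !raddf_sum /= [RHS]mxE; congr (_ + _).
  rewrite -mulmxA [RHS]mxE; apply: eq_bigr => i _.
  rewrite mevalM raddf_sum /= tnth_mktuple mulrC.
  rewrite [X in _ = X * _]mxE [tangent_mx th i e]mxE; congr (_ * _).
  rewrite [RHS]mxE; apply: eq_bigr => l _.
  by rewrite mevalM compG tnth_mktuple !mxE.
have h i : ((f^`M(i) \mPo G) * (tnth G i)^`M(e)^`M(e')).@[fun=> 0] =
    (f^`M(i)).@[p0] * at0 (graph th i)^`M(e)^`M(e').
  by rewrite mevalM compG tnth_mktuple.
rewrite sum4 !h -!lshift_i !hess_graph_l !hess_graph_r /at0 meval0 !mulr0 !add0r.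
have -> (A : 'M[F]_2) : (- A) e e' = - A e e' by rewrite mxE.
by rewrite [sgram _ _ _ _]mxE opprK !lshift_i !mxE.
Qed.

Lemma eq_upto_mderiv (q : {mpoly F[2]}) e e' : eq_upto 2 q 0 -> at0 q^`M(e)^`M(e') = 0.
Proof.
move=> h; rewrite at0_mcoeff !mcoeff_mderiv h ?mcoeff0 ?mul0rn //.
by rewrite !mdegD !mdeg1 mdeg0.
Qed.

(** The Hessian of f along the surface is the sum of the restriction of the
    Hessian of f and of the derivative of f along the second derivatives of the
    surface, so it depends on the differential of f only. Conversely, the
    equation u = taylor (x) of the graph, paired with s, is a function with
    differential s. *)
Lemma correspondsP s Q : sann jcoord s -> (corresponds th s Q <-> Q = sgram jcoord s).
Proof.
move=> hs; split=> [[f [hf -> ->]]|->].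
  apply/matrixP => e e'; apply/eqP; rewrite -subr_eq0; apply/eqP.
  have := hess_comp f e e'; rewrite eq_upto_mderiv //.
  have subE (A B : 'M[F]_2) : (A - B) e e' = A e e' - B e e' by rewrite !mxE.
  by rewrite subE => <-.
pose Z : 2.-tuple {mpoly F[2 + 2]} := [tuple 'X_(lshift 2 e) - (jcoord e)%:MP | e < 2].
pose u (a : 'I_2) : {mpoly F[2 + 2]} := 'X_(rshift 2 a) - (taylor th a \mPo Z).
pose f := \sum_(a < 2) s 0 (rshift 2 a) *: u a.
have ZG p : (p \mPo Z) \mPo G = p.
  rewrite -[LHS]/((@comp_mpoly _ F _ G \o @comp_mpoly _ F _ Z) p) -[RHS]/(idfun p).
  apply: mpoly_hom_uniq => [c|e] /=; first by rewrite !comp_mpolyC.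
  rewrite comp_mpolyXU -tnth_nth tnth_mktuple rmorphB /= comp_mpolyC comp_mpolyXU.
  by rewrite -tnth_nth tnth_mktuple graph_l /jcoord addrAC subrr add0r.
have fG : f \mPo G = 0.
  rewrite /f raddf_sum big1 //= => a _; rewrite comp_mpolyZ /u rmorphB /= ZG.
  by rewrite comp_mpolyXU -tnth_nth tnth_mktuple graph_r subrr scaler0.
have Zi e i : (tnth Z e)^`M(i) = (lshift 2 e == i)%:R.
  by rewrite tnth_mktuple mderivB mderivC subr0 mderivXU.
have Z0 p : (p \mPo Z).@[p0] = at0 p.
  rewrite comp_mpoly_meval; apply: meval_eq => e; rewrite tnth_mktuple mevalB mevalC mevalXU.
  by rewrite /p0 base_pointE subrr.
have grad : \row_i (f^`M(i)).@[p0] = s.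
  apply/matrixP => z i; rewrite ord1 mxE /f sum2 mderivD !mderivZ mevalD !mevalZ.
  have uE a i' : (u a)^`M(i').@[p0] = (rshift 2 a == i')%:R
     - \sum_e at0 (taylor th a)^`M(e) * (lshift 2 e == i')%:R.
    rewrite /u mderivB mevalB mderivXU comp_mderiv rmorph_nat; congr (_ - _).
    rewrite rmorph_sum; apply: eq_bigr => e _.
    by rewrite rmorphM /= Z0 Zi rmorph_nat.
  have t4 : at0 (taylor th ord0)^`M(ord0) = jcoord 4 by exact: (@taylor_at0 ord0 1 0 isT).
  have t6 : at0 (taylor th ord0)^`M(ord_max) = jcoord 6 by exact: (@taylor_at0 ord0 0 1 isT).
  have t5 : at0 (taylor th ord_max)^`M(ord0) = jcoord 5 by exact: (@taylor_at0 ord_max 1 0 isT).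
  have t7 : at0 (taylor th ord_max)^`M(ord_max) = jcoord 7 by exact: (@taylor_at0 ord_max 0 1 isT).
  rewrite !uE !sum2 t4 t5 t6 t7 !lshift_i.
  have [h0 h1] := hs; elim/ord4P: i; rewrite -!val_eqE /= !inordK //= ?h0 ?h1; ring.
exists f; split; rewrite -/G ?fG ?grad //.
apply/matrixP => e e'; apply/eqP; rewrite eq_sym -subr_eq0; apply/eqP.
have subE (A B : 'M[F]_2) : (A - B) e e' = A e e' - B e e' by rewrite !mxE.
by have := hess_comp f e e'; rewrite fG grad !mderiv0 /at0 meval0 subE => <-.
Qed.

Lemma is_frameP fr : is_frame th fr <-> sframe jcoord fr.
Proof.
split.
- case=> [[hb /tangentP ht /normalP hn]] [/tangentP hw q1 o1 q2 q3] [/annihilatorP hs1 /(correspondsP _ hs1) hQ1].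
  case=> /normalP hz p1 o2 [/annihilatorP hs2 p2 p3 /(correspondsP _ hs2) hQ2].
  move: q1 q2 q3; rewrite hQ1 !qform_gram => q1 q2 q3; split; split=> //.
  by move=> i; rewrite -base_pointE hb mxE.
- case=> [[hb ht hn]] [hw q1 o1 q2 q3] [hs1 hQ1] [hz p1 o2] [hs2 p2 p3 hQ2].
  split; split=> //; try exact/tangentP; try exact/normalP; try exact/annihilatorP;
    try exact/correspondsP; rewrite ?hQ1 ?qform_gram //.
  by apply/matrixP => i z; rewrite ord1 base_pointE [jcoord i]hb mxE.
Qed.

End FrameEquations.

(** * Uniqueness of the frame *)

Section FrameAlgebra.

Variable F : fieldType.
Implicit Types (v w x y : 'cV[F]_(2 + 2)) (s t : 'rV[F]_(2 + 2)).

Lemma omegaDl x y w : omega (x + y) w = omega x w + omega y w.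
Proof. by rewrite !omegaE !mxE; ring. Qed.
Lemma omegaZl a x w : omega (a *: x) w = a * omega x w.
Proof. by rewrite !omegaE !mxE; ring. Qed.
Lemma omegaC x y : omega x y = - omega y x.
Proof. by rewrite !omegaE; ring. Qed.
Lemma omegaxx x : omega x x = 0.
Proof. by rewrite omegaE; ring. Qed.
Lemma pairingD s x y : pairing s (x + y) = pairing s x + pairing s y.
Proof. by rewrite !pairingE !mxE; ring. Qed.
Lemma pairingZ s a x : pairing s (a *: x) = a * pairing s x.
Proof. by rewrite !pairingE !mxE; ring. Qed.
Lemma pairingDl s t x : pairing (s + t) x = pairing s x + pairing t x.
Proof. by rewrite !pairingE !mxE; ring. Qed.
Lemma pairingZl a s x : pairing (a *: s) x = a * pairing s x.
Proof. by rewrite !pairingE !mxE; ring. Qed.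

Definition basis_mx (e1 e2 e3 e4 : 'cV[F]_(2 + 2)) : 'M[F]_(2 + 2) :=
  \matrix_(i, k) (if k == i0 then e1 i 0 else if k == i1 then e2 i 0
                  else if k == i2 then e3 i 0 else e4 i 0).

Lemma basis_mxE e1 e2 e3 e4 : let E := basis_mx e1 e2 e3 e4 in
  [/\ col i0 E = e1, col i1 E = e2, col i2 E = e3 & col i3 E = e4].
Proof.
by split; apply/matrixP => i z; rewrite ord1 !mxE -!val_eqE /= !inordK.
Qed.

Definition symplectic_basis (e1 e2 e3 e4 : 'cV[F]_(2 + 2)) : Prop :=
  [/\ omega e1 e2 = 1, omega e3 e4 = 1, omega e1 e3 = 0 & omega e1 e4 = 0]
  /\ omega e2 e3 = 0 /\ omega e2 e4 = 0.

Lemma gram_entry (E : 'M[F]_(2 + 2)) i k :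
  (E^T *m omega_mx F *m E) i k = omega (col i E) (col k E).
Proof.
have entry (A : 'M[F]_(2 + 2)) : ((delta_mx i 0)^T *m A *m delta_mx k 0 : 'M_1) 0 0 = A i k.
  by rewrite trmx_delta -rowE -colE !mxE.
by rewrite -entry /omega !colE trmx_mul !mulmxA.
Qed.

Lemma basis_mx_symplectic e1 e2 e3 e4 : symplectic_basis e1 e2 e3 e4 ->
  symplectic (basis_mx e1 e2 e3 e4).
Proof.
move=> [[h12 h34 h13 h14] [h23 h24]]; apply/symplectic_mx/matrixP => i k.
have [c1 c2 c3 c4] := basis_mxE e1 e2 e3 e4.
rewrite gram_entry omega_mxE; elim/ord4P: i; elim/ord4P: k;
  rewrite ?c1 ?c2 ?c3 ?c4 ?omegaxx -!val_eqE /= !inordK //= ?h12 ?h34 ?h13 ?h14 ?h23 ?h24 //;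
  try (by ring); rewrite omegaC ?h12 ?h34 ?h13 ?h14 ?h23 ?h24; ring.
Qed.

Lemma symplectic_span e1 e2 e3 e4 x : symplectic_basis e1 e2 e3 e4 ->
  exists a b c d, x = a *: e1 + b *: e2 + c *: e3 + d *: e4.
Proof.
move=> hE; have [E' [_ _ EE']] := symplectic_inv (basis_mx_symplectic hE).
pose y := E' *m x; exists (y i0 0), (y i1 0), (y i2 0), (y i3 0).
have -> : x = basis_mx e1 e2 e3 e4 *m y by rewrite mulmxA EE' mul1mx.
apply/matrixP => i z; rewrite ord1 ![fun_of_matrix (_ + _) _ _]mxE [LHS]mxE sum4.
by rewrite ![basis_mx _ _ _ _ _ _]mxE -!val_eqE /= !inordK //= ![fun_of_matrix (_ *: _) _ _]mxE !(mulrC (y _ _)).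
Qed.

Lemma symplectic_coord e1 e2 e3 e4 x : symplectic_basis e1 e2 e3 e4 ->
  x = omega x e2 *: e1 - omega x e1 *: e2 + omega x e4 *: e3 - omega x e3 *: e4.
Proof.
move=> hE; have [a [b [c [d xE]]]] := symplectic_span x hE.
case: hE => -[h12 h34 h13 h14] [h23 h24].
have o y : omega x y = a * omega e1 y + b * omega e2 y + c * omega e3 y + d * omega e4 y.
  by rewrite xE !omegaDl !omegaZl.
have h (k l : 'cV[F]_(2 + 2)) (r : F) : omega k l = r -> omega l k = - r.
  by move=> <-; rewrite omegaC.
rewrite !o !omegaxx h12 h34 h13 h14 h23 h24 (h _ _ _ h12) (h _ _ _ h34) (h _ _ _ h13).
rewrite (h _ _ _ h14) (h _ _ _ h23) (h _ _ _ h24) {1}xE.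
by apply/matrixP => i z; rewrite !mxE; ring.
Qed.

Lemma pairing_ext s t : (forall x, pairing s x = pairing t x) -> s = t.
Proof.
move=> h; apply/matrixP => z i; rewrite ord1; have := h (delta_mx i 0).
by rewrite /pairing -!colE !mxE.
Qed.

Lemma tangent_normal (th : nat -> F) v w : stangent th v -> snormal th w -> omega v w = 0.
Proof. by move=> [h2 h3] [k1 k0]; rewrite omegaE h2 h3 k1 k0; ring. Qed.

Lemma ann_tangent (th : nat -> F) s v : sann th s -> stangent th v -> pairing s v = 0.
Proof. by move=> [h0 h1] [k2 k3]; rewrite pairingE h0 h1 k2 k3; ring. Qed.

Section OneFrame.

Variables (th : nat -> F) (fr : frame F).
Hypothesis hfr : sframe th fr.

Local Notation e1 := (vpar fr).
Local Notation e2 := (wpar fr).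
Local Notation e3 := (vperp fr).
Local Notation e4 := (wperp fr).

Lemma frame_basis : symplectic_basis e1 e2 e3 e4.
Proof.
case: hfr => -[_ ht hn] [hw _ o1 _ _] _ [hz _ o2] _.
by split; split=> //; apply: (tangent_normal (th := th)).
Qed.

Lemma frame_tangent v : stangent th v -> v = omega v e2 *: e1 - omega v e1 *: e2.
Proof.
move=> hv; case: hfr => -[_ _ hn] _ _ [hz _ _] _.
rewrite {1}(symplectic_coord v frame_basis) (tangent_normal hv hn) (tangent_normal hv hz).
by rewrite !scale0r addr0 subr0.
Qed.

Lemma frame_normal v : snormal th v -> v = omega v e4 *: e3 - omega v e3 *: e4.
Proof.
move=> hv; case: hfr => -[_ ht _] [hw _ _ _ _] _ _ _.
rewrite {1}(symplectic_coord v frame_basis) (omegaC v e1) (omegaC v e2).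
by rewrite (tangent_normal ht hv) (tangent_normal hw hv) oppr0 !scale0r subr0 add0r.
Qed.

Lemma sform_ann0 v w : sform th 0 v w = 0.
Proof. by rewrite /sform !mxE; ring. Qed.

(** sigma1 and sigma2 are a basis of the annihilator; the equation is multiplied
    by I2a to avoid a division. *)
Lemma frame_covector s : sann th s ->
  I2a fr *: s = pairing s e3 *: sigma1 fr + (I2a fr * pairing s e4) *: sigma2 fr.
Proof.
move=> hs; case: hfr => -[_ ht _] [hw _ _ _ _] [hs1 _] [_ p1 _] [hs2 p2 p3 _].
apply: pairing_ext => x; rewrite pairingDl !pairingZl.
rewrite (symplectic_coord x frame_basis) -!scaleNr.
rewrite !pairingD !pairingZ (ann_tangent hs ht) (ann_tangent hs hw).
rewrite (ann_tangent hs1 ht) (ann_tangent hs1 hw) (ann_tangent hs2 ht) (ann_tangent hs2 hw).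
by rewrite p1 p2 p3 -/(I2a fr); ring.
Qed.

(** Otherwise sigma1 would annihilate V, and Q1 would be zero. *)
Lemma I2a_neq0 : I2a fr != 0.
Proof.
apply/eqP => a0; case: hfr => -[_ ht _] [hw _ _ _ q] [hs1 _] [_ p1 _] _.
have s0 : sigma1 fr = 0.
  apply: pairing_ext => x; rewrite (symplectic_coord x frame_basis) -!scaleNr.
  rewrite !pairingD !pairingZ (ann_tangent hs1 ht) (ann_tangent hs1 hw) p1.
  by rewrite -[pairing _ e3]/(I2a fr) a0 /pairing !mul0mx !mxE; ring.
by move/eqP: q; rewrite s0 sform_ann0 eq_sym oner_eq0.
Qed.

Lemma frame_form s v w : sann th s -> I2a fr * sform th s v w =
  pairing s e3 * sform th (sigma1 fr) v w + I2a fr * pairing s e4 * sform th (sigma2 fr) v w.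
Proof.
move=> /frame_covector h.
have e k : I2a fr * s 0 k = pairing s e3 * sigma1 fr 0 k + I2a fr * pairing s e4 * sigma2 fr 0 k.
  by have := congr1 (fun A : 'rV_(2 + 2) => A 0 k) h; rewrite !mxE.
have -> : I2a fr * sform th s v w = - ((I2a fr * s 0 i2) * (th 8 * v i0 0 * w i0 0 + th 10 * (v i0 0 * w i1 0 + v i1 0 * w i0 0) + th 12 * v i1 0 * w i1 0)
     + (I2a fr * s 0 i3) * (th 9 * v i0 0 * w i0 0 + th 11 * (v i0 0 * w i1 0 + v i1 0 * w i0 0) + th 13 * v i1 0 * w i1 0)).
  by rewrite /sform; ring.
by rewrite !e /sform; ring.
Qed.

Lemma I2b_form : I2b fr = sform th (sigma2 fr) e1 e1.
Proof. by case: hfr => _ _ _ _ [_ _ _ hQ]; rewrite /I2b hQ qform_gram. Qed.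

End OneFrame.

Lemma sform_lin (th : nat -> F) s v w w' a b :
  sform th s v (a *: w + b *: w') = a * sform th s v w + b * sform th s v w'.
Proof. by rewrite /sform !mxE; ring. Qed.

Lemma sformC (th : nat -> F) s v w : sform th s v w = sform th s w v.
Proof. by rewrite /sform; ring. Qed.

(** The decomposition of the base point is unique, which fixes e1, e3. The
    conditions on w^par leave the freedom of a multiple of e1, and those on Q1 a
    multiple of sigma2, which is excluded by I2b != 0, as Q1 (e1, e1) = 0. Then
    Q1 (e2, e2) = 0 excludes the multiple of e1, because 2 != 0. The rest of the
    frame is determined by linear conditions. *)
Lemma sframe_uniq (th : nat -> F) fr fr' : (2%:R : F) != 0 ->
  sframe th fr -> sframe th fr' -> I2b fr != 0 -> fr = fr'.
Proof.
move=> F2 hfr hfr' b0.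
have a0 := I2a_neq0 hfr; have bE := I2b_form hfr.
have [[hb ht hn] [hw q11 o12 q22 q12] [hs1 Q1E] [hz p14 o34] [hs2 p23 p24 Q2E]] := hfr.
have [[hb' ht' hn'] [hw' q11' o12' q22' q12'] [hs1' Q1E'] [hz' p14' o34'] [hs2' p23' p24' Q2E']] := hfr'.
case: fr hfr a0 b0 bE hb ht hn hw q11 o12 q22 q12 hs1 Q1E hz p14 o34 hs2 p23 p24 Q2E =>
  e1 e3 e2 e4 s1 s2 q1 q2 /= hfr a0 b0 bE hb ht hn hw q11 o12 q22 q12 hs1 Q1E hz p14 o34 hs2 p23 p24 Q2E.
case: fr' hfr' hb' ht' hn' hw' q11' o12' q22' q12' hs1' Q1E' hz' p14' o34' hs2' p23' p24' Q2E' =>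
  e1' e3' e2' e4' s1' s2' q1' q2' /= hfr' hb' ht' hn' hw' q11' o12' q22' q12' hs1' Q1E' hz' p14' o34' hs2' p23' p24' Q2E'.
have hbb : e1' + e3' = e1 + e3.
  by apply/matrixP => i z; rewrite ord1 !mxE -hb hb'.
have o1 v : stangent th v -> omega e1' v = omega e1 v.
  move=> hv; have := congr1 (fun x => omega x v) hbb; rewrite !omegaDl.
  by rewrite (omegaC e3) (omegaC e3') (tangent_normal hv hn) (tangent_normal hv hn') oppr0 !addr0.
have E1 : e1' = e1.
  rewrite (frame_tangent hfr ht') /= (o1 _ hw) (o1 _ ht) o12 omegaxx.
  by rewrite scale1r scale0r subr0.
have E3 : e3' = e3 by move: hbb; rewrite E1 => /addrI.
subst e1' e3'.
have e2E : e2' = omega e2' e2 *: e1 + e2.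
  by rewrite {1}(frame_tangent hfr hw') /= (omegaC e2' e1) o12' -scaleNr opprK scale1r.
set l := omega e2' e2 in e2E.
have f1 v w := frame_form hfr v w hs1'.
have s1e4 : pairing s1' e4 = 0.
  have := f1 e1 e1; rewrite /= q11' q11 !mulr0 add0r -bE => /esym/eqP.
  by rewrite !mulf_eq0 (negbTE a0) (negbTE b0) orbF /= => /eqP.
have s1e3 : pairing s1' e3 = I2a (Frame e1 e3 e2 e4 s1 s2 q1 q2).
  have := f1 e1 e2'; rewrite /= q12' s1e4 mulr0 mul0r addr0 mulr1.
  by rewrite e2E -[e2]scale1r sform_lin q11 q12 mulr0 add0r !mulr1 => <-.
have S1 : s1' = s1.
  apply: (scalerI a0); rewrite (frame_covector hfr hs1') /= s1e4 mulr0 scale0r addr0.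
  by rewrite s1e3.
subst s1'.
have l0 : l = 0.
  have sq : sform th s1 (l *: e1 + e2) (l *: e1 + e2) =
      l ^+ 2 * sform th s1 e1 e1 + 2%:R * l * sform th s1 e1 e2 + sform th s1 e2 e2.
    by rewrite /sform !mxE; ring.
  move: q22'; rewrite e2E sq q11 q12 q22 mulr0 mulr1 add0r addr0 => /eqP.
  by rewrite mulf_eq0 (negbTE F2) => /eqP.
have E2 : e2' = e2 by rewrite e2E l0 scale0r add0r.
clear l0 e2E l; subst e2'.
have [m e4E] : exists m, e4' = m *: e3 + e4.
  exists (omega e4' e4).
  by rewrite {1}(frame_normal hfr hz') /= (omegaC e4' e3) o34' -scaleNr opprK scale1r.
have E4 : e4' = e4.
  move: p14'; rewrite e4E pairingD pairingZ p14 addr0 => /eqP.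
  rewrite mulf_eq0 -[pairing s1 e3]/(I2a (Frame e1 e3 e2 e4 s1 s2 q1 q2)) (negbTE a0) orbF.
  by move=> /eqP ->; rewrite scale0r add0r.
clear e4E; subst e4'.
have S2 : s2' = s2.
  apply: (scalerI a0); rewrite (frame_covector hfr hs2') /= p23' p24' scale0r add0r.
  by rewrite mulr1.
by subst s2'; rewrite Q1E Q1E' Q2E Q2E'.
Qed.

End FrameAlgebra.

(** * Explicit formulas for the frame *)

Definition map_frame (F K : fieldType) (h : {rmorphism F -> K}) (fr : frame F) : frame K :=
  Frame (map_mx h (vpar fr)) (map_mx h (vperp fr)) (map_mx h (wpar fr)) (map_mx h (wperp fr))
    (map_mx h (sigma1 fr)) (map_mx h (sigma2 fr)) (map_mx h (Q1 fr)) (map_mx h (Q2 fr)).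

Section MapFrame.

Variables (F K : fieldType) (h : {rmorphism F -> K}) (th : nat -> F) (th' : nat -> K).
Hypothesis hth : forall n, (n < 14)%N -> h (th n) = th' n.

Lemma map_omega v w : omega (map_mx h v) (map_mx h w) = h (omega v w).
Proof. by rewrite !omegaE !mxE !(rmorphD, rmorphN, rmorphM). Qed.

Lemma map_pairing s v : pairing (map_mx h s) (map_mx h v) = h (pairing s v).
Proof. by rewrite !pairingE !mxE !(rmorphD, rmorphM). Qed.

Lemma map_sform s v w : sform th' (map_mx h s) (map_mx h v) (map_mx h w) = h (sform th s v w).
Proof. by rewrite /sform !mxE -!hth // !(rmorphD, rmorphN, rmorphM). Qed.

Lemma map_sgram s : sgram th' (map_mx h s) = map_mx h (sgram th s).
Proof.
have lt a i l : (a < 2)%N -> (i + l <= 2)%N -> (jidx a i l < 14)%N by move=> *; rewrite -[14%N]/(jdim 2) jidx_lt.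
apply/matrixP => i k; rewrite !mxE -!hth; first by rewrite !(rmorphD, rmorphN, rmorphM).
  by apply: lt => //; elim/ord2P: i; elim/ord2P: k.
by apply: lt => //; elim/ord2P: i; elim/ord2P: k.
Qed.

Lemma map_stangent v : stangent th v -> stangent th' (map_mx h v).
Proof. by case=> h2 h3; split; rewrite !mxE -!hth // ?h2 ?h3 !(rmorphD, rmorphM). Qed.

Lemma map_snormal v : snormal th v -> snormal th' (map_mx h v).
Proof. by case=> h2 h3; split; rewrite !mxE -!hth // ?h2 ?h3 !(rmorphD, rmorphN, rmorphM). Qed.

Lemma map_sann s : sann th s -> sann th' (map_mx h s).
Proof. by case=> h2 h3; split; rewrite !mxE -!hth // ?h2 ?h3 !(rmorphD, rmorphN, rmorphM). Qed.

Lemma map_sframe fr : sframe th fr -> sframe th' (map_frame h fr).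
Proof.
case=> [[hb ht hn] [hw q11 o12 q22 q12] [hs1 Q1E] [hz p14 o34] [hs2 p23 p24 Q2E]].
split; split=> /=; rewrite ?map_omega ?map_pairing ?map_sform ?map_sgram.
- by move=> i; rewrite -hth ?hb ?rmorphD ?mxE // (leq_trans (ltn_ord i)).
- exact: map_stangent.
- exact: map_snormal.
- exact: map_stangent.
- by rewrite q11 rmorph0.
- by rewrite o12 rmorph1.
- by rewrite q22 rmorph0.
- by rewrite q12 rmorph1.
- exact: map_sann.
- by rewrite Q1E.
- exact: map_snormal.
- by rewrite p14 rmorph0.
- by rewrite o34 rmorph1.
- exact: map_sann.
- by rewrite p23 rmorph0.
- by rewrite p24 rmorph1.
- by rewrite Q2E.
Qed.

Lemma map_qform Q v w : qform (map_mx h Q) (map_mx h v) (map_mx h w) = h (qform Q v w).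
Proof.
by rewrite /qform !mxE !sum2 !mxE !sum2 !mxE !(rmorphD, rmorphM).
Qed.

Lemma map_I2 fr : [/\ I2a (map_frame h fr) = h (I2a fr), I2b (map_frame h fr) = h (I2b fr),
  I2c (map_frame h fr) = h (I2c fr) & I2d (map_frame h fr) = h (I2d fr)].
Proof. by split; rewrite ?[LHS]map_pairing ?[LHS]map_qform. Qed.

End MapFrame.

Section FrameFormulas.

Variables (F : fieldType) (th : nat -> F).

Definition vec4 (a b c d : F) : 'cV[F]_(2 + 2) :=
  \col_i (if i == i0 then a else if i == i1 then b else if i == i2 then c else d).
Definition cov4 (a b c d : F) : 'rV[F]_(2 + 2) :=
  \row_i (if i == i0 then a else if i == i1 then b else if i == i2 then c else d).

Lemma vec4E a b c d : (vec4 a b c d i0 0 = a) * (vec4 a b c d i1 0 = b)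
  * (vec4 a b c d i2 0 = c) * (vec4 a b c d i3 0 = d).
Proof. by do !split; rewrite mxE -!val_eqE /= !inordK. Qed.
Lemma cov4E a b c d : (cov4 a b c d 0 i0 = a) * (cov4 a b c d 0 i1 = b)
  * (cov4 a b c d 0 i2 = c) * (cov4 a b c d 0 i3 = d).
Proof. by do !split; rewrite mxE -!val_eqE /= !inordK. Qed.

(** The tangent vectors, the normal vectors and the annihilating covectors, in
    terms of two of their coordinates. *)
Definition tvec (a b : F) := vec4 a b (th 4 * a + th 6 * b) (th 5 * a + th 7 * b).
Definition nvec (c d : F) := vec4 (th 6 * d - th 7 * c) (th 5 * c - th 4 * d) c d.
Definition acov (c d : F) := cov4 (- (c * th 4 + d * th 5)) (- (c * th 6 + d * th 7)) c d.

(** The value of omega on the basis of the tangent plane. *)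
Definition xc : F := 1 + th 4 * th 7 - th 6 * th 5.

Lemma omega_tvec a b a' b' : omega (tvec a b) (tvec a' b') = xc * (a * b' - b * a').
Proof. by rewrite omegaE !vec4E /xc; ring. Qed.
Lemma omega_nvec a b a' b' : omega (nvec a b) (nvec a' b') = xc * (a * b' - b * a').
Proof. by rewrite omegaE !vec4E /xc; ring. Qed.
Lemma pairing_nvec a b a' b' : pairing (acov a b) (nvec a' b') = xc * (a * a' + b * b').
Proof. by rewrite pairingE !vec4E !cov4E /xc; ring. Qed.

(** The Hessians of u_0 and u_1 at two tangent vectors. *)
Definition h0 (a b a' b' : F) : F := th 8 * a * a' + th 10 * (a * b' + b * a') + th 12 * b * b'.
Definition h1 (a b a' b' : F) : F := th 9 * a * a' + th 11 * (a * b' + b * a') + th 13 * b * b'.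

Lemma sform_tvec s2 s3 a b a' b' :
  sform th (acov s2 s3) (tvec a b) (tvec a' b') = - (s2 * h0 a b a' b' + s3 * h1 a b a' b').
Proof. by rewrite /sform !vec4E !cov4E /h0 /h1; ring. Qed.

(** The base point is tvec xv0 xv1 + nvec xn2 xn3. The vector tvec 0 xy has
    product 1 with the first summand; the covector acov xs2 xs3 is the one whose
    form takes the value 0 on the tangential summand and 1 on the pair of both
    vectors, and xN is the determinant of this linear system. Adding a multiple
    of the first vector to the second makes it isotropic for this form. *)
Definition xv0 : F := (th 0 + th 2 * th 7 - th 3 * th 6) / xc.
Definition xv1 : F := (th 1 - th 2 * th 5 + th 3 * th 4) / xc.
Definition xn2 : F := th 2 - (th 4 * xv0 + th 6 * xv1).
Definition xn3 : F := th 3 - (th 5 * xv0 + th 7 * xv1).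
Definition xy : F := 1 / (xc * xv0).
Definition xN : F := - (h1 xv0 xv1 xv0 xv1 * h0 xv0 xv1 0 xy - h0 xv0 xv1 xv0 xv1 * h1 xv0 xv1 0 xy).
Definition xs2 : F := h1 xv0 xv1 xv0 xv1 / xN.
Definition xs3 : F := - h0 xv0 xv1 xv0 xv1 / xN.
Definition xk : F := - (xs2 * h0 0 xy 0 xy + xs3 * h1 0 xy 0 xy) / 2%:R.
Definition xw0 : F := - xk * xv0.
Definition xw1 : F := xy - xk * xv1.
Definition xa : F := xc * (xs2 * xn2 + xs3 * xn3).

Definition frame_formula : frame F :=
  Frame (tvec xv0 xv1) (nvec xn2 xn3) (tvec xw0 xw1) (nvec (- xs3 / xa) (xs2 / xa))
    (acov xs2 xs3) (acov (- xn3) xn2) (sgram th (acov xs2 xs3)) (sgram th (acov (- xn3) xn2)).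

Hypotheses (F2 : (2%:R : F) != 0) (xc0 : xc != 0) (xv00 : xv0 != 0)
  (xN0 : xN != 0) (xa0 : xa != 0).

Lemma frame_formulaP : sframe th frame_formula.
Proof.
have s1v : - (xs2 * h0 xv0 xv1 xv0 xv1 + xs3 * h1 xv0 xv1 xv0 xv1) = 0.
  by rewrite /xs2 /xs3; ring.
have s1w : - (xs2 * h0 xv0 xv1 0 xy + xs3 * h1 xv0 xv1 0 xy) = 1.
  rewrite -(divff xN0) /xs2 /xs3 [X in _ = X / _]/xN; ring.
have kE : - (xs2 * h0 0 xy 0 xy + xs3 * h1 0 xy 0 xy) = xk * 2%:R by rewrite /xk divfK.
have tan a b : stangent th (tvec a b) by split; rewrite !vec4E.
have nor a b : snormal th (nvec a b) by split; rewrite !vec4E.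
have ann a b : sann th (acov a b) by split; rewrite !cov4E.
split; split=> //=.
- elim/ord4P; rewrite !vec4E !inordK // /xn2 /xn3 /xv0 /xv1; try by ring.
    by move: xc0; rewrite /xc => ?; field.
  by move: xc0; rewrite /xc => ?; field.
- by rewrite sform_tvec.
- rewrite omega_tvec /xw1 /xw0.
  have -> : xc * (xv0 * (xy - xk * xv1) - xv1 * (- xk * xv0)) = xc * xv0 * xy by ring.
  by rewrite /xy mul1r mulfV // mulf_neq0.
- rewrite sform_tvec.
  have -> : - (xs2 * h0 xw0 xw1 xw0 xw1 + xs3 * h1 xw0 xw1 xw0 xw1) =
     - (xs2 * h0 0 xy 0 xy + xs3 * h1 0 xy 0 xy)
     - 2%:R * xk * - (xs2 * h0 xv0 xv1 0 xy + xs3 * h1 xv0 xv1 0 xy)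
     + xk ^+ 2 * - (xs2 * h0 xv0 xv1 xv0 xv1 + xs3 * h1 xv0 xv1 xv0 xv1).
    by rewrite /h0 /h1 /xw0 /xw1; ring.
  by rewrite kE s1w s1v; ring.
- rewrite sform_tvec.
  have -> : - (xs2 * h0 xv0 xv1 xw0 xw1 + xs3 * h1 xv0 xv1 xw0 xw1) =
     - (xs2 * h0 xv0 xv1 0 xy + xs3 * h1 xv0 xv1 0 xy)
     - xk * - (xs2 * h0 xv0 xv1 xv0 xv1 + xs3 * h1 xv0 xv1 xv0 xv1).
    by rewrite /h0 /h1 /xw0 /xw1; ring.
  by rewrite s1w s1v mulr0 subr0.
- by rewrite pairing_nvec; ring.
- rewrite omega_nvec.
  have -> : xc * (xn2 * (xs2 / xa) - xn3 * (- xs3 / xa)) = xc * (xs2 * xn2 + xs3 * xn3) / xa by ring.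
  by rewrite -/xa divff.
- by rewrite pairing_nvec; ring.
- rewrite pairing_nvec.
  have -> : xc * (- xn3 * (- xs3 / xa) + xn2 * (xs2 / xa)) = xc * (xs2 * xn2 + xs3 * xn3) / xa by ring.
  by rewrite -/xa divff.
Qed.

(** The values of the second form on the tangent part of the frame. *)
Definition xb : F := - (- xn3 * h0 xv0 xv1 xv0 xv1 + xn2 * h1 xv0 xv1 xv0 xv1).
Definition xcc : F := - (- xn3 * h0 xv0 xv1 xw0 xw1 + xn2 * h1 xv0 xv1 xw0 xw1).
Definition xd : F := - (- xn3 * h0 xw0 xw1 xw0 xw1 + xn2 * h1 xw0 xw1 xw0 xw1).

Lemma frame_formula_I2 : [/\ I2b frame_formula = xb, I2c frame_formula = xcc & I2d frame_formula = xd].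
Proof. by split; rewrite /I2b /I2c /I2d qform_gram sform_tvec. Qed.

End FrameFormulas.

Section MapFormulas.

Variables (F K : fieldType) (h : {rmorphism F -> K}) (th : nat -> F) (th' : nat -> K).
Hypothesis hth : forall n, (n < 14)%N -> h (th n) = th' n.

Let morphE := (rmorphD h, rmorphN h, rmorphM h, fmorphV h, rmorph1 h, rmorph0 h, rmorph_nat h).

Lemma map_formulas : [/\ h (xc th) = xc th', h (xv0 th) = xv0 th', h (xN th) = xN th',
  h (xa th) = xa th' & h (xb th) = xb th'].
Proof.
have c : h (xc th) = xc th' by rewrite /xc !morphE /= !hth.
have v0 : h (xv0 th) = xv0 th'.
  by rewrite /xv0; move: c; move: (xc th) (xc th') => u u' c; rewrite !morphE /= c !hth.
have v1 : h (xv1 th) = xv1 th'.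
  by rewrite /xv1; move: c; move: (xc th) (xc th') => u u' c; rewrite !morphE /= c !hth.
have n2 : h (xn2 th) = xn2 th'.
  rewrite /xn2; move: v0 v1; move: (xv0 th) (xv0 th') (xv1 th) (xv1 th') => u u' v v' v0 v1.
  by rewrite !morphE /= v0 v1 !hth.
have n3 : h (xn3 th) = xn3 th'.
  rewrite /xn3; move: v0 v1; move: (xv0 th) (xv0 th') (xv1 th) (xv1 th') => u u' v v' v0 v1.
  by rewrite !morphE /= v0 v1 !hth.
have y : h (xy th) = xy th'.
  rewrite /xy; move: v0 c; move: (xv0 th) (xv0 th') (xc th) (xc th') => u u' v v' v0 c.
  by rewrite !morphE /= v0 c.
have f0 p q r s : h (h0 th p q r s) = h0 th' (h p) (h q) (h r) (h s).
  by rewrite /h0 !morphE /= !hth.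
have f1 p q r s : h (h1 th p q r s) = h1 th' (h p) (h q) (h r) (h s).
  by rewrite /h1 !morphE /= !hth.
have A0 : h (h0 th (xv0 th) (xv1 th) (xv0 th) (xv1 th)) = h0 th' (xv0 th') (xv1 th') (xv0 th') (xv1 th').
  by rewrite f0 v0 v1.
have A1 : h (h1 th (xv0 th) (xv1 th) (xv0 th) (xv1 th)) = h1 th' (xv0 th') (xv1 th') (xv0 th') (xv1 th').
  by rewrite f1 v0 v1.
have B0 : h (h0 th (xv0 th) (xv1 th) 0 (xy th)) = h0 th' (xv0 th') (xv1 th') 0 (xy th').
  by rewrite f0 v0 v1 y rmorph0.
have B1 : h (h1 th (xv0 th) (xv1 th) 0 (xy th)) = h1 th' (xv0 th') (xv1 th') 0 (xy th').
  by rewrite f1 v0 v1 y rmorph0.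
have hB (p q r s : F) : h (- (p * q - r * s)) = - (h p * h q - h r * h s) by rewrite !morphE.
have hC (p q r s : F) : h (- (- p * q + r * s)) = - (- h p * h q + h r * h s) by rewrite !morphE.
have hD (p q r s t u : F) : h (p * (q / r * s + - t / r * u)) =
    h p * (h q / h r * h s + - h t / h r * h u) by rewrite !morphE.
have N : h (xN th) = xN th' by rewrite [LHS]hB A0 A1 B0 B1.
split=> //; last by rewrite [LHS]hC n2 n3 A0 A1.
by rewrite [LHS]hD A0 A1 n2 n3 c N.
Qed.

End MapFormulas.

Section GenericFrame.

Variables (R : realType) (FF : fieldType) (jF : {rmorphism R -> FF}).
Variables (gen : nat -> FF).
Hypotheses (FFP : jet_field jF gen).

Local Notation at_R := (at_jet jF gen (idfun : {rmorphism R -> R}) (@nonzero R)).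

(** A 2-jet at which the frame is the standard basis. *)
Definition jet0 (n : nat) : R := nth 0 [:: 1; 0; 1; 0; 0; 0; 0; 0; 0; -1; -1; 0; 0; -1] n.

Let at_ := at_R 2 jet0.

Let aD f h c d : at_ f c -> at_ h d -> at_ (f + h) (c + d).
Proof. exact: (at_add FFP (@nzM R) (@nz0 R)). Qed.
Let aM f h c d : at_ f c -> at_ h d -> at_ (f * h) (c * d).
Proof. exact: (at_mul (@nzM R)). Qed.
Let aN f c : at_ f c -> at_ (- f) (- c).
Proof. exact: at_opp. Qed.
Let aV f c : at_ f c -> c != 0 -> at_ f^-1 c^-1.
Proof. exact: (at_inv (@nzM R) (@nz0 R)). Qed.
Let a1 : at_ 1 1.
Proof. exact: (at_1 _ _ _ (nz1 R)). Qed.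
Let a0 : at_ 0 0.
Proof. exact: (at_0 _ _ _ (nz1 R)). Qed.
Let ag n : (n < 14)%N -> at_ (gen n) (jet0 n).
Proof. by move=> hn; apply: (at_gen _ _ _ (nz1 R)). Qed.

Ltac at_tac := repeat first [ assumption | apply: aD | apply: aN | apply: aM | exact: a1 | exact: a0
  | exact: ag ].

Lemma jet0E : [/\ [/\ xc jet0 = 1, xv0 jet0 = 1, xv1 jet0 = 0, xn2 jet0 = 1 & xn3 jet0 = 0],
  [/\ xy jet0 = 1, xN jet0 = -1, xs2 jet0 = 1, xs3 jet0 = 0 & xa jet0 = 1]
  & [/\ xw0 jet0 = 0, xw1 jet0 = 1, xb jet0 = 1, xcc jet0 = 0 & xd jet0 = 1]].
Proof.
have c1 : xc jet0 = 1 by rewrite /xc /jet0 /=; ring.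
have v0 : xv0 jet0 = 1 by rewrite /xv0 c1 /jet0 /=; field.
have v1 : xv1 jet0 = 0 by rewrite /xv1 c1 /jet0 /=; field.
have n2 : xn2 jet0 = 1 by rewrite /xn2 v0 v1 /jet0 /=; ring.
have n3 : xn3 jet0 = 0 by rewrite /xn3 v0 v1 /jet0 /=; ring.
have y : xy jet0 = 1 by rewrite /xy v0 c1; field.
have N : xN jet0 = -1 by rewrite /xN v0 v1 y /h0 /h1 /jet0 /=; ring.
have s2 : xs2 jet0 = 1 by rewrite /xs2 N v0 v1 /h1 /jet0 /=; field.
have s3 : xs3 jet0 = 0 by rewrite /xs3 N v0 v1 /h0 /jet0 /=; field.
have k : xk jet0 = 0 by rewrite /xk s2 s3 y /h0 /h1 /jet0 /=; field.
have w0 : xw0 jet0 = 0 by rewrite /xw0 k; ring.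
have w1 : xw1 jet0 = 1 by rewrite /xw1 k y v1; ring.
split; split=> //.
- by rewrite /xa c1 s2 s3 n2 n3; ring.
- by rewrite /xb v0 v1 n2 n3 /h0 /h1 /jet0 /=; ring.
- by rewrite /xcc v0 v1 w0 w1 n2 n3 /h0 /h1 /jet0 /=; ring.
- by rewrite /xd w0 w1 n2 n3 /h0 /h1 /jet0 /=; ring.
Qed.

Let neq0_at f c : at_ f c -> c != 0 -> f != 0.
Proof.
move=> hf; apply: contra_neq => f0; rewrite f0 in hf.
exact: (at_uniq FFP (@nz0 R) hf a0).
Qed.

(** All these functions take the value 1 or -1 at jet0. *)
Lemma generic_frame : [/\ xc gen != 0, xv0 gen != 0, xN gen != 0 & xa gen != 0] /\
  (xb gen != 0 /\ xb gen * xd gen - xcc gen ^+ 2 != 0).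
Proof.
have [[c v0 v1 n2 n3] [y N s2 s3 a] [w0 w1 b cc d]] := jet0E.
have one : (1 : R) != 0 := oner_neq0 _.
have None : (-1 : R) != 0 by rewrite oppr_eq0.
have two : (2%:R : R) != 0 by rewrite pnatr_eq0.
have hc : at_ (xc gen) (xc jet0) by rewrite /xc; at_tac.
have hv0 : at_ (xv0 gen) (xv0 jet0).
  by rewrite /xv0; at_tac; apply: aV => //; rewrite c.
have hv1 : at_ (xv1 gen) (xv1 jet0).
  by rewrite /xv1; at_tac; apply: aV => //; rewrite c.
have hn2 : at_ (xn2 gen) (xn2 jet0) by rewrite /xn2; at_tac.
have hn3 : at_ (xn3 gen) (xn3 jet0) by rewrite /xn3; at_tac.
have hy : at_ (xy gen) (xy jet0).
  rewrite /xy; at_tac; apply: aV; first by at_tac.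
  by rewrite c v0 mulr1.
have hh0 p1 q1 p2 q2 p1' q1' p2' q2' : at_ p1 p1' -> at_ q1 q1' -> at_ p2 p2' -> at_ q2 q2' ->
  at_ (h0 gen p1 q1 p2 q2) (h0 jet0 p1' q1' p2' q2') by move=> *; rewrite /h0; at_tac.
have hh1 p1 q1 p2 q2 p1' q1' p2' q2' : at_ p1 p1' -> at_ q1 q1' -> at_ p2 p2' -> at_ q2 q2' ->
  at_ (h1 gen p1 q1 p2 q2) (h1 jet0 p1' q1' p2' q2') by move=> *; rewrite /h1; at_tac.
have hN : at_ (xN gen) (xN jet0).
  by rewrite /xN; apply: aN; apply: aD; [|apply: aN]; apply: aM; apply: hh0 || apply: hh1; at_tac.
have hs2 : at_ (xs2 gen) (xs2 jet0).
  by rewrite /xs2; apply: aM; [apply: hh1|apply: aV => //; rewrite N].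
have hs3 : at_ (xs3 gen) (xs3 jet0).
  by rewrite /xs3; apply: aM; [apply: aN; apply: hh0|apply: aV => //; rewrite N].
have hk : at_ (xk gen) (xk jet0).
  rewrite /xk; apply: aM; last by apply: aV => //; rewrite -[2%:R]/(1 + 1); at_tac.
  by apply: aN; apply: aD; apply: aM => //; apply: hh0 || apply: hh1; at_tac.
have hw0 : at_ (xw0 gen) (xw0 jet0) by rewrite /xw0; at_tac.
have hw1 : at_ (xw1 gen) (xw1 jet0) by rewrite /xw1; at_tac.
have ha : at_ (xa gen) (xa jet0) by rewrite /xa; at_tac.
have form v w v' w' p1 q1 p2 q2 : at_ v v' -> at_ w w' -> at_ p1 p2 -> at_ q1 q2 ->
    at_ (- (- xn3 gen * h0 gen v w p1 q1 + xn2 gen * h1 gen v w p1 q1))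
        (- (- xn3 jet0 * h0 jet0 v' w' p2 q2 + xn2 jet0 * h1 jet0 v' w' p2 q2)).
  move=> *; apply: aN; apply: aD; apply: aM => //; last exact: hh1; last exact: hh0.
  exact: aN.
have hb : at_ (xb gen) (xb jet0) by exact: form.
have hcc : at_ (xcc gen) (xcc jet0) by exact: form.
have hd : at_ (xd gen) (xd jet0) by exact: form.
split; first by split; apply: neq0_at; try eassumption; rewrite ?c ?v0 ?N ?a.
split; first by apply: neq0_at; try eassumption; rewrite b.
apply: (@neq0_at _ (xb jet0 * xd jet0 - xcc jet0 * xcc jet0)); last by rewrite b d cc mulr0 subr0 mulr1.
by rewrite expr2; at_tac.
Qed.

End GenericFrame.

(** * Equivariance of the frame *)

Lemma tvec_eq (K : fieldType) (th : nat -> K) v : stangent th v -> v = tvec th (v i0 0) (v i1 0).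
Proof.
by case=> h2 h3; apply/matrixP => i z; rewrite ord1; elim/ord4P: i; rewrite vec4E ?h2 ?h3.
Qed.

(** The second fundamental form is the normal component of the derivative of
    one tangent field along the other. *)
Lemma sform_derivative (K : fieldType) (th : nat -> K) (d : 'I_2 -> K -> K) s v w :
    (forall e, derivation (d e)) -> (forall e n, d e (th n) = dnext th e n) ->
    sann th s -> stangent th w ->
  sform th s v w = - \sum_i s 0 i * (v i0 0 * d ord0 (w i 0) + v i1 0 * d ord_max (w i 0)).
Proof.
move=> dP dth [s0 s1] [w2 w3].
have dE e n m : dnext th e n = th m -> d e (th n) = th m by move=> <-; exact: dth.
have d04 : d ord0 (th 4) = th 8 by exact: dE.
have d14 : d ord_max (th 4) = th 10 by exact: dE.
have d06 : d ord0 (th 6) = th 10 by exact: dE.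
have d16 : d ord_max (th 6) = th 12 by exact: dE.
have d05 : d ord0 (th 5) = th 9 by exact: dE.
have d15 : d ord_max (th 5) = th 11 by exact: dE.
have d07 : d ord0 (th 7) = th 11 by exact: dE.
have d17 : d ord_max (th 7) = th 13 by exact: dE.
rewrite sum4 w2 w3 !(derD (dP ord0)) !(derD (dP ord_max)) !(derM (dP ord0)) !(derM (dP ord_max)).
rewrite d04 d14 d06 d16 d05 d15 d07 d17 s0 s1 /sform; ring.
Qed.

Lemma snormal_omega (K : fieldType) (th : nat -> K) y :
  omega y (tvec th 1 0) = 0 -> omega y (tvec th 0 1) = 0 -> snormal th y.
Proof.
rewrite !omegaE !vec4E => e0 e1; split; apply/eqP; rewrite -subr_eq0; apply/eqP;
  [rewrite -[RHS]oppr0 -{1}e0|rewrite -[RHS]e1]; ring.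
Qed.

Lemma sann_pairing (K : fieldType) (th : nat -> K) s :
  pairing s (tvec th 1 0) = 0 -> pairing s (tvec th 0 1) = 0 -> sann th s.
Proof.
rewrite !pairingE !vec4E => e0 e1; split; apply/eqP; rewrite -subr_eq0; apply/eqP;
  [rewrite -[RHS]e0|rewrite -[RHS]e1]; ring.
Qed.

Lemma map_omega_mx (K L : fieldType) (f : {rmorphism K -> L}) :
  map_mx f (omega_mx K) = omega_mx L.
Proof.
by apply/matrixP => i k; rewrite mxE !omega_mxE !(rmorphB, rmorphD) !rmorph_nat.
Qed.

Section Equivariance.

Variables (R : realType) (FF : fieldType) (jF : {rmorphism R -> FF}).
Variables (gen : nat -> FF) (D : 'I_2 -> FF -> FF).
Hypotheses (FFP : jet_field jF gen) (DP : total_derivatives jF gen D).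
Variables (g : 'M[R]_(2 + 2)) (h : {rmorphism FF -> FF}).
Hypotheses (hg : symplectic g) (hC : forall c, h (jF c) = jF c)
  (hX : forall n, h (gen n) = gjet jF gen D g n).

Local Notation T := (gjet jF gen D g).
Local Notation Dg := (gD jF gen D g).

Definition nab (v : 'cV[FF]_(2 + 2)) (f : FF) : FF :=
  v i0 0 * D ord0 f + v i1 0 * D ord_max f.

Lemma nab_der v : derivation (nab v).
Proof. by apply: der_comb; exact: D_der. Qed.

Definition gm : 'M[FF]_(2 + 2) := map_mx jF g.

Lemma gm_symplectic : symplectic gm.
Proof.
apply/symplectic_mx; have /symplectic_mx e := hg.
rewrite /gm; have -> : (map_mx jF g)^T = map_mx jF g^T by apply/matrixP => i k; rewrite !mxE.
by rewrite -(map_omega_mx jF) -!map_mxM e.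
Qed.

Lemma nab_gen v (l : 'I_(2 + 2)) : stangent gen v -> nab v (gen l) = v l 0.
Proof.
move=> [v2 v3]; have dE e n m : dnext gen e n = m -> D e (gen n) = m by move=> <-; exact: D_gen.
elim/ord4P: l; rewrite inordK // /nab.
- by rewrite (@dE ord0 0%N 1) // (@dE ord_max 0%N 0) //; ring.
- by rewrite (@dE ord0 1%N 0) // (@dE ord_max 1%N 1) //; ring.
- by rewrite (@dE ord0 2%N (gen 4)) // (@dE ord_max 2%N (gen 6)) // v2; ring.
- by rewrite (@dE ord0 3%N (gen 5)) // (@dE ord_max 3%N (gen 7)) // v3; ring.
Qed.

Lemma nab_linmap v (w : 'I_(2 + 2) -> FF) (i : 'I_(2 + 2)) :
  nab v (\sum_l jF (g i l) * w l) = \sum_l jF (g i l) * nab v (w l).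
Proof.
rewrite (der_sum (nab_der v)); apply: eq_bigr => l _; rewrite (derM (nab_der v)).
by rewrite /nab !(D_const DP) !mulr0 addr0 mul0r add0r.
Qed.

Lemma nab_gpoint v (i : 'I_(2 + 2)) : stangent gen v ->
  nab v (gpoint jF gen g i) = (gm *m v) i 0.
Proof.
move=> hv; rewrite /gpoint /linmap inord_val nab_linmap mxE; apply: eq_bigr => l _.
by rewrite nab_gen // mxE.
Qed.

(** In terms of the new independent variables, the derivation along v is the one
    along the image vector g v. *)
Lemma nab_gD v f : stangent gen v ->
  nab v f = (gm *m v) i0 0 * Dg ord0 f + (gm *m v) i1 0 * Dg ord_max f.
Proof.
move=> hv; rewrite -!nab_gpoint // {1}/nab.
rewrite (dchange_expand (gjac_neq0 FFP DP hg) ord0 f) (dchange_expand (gjac_neq0 FFP DP hg) ord_max f).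
by rewrite /i0 /i1 !inordK // /nab /gD; ring.
Qed.

Lemma gjet4 : (T 0 = gpoint jF gen g 0) * (T 1 = gpoint jF gen g 1) * (T 2 = gpoint jF gen g 2) * (T 3 = gpoint jF gen g 3)
  * (T 4 = Dg ord0 (gpoint jF gen g 2)) * (T 6 = Dg ord_max (gpoint jF gen g 2))
  * (T 5 = Dg ord0 (gpoint jF gen g 3)) * (T 7 = Dg ord_max (gpoint jF gen g 3)).
Proof. by []. Qed.

Lemma gm_tangent v : stangent gen v -> stangent T (gm *m v).
Proof.
move=> hv; split; rewrite !gjet4 -nab_gpoint // nab_gD // /i2 /i3 !inordK //; ring.
Qed.

(** The tangent vectors whose components are the entries of the inverse Jacobian
    matrix are sent to the standard basis of the image tangent plane. *)
Lemma gm_tvec (e : 'I_2) : exists2 t, stangent gen t &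
  gm *m t = tvec T (e == ord0)%:R (e == ord_max)%:R.
Proof.
pose J := jac_inv D (gpoint jF gen g) e.
pose t := tvec gen (J ord0) (J ord_max).
have ht : stangent gen t by split; rewrite !vec4E.
have nabE f : nab t f = Dg e f by rewrite /nab !vec4E /gD dchangeE.
exists t => //; rewrite [LHS](tvec_eq (gm_tangent ht)) -!nab_gpoint // !nabE.
rewrite /gD /i0 /i1 !inordK // !(dchange_self (gjac_neq0 FFP DP hg)) //.
by congr (tvec _ _%:R _%:R); rewrite -val_eqE /= eq_sym.
Qed.

Lemma gm_normal y : snormal gen y -> snormal T (gm *m y).
Proof.
move=> hy; apply: snormal_omega.
  have [t ht <-] := gm_tvec ord0; rewrite gm_symplectic omegaC.
  by rewrite (tangent_normal ht hy) oppr0.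
have [t ht <-] := gm_tvec ord_max; rewrite gm_symplectic omegaC.
by rewrite (tangent_normal ht hy) oppr0.
Qed.

Variable gi : 'M[FF]_(2 + 2).
Hypothesis gig : gi *m gm = 1%:M.

Lemma gi_pairing s x : pairing (s *m gi) (gm *m x) = pairing s x.
Proof. by rewrite /pairing mulmxA -(mulmxA s) gig mulmx1. Qed.

Lemma gi_ann s : sann gen s -> sann T (s *m gi).
Proof.
move=> hs; apply: sann_pairing.
  by have [t ht <-] := gm_tvec ord0; rewrite gi_pairing (ann_tangent hs ht).
by have [t ht <-] := gm_tvec ord_max; rewrite gi_pairing (ann_tangent hs ht).
Qed.

(** The forms correspond to each other because they are second derivatives of
    the position along the surface, and g acts linearly on the position. *)
Lemma gi_sform s v w : sann gen s -> stangent gen v -> stangent gen w ->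
  sform T (s *m gi) (gm *m v) (gm *m w) = sform gen s v w.
Proof.
move=> hs hv hw.
rewrite (sform_derivative (d := Dg) _ _ _ (gi_ann hs) (gm_tangent hw)); last 2 first.
- by move=> e; exact: gD_der.
- by move=> e n; exact: gjet_next.
rewrite (sform_derivative (d := D) _ (D_der DP) (D_gen DP) hs hw); congr (- _).
pose x : 'cV[FF]_(2 + 2) := \col_i nab v (w i 0).
have -> : \sum_i s 0 i * (v i0 0 * D ord0 (w i 0) + v i1 0 * D ord_max (w i 0)) = pairing s x.
  by rewrite /pairing mxE; apply: eq_bigr => i _; rewrite mxE.
rewrite -gi_pairing /pairing [RHS]mxE; apply: eq_bigr => i _; congr (_ * _).
rewrite -nab_gD // [RHS]mxE [(gm *m w) i 0]mxE.
under eq_bigr do rewrite [gm _ _]mxE.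
by rewrite nab_linmap; apply: eq_bigr => l _; rewrite !mxE.
Qed.

Definition gframe (fr : frame FF) : frame FF :=
  Frame (gm *m vpar fr) (gm *m vperp fr) (gm *m wpar fr) (gm *m wperp fr)
    (sigma1 fr *m gi) (sigma2 fr *m gi) (sgram T (sigma1 fr *m gi)) (sgram T (sigma2 fr *m gi)).

Lemma gframeP fr : sframe gen fr -> sframe T (gframe fr).
Proof.
case=> [[hb ht hn] [hw q11 o12 q22 q12] [hs1 Q1E] [hz p14 o34] [hs2 p23 p24 Q2E]].
split; split=> //=; rewrite ?gi_sform ?gi_pairing ?gm_symplectic //.
- move=> i; have -> : T i = gpoint jF gen g i by rewrite /gjet jet_seq_base // ltn_ord.
  rewrite /gpoint /linmap inord_val !mxE -big_split /=; apply: eq_bigr => l _.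
  by rewrite hb !mxE mulrDr.
- exact: gm_tangent.
- exact: gm_normal.
- exact: gm_tangent.
- exact: gi_ann.
- exact: gm_normal.
- exact: gi_ann.
Qed.

(** The pull-back of the frame is its image under g, since both are the frame of
    the prolonged jet. *)
Lemma pull_frame fr : sframe gen fr -> I2b fr != 0 -> map_frame h fr = gframe fr.
Proof.
move=> hfr b0; have F2 : (2%:R : FF) != 0 by rewrite -(rmorph_nat jF) fmorph_eq0 pnatr_eq0.
apply: (sframe_uniq F2 (map_sframe (fun n _ => hX n) hfr) (gframeP hfr)).
by have [_ -> _ _] := map_I2 h fr; rewrite fmorph_eq0.
Qed.

Lemma pull_I2 fr : sframe gen fr -> I2b fr != 0 ->
  [/\ h (I2a fr) = I2a fr, h (I2b fr) = I2b fr, h (I2c fr) = I2c fr & h (I2d fr) = I2d fr].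
Proof.
move=> hfr b0; have [<- <- <- <-] := map_I2 h fr; rewrite (pull_frame hfr b0).
have [[hb ht hn] [hw q11 o12 q22 q12] [hs1 Q1E] [hz p14 o34] [hs2 p23 p24 Q2E]] := hfr.
by split; rewrite /I2a /I2b /I2c /I2d /= ?gi_pairing ?Q2E ?qform_gram ?gi_sform.
Qed.

Lemma pull_nab fr v : sframe gen fr -> stangent gen v ->
    (forall i, h (v i 0) = (gm *m v) i 0) ->
  forall f, h (nab v f) = nab v (h f).
Proof.
move=> hfr hv hvE f; rewrite {1}/nab rmorphD !rmorphM /= !hvE.
by rewrite !(pull_D FFP DP hg hC hX) -nab_gD.
Qed.

End Equivariance.

(** * Structure equations of the frame *)

Section StructureEquations.

Variables (R : realType) (FF : fieldType) (jF : {rmorphism R -> FF}).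
Variables (gen : nat -> FF) (D : 'I_2 -> FF -> FF).
Hypotheses (FFP : jet_field jF gen) (DP : total_derivatives jF gen D).
Variable fr : frame FF.
Hypothesis hfr : sframe gen fr.

Local Notation nb := (nab D).
Local Notation e1 := (vpar fr).
Local Notation e2 := (wpar fr).
Local Notation e3 := (vperp fr).
Local Notation e4 := (wperp fr).

Definition vnab v (w : 'cV[FF]_(2 + 2)) : 'cV[FF]_(2 + 2) := map_mx (nb v) w.

Lemma nab_omega v x y : nb v (omega x y) = omega (vnab v x) y + omega x (vnab v y).
Proof.
have dv := nab_der DP v; rewrite !omegaE !mxE.
by rewrite (derB dv) (derD dv) (derB dv) !(derM dv); ring.
Qed.

Lemma nab_const v x : (x = 0 \/ x = 1) -> nb v x = 0.
Proof.
by case=> ->; [exact: (der0 (nab_der DP v))|exact: (der1 (nab_der DP v))].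
Qed.

(** The structure coefficients: the components of the derivatives of the frame. *)
Definition cf v x y : FF := omega (vnab v x) y.

Lemma cfC v x y : (omega x y = 0 \/ omega x y = 1) -> cf v x y = cf v y x.
Proof.
move=> /(nab_const v); rewrite nab_omega (omegaC x) => /eqP.
by rewrite subr_eq0 => /eqP.
Qed.

Lemma vnab_base v : stangent gen v -> vnab v e1 + vnab v e3 = v.
Proof.
move=> hv; case: hfr => -[hb _ _] _ _ _ _; apply/matrixP => i z; rewrite ord1 !mxE.
by rewrite -(derD (nab_der DP v)) -hb; exact: nab_gen.
Qed.

(** The normal part of the derivative of a tangent field is the second
    fundamental form. *)
Lemma cf_sigma s v w : sann gen s -> stangent gen w ->
  pairing s (vnab v w) = - sform gen s v w.
Proof.
move=> hs hw; rewrite (sform_derivative (d := D) _ (D_der DP) (D_gen DP) hs hw) opprK.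
by rewrite /pairing mxE; apply: eq_bigr => i _; rewrite [vnab _ _ _ _]mxE.
Qed.

Let ht : stangent gen e1. Proof. by case: hfr => -[]. Qed.
Let hw : stangent gen e2. Proof. by case: hfr => _ []. Qed.

Lemma cf4 v w : stangent gen w -> I2a fr * cf v w e4 = - sform gen (sigma1 fr) v w.
Proof.
move=> h; case: hfr => _ _ [hs1 _] [_ p14 _] _.
rewrite -(cf_sigma v hs1 h) (symplectic_coord (vnab v w) (frame_basis hfr)) -!scaleNr.
rewrite !pairingD !pairingZ (ann_tangent hs1 ht) (ann_tangent hs1 hw) p14 !mulr0 !add0r addr0.
by rewrite mulrC /I2a /cf.
Qed.

Lemma cf3 v w : stangent gen w -> cf v w e3 = sform gen (sigma2 fr) v w.
Proof.
move=> h; case: hfr => _ _ _ _ [hs2 p23 p24 _].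
apply: oppr_inj; rewrite -(cf_sigma v hs2 h) (symplectic_coord (vnab v w) (frame_basis hfr)) -!scaleNr.
rewrite !pairingD !pairingZ (ann_tangent hs2 ht) (ann_tangent hs2 hw) p23 p24 !mulr0 !add0r mulr1.
by [].
Qed.

Lemma omega_coord x y : omega x y = omega x e1 * omega y e2 - omega x e2 * omega y e1
   + omega x e3 * omega y e4 - omega x e4 * omega y e3.
Proof.
have hE := frame_basis hfr; rewrite {1}(symplectic_coord x hE) -!scaleNr !omegaDl !omegaZl.
by rewrite (omegaC e1) (omegaC e2) (omegaC e3) (omegaC e4); ring.
Qed.

(** The total derivatives commute, so that the bracket of two tangent fields is
    again a tangent field. *)
Lemma nab_bracket v w f :
  nb v (nb w f) - nb w (nb v f) = nb (vnab v w - vnab w v) f.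
Proof.
have E v' w' : nb v' (nb w' f) = nb v' (w' i0 0) * D ord0 f + w' i0 0 * nb v' (D ord0 f)
    + (nb v' (w' i1 0) * D ord_max f + w' i1 0 * nb v' (D ord_max f)).
  rewrite -[nb w' f]/(w' i0 0 * D ord0 f + w' i1 0 * D ord_max f).
  by rewrite (derD (nab_der DP v')) !(derM (nab_der DP v')).
have N v' e : nb v' (D e f) = v' i0 0 * D ord0 (D e f) + v' i1 0 * D ord_max (D e f) by [].
rewrite !E !N (D_comm FFP DP ord_max ord0 f).
rewrite -[RHS]/(_ * D ord0 f + _ * D ord_max f) !mxE; ring.
Qed.

Lemma bracket_tangent v w : stangent gen v -> stangent gen w ->
  stangent gen (vnab v w - vnab w v).
Proof.
move=> hv hw'; set z := vnab v w - vnab w v.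
have h (l : 'I_(2 + 2)) : z l 0 = nb z (gen l).
  by rewrite -nab_bracket !(nab_gen DP) // !mxE.
have dE e n m : dnext gen e n = m -> D e (gen n) = m by move=> <-; exact: (D_gen DP).
split; rewrite h /nab inordK //.
  by rewrite (@dE ord0 2%N (gen 4)) // (@dE ord_max 2%N (gen 6)) //; ring.
by rewrite (@dE ord0 3%N (gen 5)) // (@dE ord_max 3%N (gen 7)) //; ring.
Qed.

Lemma bracket12 f : nb e1 (nb e2 f) - nb e2 (nb e1 f) =
  (cf e1 e2 e2 - cf e2 e1 e2) * nb e1 f - (cf e1 e2 e1 - cf e2 e1 e1) * nb e2 f.
Proof.
rewrite nab_bracket; set z := vnab e1 e2 - vnab e2 e1.
have zE : z = (cf e1 e2 e2 - cf e2 e1 e2) *: e1 - (cf e1 e2 e1 - cf e2 e1 e1) *: e2.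
  rewrite [LHS](frame_tangent hfr (bracket_tangent ht hw)).
  by rewrite !omegaDl -!scaleN1r !omegaZl !mulN1r.
by rewrite zE -[LHS]/(_ * D ord0 f + _ * D ord_max f) !mxE /nab; ring.
Qed.

(** The integrability conditions: the second derivatives of the vectors of the
    frame commute up to the bracket of e1 and e2. *)
Lemma codazzi x y :
  nb e1 (cf e2 x y) - nb e2 (cf e1 x y) =
  (cf e1 e2 e2 - cf e2 e1 e2) * cf e1 x y - (cf e1 e2 e1 - cf e2 e1 e1) * cf e2 x y
  + omega (vnab e2 x) (vnab e1 y) - omega (vnab e1 x) (vnab e2 y).
Proof.
rewrite /cf !nab_omega.
have -> : omega (vnab e1 (vnab e2 x)) y + omega (vnab e2 x) (vnab e1 y)
   - (omega (vnab e2 (vnab e1 x)) y + omega (vnab e1 x) (vnab e2 y)) =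
   omega (vnab e1 (vnab e2 x) - vnab e2 (vnab e1 x)) y
   + omega (vnab e2 x) (vnab e1 y) - omega (vnab e1 x) (vnab e2 y).
  by rewrite omegaDl -scaleN1r omegaZl; ring.
congr (_ + _ - _).
have -> : vnab e1 (vnab e2 x) - vnab e2 (vnab e1 x) =
   (cf e1 e2 e2 - cf e2 e1 e2) *: vnab e1 x - (cf e1 e2 e1 - cf e2 e1 e1) *: vnab e2 x.
  by apply/matrixP => i z; rewrite !mxE bracket12.
by rewrite omegaDl -scaleN1r !omegaZl /cf; ring.
Qed.

Local Notation a := (I2a fr).
Local Notation b := (I2b fr).
Local Notation c := (I2c fr).
Local Notation d := (I2d fr).

(** The components along e3 and e4 of the derivatives of e1 and e2 are second
    fundamental forms; the derivative of e1 + e3 along e1 is e1; and the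
    coefficients are symmetric, as the products omega (ei, ej) are constant. *)
Lemma structure1 : [/\ [/\ cf e1 e1 e1 = - b, cf e1 e1 e2 = 1 - c, cf e1 e1 e3 = b & cf e1 e1 e4 = 0],
  [/\ cf e1 e2 e1 = 1 - c, cf e1 e2 e3 = c & cf e1 e2 e4 = - a^-1],
  [/\ cf e1 e3 e1 = b, cf e1 e3 e2 = c, cf e1 e3 e3 = - b & cf e1 e3 e4 = 0]
  & [/\ cf e1 e4 e1 = 0, cf e1 e4 e2 = - a^-1 & cf e1 e4 e3 = 0]].
Proof.
have a0 := I2a_neq0 hfr.
have [[_ _ _] [_ q11 o12 q22 q12] _ [_ _ o34] [_ _ _ Q2E]] := hfr.
have [[_ _ o13 o14] [o23 o24]] := frame_basis hfr.
have k13 : cf e1 e1 e3 = b by rewrite cf3 // /I2b Q2E qform_gram.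
have k23 : cf e1 e2 e3 = c by rewrite cf3 // /I2c Q2E qform_gram.
have k14 : cf e1 e1 e4 = 0.
  by apply: (mulfI a0); rewrite cf4 // q11 oppr0 mulr0.
have k24 : cf e1 e2 e4 = - a^-1.
  by apply: (mulfI a0); rewrite cf4 // q12 mulrN mulfV.
have base y : cf e1 e1 y + cf e1 e3 y = omega e1 y.
  by rewrite /cf -omegaDl vnab_base.
have sw x y r : (omega x y = 0 \/ omega x y = 1) -> cf e1 x y = r -> cf e1 y x = r.
  by move=> h <-; rewrite (cfC _ h).
have k31 : cf e1 e3 e1 = b := (sw _ _ _ (or_introl o13) k13).
have k32 : cf e1 e3 e2 = c := (sw _ _ _ (or_introl o23) k23).
have k41 : cf e1 e4 e1 = 0 := (sw _ _ _ (or_introl o14) k14).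
have k42 : cf e1 e4 e2 = - a^-1 := (sw _ _ _ (or_introl o24) k24).
have k11 : cf e1 e1 e1 = - b by have := base e1; rewrite k31 omegaxx => /eqP; rewrite addr_eq0 => /eqP.
have k12 : cf e1 e1 e2 = 1 - c by have := base e2; rewrite k32 o12 => <-; rewrite addrK.
have k21 : cf e1 e2 e1 = 1 - c := (sw _ _ _ (or_intror o12) k12).
have k33 : cf e1 e3 e3 = - b by have := base e3; rewrite k13 o13 addrC => /eqP; rewrite addr_eq0 => /eqP.
have k34 : cf e1 e3 e4 = 0 by have := base e4; rewrite k14 o14 add0r.
have k43 : cf e1 e4 e3 = 0 := (sw _ _ _ (or_intror o34) k34).
by do !split.
Qed.

Lemma structure2 : [/\ [/\ cf e2 e1 e1 = - c - 1, cf e2 e1 e2 = - d, cf e2 e1 e3 = c & cf e2 e1 e4 = - a^-1],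
  [/\ cf e2 e2 e1 = - d, cf e2 e2 e3 = d & cf e2 e2 e4 = 0],
  [/\ cf e2 e3 e1 = c, cf e2 e3 e2 = d, cf e2 e3 e3 = - c & cf e2 e3 e4 = a^-1]
  & [/\ cf e2 e4 e1 = - a^-1, cf e2 e4 e2 = 0 & cf e2 e4 e3 = a^-1]].
Proof.
have a0 := I2a_neq0 hfr.
have [[_ _ _] [_ q11 o12 q22 q12] _ [_ _ o34] [_ _ _ Q2E]] := hfr.
have [[_ _ o13 o14] [o23 o24]] := frame_basis hfr.
have k13 : cf e2 e1 e3 = c by rewrite cf3 // sformC /I2c Q2E qform_gram.
have k23 : cf e2 e2 e3 = d by rewrite cf3 // /I2d Q2E qform_gram.
have k14 : cf e2 e1 e4 = - a^-1.
  by apply: (mulfI a0); rewrite cf4 // sformC q12 mulrN mulfV.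
have k24 : cf e2 e2 e4 = 0.
  by apply: (mulfI a0); rewrite cf4 // q22 oppr0 mulr0.
have base y : cf e2 e1 y + cf e2 e3 y = omega e2 y.
  by rewrite /cf -omegaDl vnab_base.
have o21 : omega e2 e1 = -1 by rewrite omegaC o12.
have sw x y r : (omega x y = 0 \/ omega x y = 1) -> cf e2 x y = r -> cf e2 y x = r.
  by move=> h <-; rewrite (cfC _ h).
have k31 : cf e2 e3 e1 = c := (sw _ _ _ (or_introl o13) k13).
have k32 : cf e2 e3 e2 = d := (sw _ _ _ (or_introl o23) k23).
have k41 : cf e2 e4 e1 = - a^-1 := (sw _ _ _ (or_introl o14) k14).
have k42 : cf e2 e4 e2 = 0 := (sw _ _ _ (or_introl o24) k24).
have k11 : cf e2 e1 e1 = - c - 1.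
  by have := base e1; rewrite k31 o21 => /(canRL (addrK _)) ->; ring.
have k12 : cf e2 e1 e2 = - d by have := base e2; rewrite k32 omegaxx => /eqP; rewrite addr_eq0 => /eqP.
have k21 : cf e2 e2 e1 = - d := (sw _ _ _ (or_intror o12) k12).
have k33 : cf e2 e3 e3 = - c by have := base e3; rewrite k13 o23 addrC => /eqP; rewrite addr_eq0 => /eqP.
have k34 : cf e2 e3 e4 = a^-1.
  by have := base e4; rewrite k14 o24 => /(canRL (addKr _)) ->; ring.
have k43 : cf e2 e4 e3 = a^-1 := (sw _ _ _ (or_intror o34) k34).
by do !split.
Qed.

(** The integrability conditions for the pairs (e1, e3), (e2, e3), (e1, e4) and
    (e2, e4) are linear in the four coefficients that remain. The determinant of
    the system is b^2 (b d - c^2) up to sign. *)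
Lemma structure_solve :
  let x1 := cf e1 e2 e2 in let x2 := cf e2 e2 e2 in
  let y1 := cf e1 e4 e4 in let y2 := cf e2 e4 e4 in let k := a^-1 in
  [/\ b * x1 = nb e1 c - nb e2 b - 3%:R * (b * d) + 2%:R * c + 2%:R * (c * c) + 2%:R * (k * b),
      b * x2 = 2%:R * (c * x1) + c * d - 3%:R * d - nb e1 d + nb e2 c,
      c * y1 - b * y2 = - nb e1 k - 2%:R * k - 2%:R * (c * k)
    & d * y1 - c * y2 = nb e2 k + 2%:R * (x1 * k) + k * k].
Proof.
move=> x1 x2 y1 y2 k.
have [[a11 a12 a13 a14] [a21 a23 a24] [a31 a32 a33 a34] [a41 a42 a43]] := structure1.
have [[b11 b12 b13 b14] [b21 b23 b24] [b31 b32 b33 b34] [b41 b42 b43]] := structure2.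
have cz x y : nb e1 (cf e2 x y) - nb e2 (cf e1 x y) =
  (cf e1 e2 e2 - cf e2 e1 e2) * cf e1 x y - (cf e1 e2 e1 - cf e2 e1 e1) * cf e2 x y
  + (cf e2 x e1 * cf e1 y e2 - cf e2 x e2 * cf e1 y e1 + cf e2 x e3 * cf e1 y e4 - cf e2 x e4 * cf e1 y e3)
  - (cf e1 x e1 * cf e2 y e2 - cf e1 x e2 * cf e2 y e1 + cf e1 x e3 * cf e2 y e4 - cf e1 x e4 * cf e2 y e3).
  by rewrite codazzi (omega_coord (vnab e2 x)) (omega_coord (vnab e1 x)).
have N0 v : nb v 0 = 0 := der0 (nab_der DP v).
have NN v u : nb v (- u) = - nb v u := derN (nab_der DP v) u.
have := cz e1 e3; have := cz e1 e4; have := cz e2 e3; have := cz e2 e4.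
rewrite -/x1 -/x2 -/y1 -/y2.
rewrite ?a11 ?a12 ?a13 ?a14 ?a21 ?a23 ?a24 ?a31 ?a32 ?a33 ?a34 ?a41 ?a42 ?a43.
rewrite ?b11 ?b12 ?b13 ?b14 ?b21 ?b23 ?b24 ?b31 ?b32 ?b33 ?b34 ?b41 ?b42 ?b43.
rewrite -/x1 -/x2 -/y1 -/y2 -/k ?N0 ?NN => E24 E23 E14 E13.
have sub0 (u v : FF) : u = v -> u - v = 0 by move=> ->; rewrite subrr.
split; apply/eqP; rewrite -subr_eq0; apply/eqP.
- by rewrite -[RHS]oppr0 -(sub0 _ _ E13); ring.
- by rewrite -[RHS](sub0 _ _ E23); ring.
- by rewrite -[RHS]oppr0 -(sub0 _ _ E14); ring.
- by rewrite -[RHS]oppr0 -(sub0 _ _ E24); ring.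
Qed.

End StructureEquations.

(** * Rational expressions *)

Section RationalExpressions.

Variables (R : realType) (FF : fieldType) (jF : {rmorphism R -> FF}).

Inductive field_gen (S : FF -> Prop) : FF -> Prop :=
| fg_const c : field_gen S (jF c)
| fg_in x of S x : field_gen S x
| fg_add x y of field_gen S x & field_gen S y : field_gen S (x + y)
| fg_mul x y of field_gen S x & field_gen S y : field_gen S (x * y)
| fg_inv x of field_gen S x : field_gen S x^-1.

Lemma fg_opp S x : field_gen S x -> field_gen S (- x).
Proof.
by move=> hx; rewrite -mulN1r -(rmorphN1 jF); apply: fg_mul => //; exact: fg_const.
Qed.

Lemma fg_nat S n : field_gen S n%:R.
Proof. by rewrite -(rmorph_nat jF); exact: fg_const. Qed.

Lemma fg_0 S : field_gen S 0. Proof. exact: (fg_nat S 0). Qed.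
Lemma fg_1 S : field_gen S 1. Proof. exact: (fg_nat S 1). Qed.

Lemma fg_sub_pred (S S' : FF -> Prop) : (forall x, S x -> field_gen S' x) ->
  forall x, field_gen S x -> field_gen S' x.
Proof.
move=> h x; elim=> [c|y /h //|y z _ hy _ hz|y z _ hy _ hz|y _ hy].
- exact: fg_const.
- exact: fg_add.
- exact: fg_mul.
- exact: fg_inv.
Qed.

Lemma fg_der S (d : FF -> FF) : derivation d -> (forall c, d (jF c) = 0) ->
    (forall x, S x -> field_gen S (d x)) ->
  forall x, field_gen S x -> field_gen S (d x).
Proof.
move=> dd dc dS x; elim=> [c|y /dS //|y z hy hdy hz hdz|y z hy hdy hz hdz|y hy hdy].
- by rewrite dc; exact: fg_0.
- by rewrite (derD dd); exact: fg_add.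
- by rewrite (derM dd); apply: fg_add; apply: fg_mul.
- by rewrite (derV dd) expr2; apply: fg_mul; [apply: fg_opp|apply: fg_inv; apply: fg_mul].
Qed.

Definition rational_in n (z : 'I_n -> FF) (f : FF) : Prop :=
  exists P Q : {mpoly R[n]}, mmap jF z Q != 0 /\ f = mmap jF z P / mmap jF z Q.

Definition point (u : seq FF) : 'I_(size u) -> FF := fun i => nth (0 : FF) u i.
Arguments point : clear implicits.

Lemma rational_in_poly n (z : 'I_n -> FF) P : rational_in z (mmap jF z P).
Proof. by exists P, 1; rewrite rmorph1 divr1 oner_neq0. Qed.

Lemma rational_in_add n (z : 'I_n -> FF) x y : rational_in z x -> rational_in z y -> rational_in z (x + y).
Proof.
move=> [P [Q [Q0 ->]]] [P' [Q' [Q'0 ->]]]; exists (P * Q' + P' * Q), (Q * Q').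
by rewrite !rmorphD !rmorphM /= mulf_neq0 // addf_div.
Qed.

Lemma rational_in_mul n (z : 'I_n -> FF) x y : rational_in z x -> rational_in z y -> rational_in z (x * y).
Proof.
move=> [P [Q [Q0 ->]]] [P' [Q' [Q'0 ->]]]; exists (P * P'), (Q * Q').
by rewrite !rmorphM /= mulf_neq0 // mulf_div.
Qed.

Lemma rational_in_inv n (z : 'I_n -> FF) x : rational_in z x -> rational_in z x^-1.
Proof.
move=> [P [Q [Q0 ->]]]; have [P0|P0] := eqVneq (mmap jF z P) 0.
  by rewrite P0 mul0r invr0 -(rmorph0 (mmap jF z)); exact: rational_in_poly.
by exists Q, P; rewrite invf_div.
Qed.

Lemma rational_in_reindex n m (z : 'I_n -> FF) (z' : 'I_m -> FF) f :
  (forall i, exists j, z i = z' j) -> rational_in z f -> rational_in z' f.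
Proof.
move=> /choice[rho zE] [P [Q [Q0 ->]]].
pose t : n.-tuple {mpoly R[m]} := [tuple 'X_(rho i) | i < n].
have mE p : mmap jF z' (p \mPo t) = mmap jF z p.
  rewrite -[LHS]/((mmap jF z' \o @comp_mpoly _ R _ t) p).
  apply: mpoly_hom_uniq => [c|i] /=; first by rewrite comp_mpolyC !mmapC.
  by rewrite comp_mpolyXU -tnth_nth tnth_mktuple !mmapX !mmap1U zE.
by exists (P \mPo t), (Q \mPo t); rewrite !mE.
Qed.

Lemma rational_in_subset (u v : seq FF) f : {subset u <= v} -> rational_in (point u) f -> rational_in (point v) f.
Proof.
move=> uv; apply: rational_in_reindex => i.
have uiv : point u i \in v by rewrite uv // mem_nth.
have lt := uiv; rewrite -index_mem in lt.
by exists (Ordinal lt); rewrite [RHS]nth_index.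
Qed.

(** Rational expressions in two lists are rational expressions in their
    concatenation. *)
Lemma field_gen_rational S f : field_gen S f ->
  exists u : seq FF, (forall x, x \in u -> S x) /\ rational_in (point u) f.
Proof.
elim=> [c|x Sx|x y _ [u [uS ux]] _ [v [vS vy]]|x y _ [u [uS ux]] _ [v [vS vy]]|x _ [u [uS ux]]].
- by exists [::]; split=> //; rewrite -(mmapC (point [::]) jF c); exact: rational_in_poly.
- exists [:: x]; split=> [y|]; first by rewrite inE => /eqP ->.
  by have := rational_in_poly (point [:: x]) 'X_ord0; rewrite mmapX mmap1U.
- exists (u ++ v); split=> [z|]; first by rewrite mem_cat => /orP[/uS|/vS].
  apply: rational_in_add; [apply: rational_in_subset ux|apply: rational_in_subset vy] => z zu;
    by rewrite mem_cat zu ?orbT.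
- exists (u ++ v); split=> [z|]; first by rewrite mem_cat => /orP[/uS|/vS].
  apply: rational_in_mul; [apply: rational_in_subset ux|apply: rational_in_subset vy] => z zu;
    by rewrite mem_cat zu ?orbT.
- by exists u; split=> //; exact: rational_in_inv.
Qed.

End RationalExpressions.

(** * Generation by the invariants and the frame *)

Section Generation.

Variables (R : realType) (FF : fieldType) (jF : {rmorphism R -> FF}).
Variables (gen : nat -> FF) (D : 'I_2 -> FF -> FF).
Hypotheses (FFP : jet_field jF gen) (DP : total_derivatives jF gen D).
Variable fr : frame FF.
Hypotheses (hfr : sframe gen fr) (b0 : I2b fr != 0)
  (bd0 : I2b fr * I2d fr - I2c fr ^+ 2 != 0).

Local Notation fgen := (field_gen jF).
Local Notation nb := (nab D).
Local Notation e1 := (vpar fr).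
Local Notation e2 := (wpar fr).
Local Notation e3 := (vperp fr).
Local Notation e4 := (wperp fr).

(* In the application, the iterated derivatives of the invariants of order 2. *)
Variable GS : FF -> Prop.
Hypotheses (GS_nab1 : forall x, GS x -> GS (nb e1 x))
  (GS_nab2 : forall x, GS x -> GS (nb e2 x))
  (GSa : GS (I2a fr)) (GSb : GS (I2b fr)) (GSc : GS (I2c fr)) (GSd : GS (I2d fr)).

Lemma nab_jF v c : nb v (jF c) = 0.
Proof. by rewrite /nab !(D_const DP) !mulr0 addr0. Qed.

Lemma fgen_nab1 x : fgen GS x -> fgen GS (nb e1 x).
Proof.
by apply: fg_der; [exact: nab_der|exact: nab_jF|move=> y Gy; apply: fg_in; exact: GS_nab1].
Qed.

Lemma fgen_nab2 x : fgen GS x -> fgen GS (nb e2 x).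
Proof.
by apply: fg_der; [exact: nab_der|exact: nab_jF|move=> y Gy; apply: fg_in; exact: GS_nab2].
Qed.

Ltac fg_tac := repeat first [assumption | lazymatch goal with
  | |- field_gen _ _ (nab _ (vpar _) _) => apply: fgen_nab1
  | |- field_gen _ _ (nab _ (wpar _) _) => apply: fgen_nab2
  | |- field_gen _ _ (GRing.natmul 1 _) => exact: fg_nat
  | |- field_gen _ _ (GRing.add _ _) => apply: fg_add
  | |- field_gen _ _ (GRing.opp _) => apply: fg_opp
  | |- field_gen _ _ (GRing.mul _ _) => apply: fg_mul
  | |- field_gen _ _ (GRing.inv _) => apply: fg_inv
  | |- field_gen _ _ 1 => exact: fg_1
  | |- field_gen _ _ 0 => exact: fg_0
  end].

(** The linear system for the four unknown coefficients is solved by division by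
    I2b and by I2b I2d - I2c ^ 2. *)
Lemma fgen_cf : [/\ forall x y, x \in [:: e1; e2; e3; e4] -> y \in [:: e1; e2; e3; e4] ->
    fgen GS (cf D e1 x y) & forall x y, x \in [:: e1; e2; e3; e4] -> y \in [:: e1; e2; e3; e4] ->
    fgen GS (cf D e2 x y)].
Proof.
have ha : fgen GS (I2a fr) by exact: fg_in.
have hb : fgen GS (I2b fr) by exact: fg_in.
have hc : fgen GS (I2c fr) by exact: fg_in.
have hd : fgen GS (I2d fr) by exact: fg_in.
have [[a11 a12 a13 a14] [a21 a23 a24] [a31 a32 a33 a34] [a41 a42 a43]] := structure1 DP hfr.
have [[b11 b12 b13 b14] [b21 b23 b24] [b31 b32 b33 b34] [b41 b42 b43]] := structure2 DP hfr.
have [X1 X2 Y1 Y2] := structure_solve FFP DP hfr.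
have x1 : fgen GS (cf D e1 e2 e2).
  by rewrite -(mulKf b0 (cf D e1 e2 e2)) X1; fg_tac.
have x2 : fgen GS (cf D e2 e2 e2).
  by rewrite -(mulKf b0 (cf D e2 e2 e2)) X2; fg_tac.
have y1 : fgen GS (cf D e1 e4 e4).
  rewrite -(mulKf bd0 (cf D e1 e4 e4)); apply: fg_mul; first by rewrite expr2; fg_tac.
  have -> : (I2b fr * I2d fr - I2c fr ^+ 2) * cf D e1 e4 e4 =
     I2b fr * (I2d fr * cf D e1 e4 e4 - I2c fr * cf D e2 e4 e4)
     - I2c fr * (I2c fr * cf D e1 e4 e4 - I2b fr * cf D e2 e4 e4) by ring.
  by rewrite Y1 Y2; fg_tac.
have y2 : fgen GS (cf D e2 e4 e4).
  rewrite -(mulKf bd0 (cf D e2 e4 e4)); apply: fg_mul; first by rewrite expr2; fg_tac.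
  have -> : (I2b fr * I2d fr - I2c fr ^+ 2) * cf D e2 e4 e4 =
     I2c fr * (I2d fr * cf D e1 e4 e4 - I2c fr * cf D e2 e4 e4)
     - I2d fr * (I2c fr * cf D e1 e4 e4 - I2b fr * cf D e2 e4 e4) by ring.
  by rewrite Y1 Y2; fg_tac.
split=> x y; rewrite !inE => /or4P[] /eqP -> /or4P[] /eqP -> //;
  rewrite ?a11 ?a12 ?a13 ?a14 ?a21 ?a23 ?a24 ?a31 ?a32 ?a33 ?a34 ?a41 ?a42 ?a43
    ?b11 ?b12 ?b13 ?b14 ?b21 ?b23 ?b24 ?b31 ?b32 ?b33 ?b34 ?b41 ?b42 ?b43; fg_tac.
Qed.

Definition frame_mx : 'M[FF]_(2 + 2) := basis_mx e1 e2 e3 e4.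

Definition entry (M : 'M[FF]_(2 + 2)) (x : FF) : Prop := exists i k, x = M i k.

Local Notation GE := (fun x => GS x \/ entry frame_mx x).

Lemma fgE_entry x i : x \in [:: e1; e2; e3; e4] -> fgen GE (x i 0).
Proof.
have [c1 c2 c3 c4] := basis_mxE e1 e2 e3 e4.
rewrite !inE => /or4P[] /eqP ->; apply: fg_in; right.
- by exists i, i0; rewrite -[in LHS]c1 mxE.
- by exists i, i1; rewrite -[in LHS]c2 mxE.
- by exists i, i2; rewrite -[in LHS]c3 mxE.
- by exists i, i3; rewrite -[in LHS]c4 mxE.
Qed.

Lemma fgE_of_GS x : fgen GS x -> fgen GE x.
Proof. by apply: fg_sub_pred => y Gy; apply: fg_in; left. Qed.

(** The derivatives of the frame are combinations of the frame itself, with the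
    structure coefficients. *)
Lemma fgE_vnab v x i : v = e1 \/ v = e2 -> x \in [:: e1; e2; e3; e4] ->
  fgen GE (nb v (x i 0)).
Proof.
move=> hv hx; have [k1 k2] := fgen_cf.
have hcf y : y \in [:: e1; e2; e3; e4] -> fgen GE (cf D v x y).
  by move=> hy; apply: fgE_of_GS; case: hv => ->; [exact: k1|exact: k2].
have -> : nb v (x i 0) = vnab D v x i 0 by rewrite mxE.
rewrite (symplectic_coord (vnab D v x) (frame_basis hfr)) !mxE.
by fg_tac; try (apply: hcf; rewrite !inE eqxx ?orbT //); apply: fgE_entry; rewrite !inE eqxx ?orbT.
Qed.

Lemma fgE_nab v x : v = e1 \/ v = e2 -> fgen GE x -> fgen GE (nb v x).
Proof.
move=> hv; apply: fg_der; [exact: nab_der|exact: nab_jF|].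
move=> y [Gy|[i [k ->]]].
  by apply: fg_in; left; case: hv => ->; [exact: GS_nab1|exact: GS_nab2].
have [c1 c2 c3 c4] := basis_mxE e1 e2 e3 e4.
have cE (j : 'I_(2 + 2)) : frame_mx i j = col j frame_mx i 0 by rewrite [RHS]mxE.
rewrite cE /frame_mx; elim/ord4P: k; rewrite ?c1 ?c2 ?c3 ?c4; apply: fgE_vnab => //;
  by rewrite !inE eqxx ?orbT.
Qed.

(** The total derivatives are combinations of those along e1 and e2, which are
    independent because omega (e1, e2) = 1. *)
Lemma fgE_D e x : fgen GE x -> fgen GE (D e x).
Proof.
move=> hx; have [[_ ht _] [hw _ o12 _ _] _ _ _] := hfr.
pose dl := e1 i0 0 * e2 i1 0 - e1 i1 0 * e2 i0 0.
have dl0 : dl != 0.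
  apply: contra_eq_neq o12 => dl0.
  rewrite (tvec_eq ht) (tvec_eq hw) omega_tvec -/dl dl0 mulr0 eq_sym; exact: oner_neq0.
have h1 : fgen GE (nb e1 x) by apply: fgE_nab => //; left.
have h2 : fgen GE (nb e2 x) by apply: fgE_nab => //; right.
have ent y i : y \in [:: e1; e2; e3; e4] -> fgen GE (y i 0) by exact: fgE_entry.
have m1 : e1 \in [:: e1; e2; e3; e4] by rewrite !inE eqxx.
have m2 : e2 \in [:: e1; e2; e3; e4] by rewrite !inE eqxx orbT.
have E0 : D ord0 x = (e2 i1 0 * nb e1 x - e1 i1 0 * nb e2 x) / dl.
  by apply: (canRL (mulfK dl0)); rewrite /nab /dl; ring.
have E1 : D ord_max x = (e1 i0 0 * nb e2 x - e2 i0 0 * nb e1 x) / dl.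
  by apply: (canRL (mulfK dl0)); rewrite /nab /dl; ring.
have hdl : fgen GE dl by rewrite /dl; fg_tac; exact: ent.
by elim/ord2P: e; rewrite ?E0 ?E1; fg_tac; exact: ent.
Qed.

(** The base point is e1 + e3, and all the jet coordinates are total derivatives
    of its coordinates. *)
Lemma fgE_gen n : fgen GE (gen n).
Proof.
have base (l : 'I_(2 + 2)) : fgen GE (gen l).
  have [[hb _ _] _ _ _ _] := hfr; rewrite hb.
  by apply: fg_add; apply: fgE_entry; rewrite !inE eqxx ?orbT.
move: n; elim/jcoord_ind => [||a i l a2].
- exact: (base (inord 0 : 'I_(2 + 2))) || by have := base i0; rewrite inordK.
- by have := base i1; rewrite inordK.
elim: i => [|i IH].
  elim: l => [|l IH].
    by case: a a2 => [|[|//]] _; [have := base i2|have := base i3]; rewrite inordK.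
  by have := fgE_D ord_max IH; rewrite (D_gen DP) dnext_jidx // addn0 addn1.
by have := fgE_D ord0 IH; rewrite (D_gen DP) dnext_jidx // addn0 addn1.
Qed.

Lemma fgE_all x : fgen GE x.
Proof.
have [k [P [Q [Q0 ->]]]] := jet_span FFP x.
have h (p : {mpoly R[jdim k]}) : fgen GE (ev jF gen p).
  apply: (mpoly_gen_ind (P := fun p => fgen GE (ev jF gen p))) => [c|i|p' q hp hq|p' q hp hq].
  - by rewrite evC; exact: fg_const.
  - by rewrite evX; exact: fgE_gen.
  - by rewrite rmorphD; exact: fg_add.
  - by rewrite rmorphM; exact: fg_mul.
by apply: fg_mul => //; exact: fg_inv.
Qed.

End Generation.

(** * Separating the invariants from the frame *)

Definition with_entries (K : fieldType) N (s : 'I_N -> K) (M : 'M[K]_(2 + 2))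
    (i : 'I_(N + (2 + 2) * (2 + 2))) : K :=
  match split i with inl i => s i | inr i => mxvec M 0 i end.

Section Separation.

Variables (R : realType) (FF : fieldType) (jF : {rmorphism R -> FF}).
Variables (gen : nat -> FF).
Hypotheses (FFP : jet_field jF gen).

Local Notation at_real := (at_jet jF gen idfun (@nonzero R)).

Lemma at_mx_mul k th (A B : 'M[FF]_(2 + 2)) (a b : 'M[R]_(2 + 2)) :
    (forall i l, at_real k th (A i l) (a i l)) -> (forall i l, at_real k th (B i l) (b i l)) ->
  forall i l, at_real k th ((A *m B) i l) ((a *m b) i l).
Proof.
move=> hA hB i l; rewrite !mxE.
apply: (at_sum FFP (nz1 R) (@nzM R) (@nz0 R)) => m.
exact: (at_mul (@nzM R) (hA i m) (hB m l)).
Qed.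

Lemma at_mx_const k th (a : 'M[R]_(2 + 2)) i l : at_real k th (map_mx jF a i l) (a i l).
Proof. by rewrite mxE; exact: (at_const jF gen idfun (nz1 R)). Qed.

Lemma at_symplectic k th (A : 'M[FF]_(2 + 2)) (a : 'M[R]_(2 + 2)) :
  (forall i l, at_real k th (A i l) (a i l)) -> symplectic A -> symplectic a.
Proof.
move=> hA /symplectic_mx sA; apply/symplectic_mx; apply/matrixP => i l.
have hO i' l' : at_real k th (omega_mx FF i' l') (omega_mx R i' l').
  by rewrite -(map_omega_mx jF); exact: at_mx_const.
have hT i' l' : at_real k th (A^T i' l') (a^T i' l') by rewrite !mxE.
have h := at_mx_mul (at_mx_mul hT hO) hA i l; rewrite sA in h.
exact: (at_uniq FFP (@nz0 R) h (hO i l)).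
Qed.

Variables (N : nat) (s : 'I_N -> FF) (E : 'M[FF]_(2 + 2)) (F : FF).

Local Notation diff M P Q := (F * mmap jF (with_entries s M) Q - mmap jF (with_entries s M) P).

Lemma at_entries k th (M : 'M[FF]_(2 + 2)) (v : 'I_N -> R) (m : 'M[R]_(2 + 2)) :
    (forall i, at_real k th (s i) (v i)) -> (forall i l, at_real k th (M i l) (m i l)) ->
  forall p, at_real k th (with_entries s M p) (with_entries v m p).
Proof.
move=> hs hM p; rewrite /with_entries; case: (split p) => // q.
by case/mxvec_indexP: q => i l; rewrite !mxvecE.
Qed.

Lemma at_mmap_entries k th (M : 'M[FF]_(2 + 2)) (v : 'I_N -> R) (m : 'M[R]_(2 + 2)) P :
    (forall i, at_real k th (s i) (v i)) -> (forall i l, at_real k th (M i l) (m i l)) ->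
  at_real k th (mmap jF (with_entries s M) P) (mmap idfun (with_entries v m) P).
Proof.
move=> hs hM; exact: (at_mmap FFP (nz1 R) (@nzM R) (@nz0 R) P (at_entries hs hM)).
Qed.

Lemma at_diff k th (M : 'M[FF]_(2 + 2)) (v : 'I_N -> R) (m : 'M[R]_(2 + 2)) c P Q :
    (forall i, at_real k th (s i) (v i)) -> (forall i l, at_real k th (M i l) (m i l)) ->
    at_real k th F c ->
  at_real k th (diff M P Q)
    (c * mmap idfun (with_entries v m) Q - mmap idfun (with_entries v m) P).
Proof.
move=> hs hM hF.
apply: (at_sub FFP (@nzM R) (@nz0 R)); last exact: at_mmap_entries.
apply: (at_mul (@nzM R) hF); exact: at_mmap_entries.
Qed.

(* The functions that have to be regular at a jet. *)
Definition jet_data : seq FF :=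
  F :: [seq s i | i <- enum 'I_N] ++ [seq E p.1 p.2 | p <- enum {: 'I_(2 + 2) * 'I_(2 + 2)}].

Lemma real_data X : exists k th c (v : 'I_N -> R) (m : 'M[R]_(2 + 2)) x,
  [/\ at_real k th F c, forall i, at_real k th (s i) (v i),
      forall i l, at_real k th (E i l) (m i l), at_real k th X x & X != 0 -> x != 0].
Proof.
have [k [th hth]] := regular_jet FFP (X :: jet_data).
have hs i : exists c, at_real k th (s i) c.
  have [|c [hc _]] := hth (s i); last by exists c.
  by rewrite !inE mem_cat map_f ?orbT // mem_enum.
have hE p : exists c, at_real k th (E p.1 p.2) c.
  have [|c [hc _]] := hth (E p.1 p.2); last by exists c.
  by rewrite !inE mem_cat (map_f (fun p => E p.1 p.2)) ?orbT // mem_enum.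
have [v hv] := choice hs; have [m hm] := choice hE.
have [|c [hc _]] := hth F; first by rewrite !inE eqxx orbT.
have [|x [hx x0]] := hth X; first by rewrite inE eqxx.
exists k, th, c, v, (\matrix_(i, l) m (i, l)), x; split=> // i l.
by rewrite mxE; exact: (hm (i, l)).
Qed.

(** The last hypothesis says that F and the s i are fixed by the group, while E is
    moved to g E. Let m0
    be the value of E at a jet where the denominator does not vanish. If F were
    not equal to the expression with m0 in the place of E, then the difference
    would be nonzero at some jet, with E = m there; but for g = m0 m^-1 the
    expressions with g E and with m0 have the same value at this jet. *)
Lemma separation : symplectic E -> rational_in jF (with_entries s E) F ->
    (forall P Q, diff E P Q = 0 -> forall g, symplectic g -> diff (map_mx jF g *m E) P Q = 0) ->
  rational_in jF s F.
Proof.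
move=> sE [P [Q [Q0 FE]]] inv.
have eq0 : diff E P Q = 0 by rewrite FE divfK // subrr.
have [k0 [th0 [c0 [v0 [m0 [q0 [_ hv0 hm0 hq0 /(_ Q0) q00]]]]]]] :=
  real_data (mmap jF (with_entries s E) Q).
have sm0 : symplectic m0 := at_symplectic hm0 sE.
have const_Q : mmap jF (with_entries s (map_mx jF m0)) Q != 0.
  apply: contraNneq q00 => e0.
  have h1 := at_mmap_entries Q hv0 (at_mx_const k0 th0 m0); rewrite e0 in h1.
  have h2 := at_mmap_entries Q hv0 hm0.
  by rewrite (at_uniq FFP (@nz0 R) hq0 h2) (at_uniq FFP (@nz0 R) h1 (at_0 jF gen idfun (nz1 R) k0 th0)).
have const_F : diff (map_mx jF m0) P Q = 0.
  apply/eqP; apply: contraT => X0.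
  have [k [th [c [v [m [x [hF hv hm hx /(_ X0) x0]]]]]]] := real_data (diff (map_mx jF m0) P Q).
  have [m' [sm' m'm _]] := symplectic_inv (at_symplectic hm sE).
  have sg : symplectic (m0 *m m') by move=> y z; rewrite -!mulmxA sm0 sm'.
  have hg i l : at_real k th ((map_mx jF (m0 *m m') *m E) i l) (m0 i l).
    have := at_mx_mul (at_mx_const k th (m0 *m m')) hm i l.
    by rewrite -mulmxA m'm mulmx1.
  have h1 := at_diff P Q hv hg hF; rewrite (inv _ _ eq0 _ sg) in h1.
  have h2 := at_diff P Q hv (at_mx_const k th m0) hF.
  move: x0; rewrite (at_uniq FFP (@nz0 R) hx h2).
  by rewrite (at_uniq FFP (@nz0 R) h1 (at_0 jF gen idfun (nz1 R) k th)) eqxx.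
pose t : (N + (2 + 2) * (2 + 2)).-tuple {mpoly R[N]} :=
  [tuple match split i with inl i => 'X_i | inr i => (mxvec m0 0 i)%:MP end
     | i < N + (2 + 2) * (2 + 2)].
have mE p : mmap jF s (p \mPo t) = mmap jF (with_entries s (map_mx jF m0)) p.
  rewrite -[LHS]/((mmap jF s \o @comp_mpoly _ R _ t) p).
  apply: mpoly_hom_uniq => [c|i] /=; first by rewrite comp_mpolyC !mmapC.
  rewrite comp_mpolyXU -tnth_nth tnth_mktuple !mmapX !mmap1U /with_entries.
  case: (split i) => j; first by rewrite mmapX mmap1U.
  by rewrite mmapC -map_mxvec mxE.
exists (P \mPo t), (Q \mPo t); rewrite !mE; split=> //.
by apply: (canRL (mulfK const_Q)); apply/eqP; rewrite -subr_eq0 const_F.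
Qed.

End Separation.

(** * Rational invariants *)

Section RationalInvariants.

Variables (R : realType) (FF : fieldType) (jF : {rmorphism R -> FF}).
Variables (gen : nat -> FF) (D : 'I_2 -> FF -> FF).
Hypotheses (FFP : jet_field jF gen) (DP : total_derivatives jF gen D).

(** The pull-back along g is the endomorphism h that is the identity on the
    constants and sends the jet coordinates to those of the prolonged jet. *)
Definition fixed_by_group (x : FF) : Prop :=
  forall g (h : {rmorphism FF -> FF}), symplectic g -> (forall c, h (jF c) = jF c) ->
    (forall n, h (gen n) = gjet jF gen D g n) -> h x = x.

Variable fr : frame FF.
Hypotheses (hfr : sframe gen fr) (b0 : I2b fr != 0)
  (bd0 : I2b fr * I2d fr - I2c fr ^+ 2 != 0).

Lemma pull_frame_mx g (h : {rmorphism FF -> FF}) : symplectic g ->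
    (forall n, h (gen n) = gjet jF gen D g n) ->
  map_mx h (frame_mx fr) = map_mx jF g *m frame_mx fr.
Proof.
move=> hg hX; have [g' [_ g'g _]] := symplectic_inv hg.
have gig : map_mx jF g' *m gm jF g = 1%:M by rewrite /gm -map_mxM g'g map_mx1.
have e := pull_frame FFP DP hg hX gig hfr b0.
have [e1 e2 e3 e4] : [/\ map_mx h (vpar fr) = gm jF g *m vpar fr,
    map_mx h (vperp fr) = gm jF g *m vperp fr, map_mx h (wpar fr) = gm jF g *m wpar fr
  & map_mx h (wperp fr) = gm jF g *m wperp fr].
  by split; [have := congr1 (@vpar FF) e|have := congr1 (@vperp FF) e
            |have := congr1 (@wpar FF) e|have := congr1 (@wperp FF) e].
have [c1 c2 c3 c4] := basis_mxE (vpar fr) (wpar fr) (vperp fr) (wperp fr).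
have colP k : col k (map_mx h (frame_mx fr)) = col k (map_mx jF g *m frame_mx fr).
  rewrite -map_col [RHS]colE -mulmxA -colE /frame_mx.
  by elim/ord4P: k; rewrite ?c1 ?c2 ?c3 ?c4 ?e1 ?e2 ?e3 ?e4.
by apply/matrixP => i k; have /matrixP/(_ i 0) := colP k; rewrite [LHS]mxE [RHS]mxE.
Qed.

Lemma hom_mmap (h : {rmorphism FF -> FF}) n (z : 'I_n -> FF) P :
  (forall c, h (jF c) = jF c) -> h (mmap jF z P) = mmap jF (h \o z) P.
Proof.
move=> hC; rewrite -[LHS]/((h \o mmap jF z) P).
by apply: mpoly_hom_uniq => [c|i] /=; rewrite ?mmapC ?mmapX ?mmap1U ?hC.
Qed.

(* Again the iterated derivatives of the invariants of order 2. *)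
Variable GS : FF -> Prop.
Hypotheses (GS_nab1 : forall x, GS x -> GS (nab D (vpar fr) x))
  (GS_nab2 : forall x, GS x -> GS (nab D (wpar fr) x))
  (GSa : GS (I2a fr)) (GSb : GS (I2b fr)) (GSc : GS (I2c fr)) (GSd : GS (I2d fr))
  (GS_inv : forall x, GS x -> fixed_by_group x).

Lemma invariants_generated F : fixed_by_group F ->
  exists s : seq FF, (forall x, x \in s -> GS x) /\ rational_in jF (@point FF s) F.
Proof.
move=> Finv; have [u [uP uF]] := field_gen_rational (fgE_all FFP DP hfr b0 bd0 GS_nab1 GS_nab2 GSa GSb GSc GSd F).
pose s := [seq x <- u | `[< GS x >]]; exists s.
have sP x : x \in s -> GS x by rewrite mem_filter => /andP[/asboolP].
split=> //; apply: (separation FFP (E := frame_mx fr)).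
- exact: basis_mx_symplectic (frame_basis hfr).
- apply: rational_in_reindex uF => i; have ui : point i \in u by exact: mem_nth.
  case: (uP _ ui) => [Gx|[l [k ->]]].
    have xs : point i \in s by rewrite mem_filter ui andbT; apply/asboolP.
    have lt := xs; rewrite -index_mem in lt.
    exists (lshift _ (Ordinal lt)); rewrite /with_entries.
    case: split_ordP => j => [/lshift_inj <-|/eqP]; first by rewrite [RHS]nth_index.
    by rewrite eq_lrshift.
  exists (rshift _ (mxvec_index l k)); rewrite /with_entries.
  case: split_ordP => j => [/eqP|/rshift_inj <-]; last by rewrite mxvecE.
  by rewrite eq_rlshift.
move=> P Q e g hg; have [h [hC hX]] := pull_exists FFP DP hg.
have := congr1 h e; rewrite rmorph0 rmorphB rmorphM /= (Finv g h hg hC hX) !hom_mmap //.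
have zE : h \o with_entries (@point FF s) (frame_mx fr) =
    with_entries (@point FF s) (map_mx jF g *m frame_mx fr).
  apply/funext => i; rewrite /= /with_entries; case: (split i) => j.
    by apply: GS_inv hg hC hX; apply: sP; exact: mem_nth.
  by rewrite -(pull_frame_mx hg hX) -map_mxvec [RHS]mxE.
by rewrite zE.
Qed.

End RationalInvariants.

(** * The frame of the generic jet *)

Section GenericFrame.

Variables (R : realType) (FF : fieldType) (jF : {rmorphism R -> FF}).
Variables (gen : nat -> FF).
Hypotheses (FFP : jet_field jF gen).
Variables (K : fieldType) (j : {rmorphism K -> FF}) (th : nat -> K).
Hypothesis hth : forall n, (n < 14)%N -> j (th n) = gen n.

Lemma FF_two : (2%:R : FF) != 0.
Proof. by rewrite -(rmorph_nat jF) fmorph_eq0 pnatr_eq0. Qed.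

Lemma generic_frame_I2 fr : sframe gen fr ->
  I2b fr != 0 /\ I2b fr * I2d fr - I2c fr ^+ 2 != 0.
Proof.
move=> hfr; have [[c0 v0 N0 a0] [b0 bd0]] := generic_frame FFP.
have [eb ec ed] := frame_formula_I2 gen.
have hff := frame_formulaP FF_two c0 v0 N0 a0.
have b0' : I2b (frame_formula gen) != 0 by rewrite eb.
by rewrite -(sframe_uniq FF_two hff hfr b0') eb ec ed.
Qed.

(** The formulas define a frame at th as soon as their denominators do not
    vanish, which may be checked in FF, where generic_frame applies. *)
Lemma generic_frame_uniq : exists! fr, sframe th fr.
Proof.
have F2 : (2%:R : K) != 0 by rewrite -(fmorph_eq0 j) rmorph_nat FF_two.
have [[c0 v0 N0 a0] _] := generic_frame FFP.
have [ec ev eN ea _] := map_formulas hth.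
have hff : sframe th (frame_formula th).
  by apply: frame_formulaP => //; rewrite -(fmorph_eq0 j) (ec, ev, eN, ea).
exists (frame_formula th); split=> // fr hfr; apply: (sframe_uniq F2 hff hfr).
have [b0 _] := generic_frame_I2 (map_sframe hth hff).
by rewrite -(fmorph_eq0 j); have [_ <- _ _] := map_I2 j (frame_formula th).
Qed.

End GenericFrame.

(** * Invariants of jets of finite order *)

Section FiniteOrder.

Variables (R : realType) (FF : fieldType) (jF : {rmorphism R -> FF}).
Variables (gen : nat -> FF) (D : 'I_2 -> FF -> FF).
Hypotheses (FFP : jet_field jF gen) (DP : total_derivatives jF gen D).

Local Notation jemb := (jemb FFP).
Local Notation fixed := (fixed_by_group jF gen D).

Definition jemb2 : {rmorphism jfield R 2 -> FF} := jemb 2.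

Lemma jemb2_generic n : (n < 14)%N -> jemb2 (jcoord (generic_jet R) n) = gen n.
Proof.
move=> hn; have e := jemb_tofrac FFP ('X_(inord n) : {mpoly R[jdim 2]}).
by rewrite evX inordK // in e.
Qed.

Lemma generic_is_frame fr : is_frame (generic_jet R) fr <-> sframe (jcoord (generic_jet R)) fr.
Proof.
apply: is_frameP; rewrite -(fmorph_eq0 jemb2) rmorph_nat; exact: (FF_two jF).
Qed.

Lemma fixed_pullback k (f : jfield R k) :
  fixed (jemb k f) <-> (forall g, symplectic g -> pullback g f f).
Proof.
split=> [hf g hg|hf g h hg hC hX].
  have [h [hC hX]] := pull_exists FFP DP hg.
  by apply/(pullbackP FFP DP hg hC hX); rewrite (hf g h).
by symmetry; apply/(pullbackP FFP DP hg hC hX); exact: hf.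
Qed.

Lemma poly_above2_order2 (f : jfield R 2) : poly_above2 f.
Proof.
have [P [Q [Q0 ->]]] := jfieldP f; exists P, Q; split=> // m i _ hi.
by have := ltn_ord i; rewrite ltnNge hi.
Qed.

Lemma jemb_nab (v : 'cV[jfield R 2]_(2 + 2)) k (f : jfield R k.+1) :
  jemb k.+2 (nabla v f) = nab D (map_mx jemb2 v) (jemb k.+1 f).
Proof. by rewrite (jemb_nabla FFP DP) sum2 !lshift_i /nab !mxE. Qed.

Lemma jemb_eval_expr k n (z : 'I_n -> jfield R k) P :
  jemb k (eval_expr z P) = mmap jF (fun i => jemb k (z i)) P.
Proof.
rewrite /eval_expr /mmap [LHS](rmorph_sum (jemb k)); apply: eq_bigr => m _.
rewrite [LHS](rmorphM (jemb k)); congr (_ * _).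
  by rewrite (jemb_tofrac FFP) evC.
rewrite /mmap1 [LHS](rmorph_prod (jemb k)); apply: eq_bigr => i _.
exact: (rmorphXn (jemb k)).
Qed.

Variable fr0 : frame (jfield R 2).
Hypothesis hfr0 : sframe (jcoord (generic_jet R)) fr0.

Local Notation fr := (map_frame jemb2 fr0).
Local Notation v := (horizontal fr0).

Let hfr : sframe gen fr := map_sframe jemb2_generic hfr0.
Let b0 : I2b fr != 0. Proof. by case: (generic_frame_I2 FFP hfr). Qed.
Let bd0 : I2b fr * I2d fr - I2c fr ^+ 2 != 0.
Proof. by case: (generic_frame_I2 FFP hfr). Qed.

Lemma horizontal0 : map_mx jemb2 (v ord0) = vpar fr. Proof. by []. Qed.
Lemma horizontal1 : map_mx jemb2 (v ord_max) = wpar fr. Proof. by []. Qed.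

Lemma pull_horizontal g (h : {rmorphism FF -> FF}) e f : symplectic g ->
    (forall c, h (jF c) = jF c) -> (forall n, h (gen n) = gjet jF gen D g n) ->
  h (nab D (map_mx jemb2 (v e)) f) = nab D (map_mx jemb2 (v e)) (h f).
Proof.
move=> hg hC hX; have [g' [_ g'g _]] := symplectic_inv hg.
have gig : map_mx jF g' *m gm jF g = 1%:M by rewrite /gm -map_mxM g'g map_mx1.
have eq := pull_frame FFP DP hg hX gig hfr b0.
have [[_ ht _] [hw _ _ _ _] _ _ _] := hfr.
apply: (pull_nab FFP DP hg hC hX hfr).
  by elim/ord2P: e; rewrite ?horizontal0 ?horizontal1.
move=> i; elim/ord2P: e; rewrite ?horizontal0 ?horizontal1.
  by have /matrixP/(_ i 0) := congr1 (@vpar FF) eq; rewrite [LHS]mxE.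
by have /matrixP/(_ i 0) := congr1 (@wpar FF) eq; rewrite [LHS]mxE.
Qed.

Lemma listed_fixed I : I \in listed fr0 -> fixed (jemb 2 I).
Proof.
move=> hI g h hg hC hX; have [g' [_ g'g _]] := symplectic_inv hg.
have gig : map_mx jF g' *m gm jF g = 1%:M by rewrite /gm -map_mxM g'g map_mx1.
have [ea eb ec ed] := pull_I2 FFP DP hg hX gig hfr b0.
have [ea' eb' ec' ed'] := map_I2 jemb2 fr0.
move: hI; rewrite !inE => /or4P[] /eqP ->.
- by rewrite -[jemb 2 _]ea' ea.
- by rewrite -[jemb 2 _]eb' eb.
- by rewrite -[jemb 2 _]ec' ec.
- by rewrite -[jemb 2 _]ed' ed.
Qed.

Lemma horizontal_invariant e : invariant_derivation (v e).
Proof.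
move=> g hg k f f'; have [h [hC hX]] := pull_exists FFP DP hg.
move=> /(pullbackP FFP DP hg hC hX) e1; apply/(pullbackP FFP DP hg hC hX).
by rewrite !jemb_nab e1 (pull_horizontal _ _ hg hC hX).
Qed.

Lemma mem_four (T : eqType) (a b c d : T) :
  [/\ a \in [:: a; b; c; d], b \in [:: a; b; c; d], c \in [:: a; b; c; d]
    & d \in [:: a; b; c; d]].
Proof. by rewrite !inE !eqxx !orbT. Qed.

(** The functions nabla_J I, seen in FF. *)
Definition iterated (x : FF) : Prop :=
  exists J I, I \in listed fr0 /\ x = jemb (size J).+2 (nablas v J I).

Lemma iterated_nab e x : iterated x -> iterated (nab D (map_mx jemb2 (v e)) x).
Proof.
move=> [J [I [hI ->]]]; exists (e :: J), I; split=> //.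
by rewrite [RHS]jemb_nab.
Qed.

Lemma iterated_fixed x : iterated x -> fixed x.
Proof.
move=> [J [I [hI ->]]] g h hg hC hX; elim: J => [|e J IH].
  exact: (listed_fixed hI hg hC hX).
by rewrite /= jemb_nab (pull_horizontal _ _ hg hC hX) IH.
Qed.

Lemma invariants_are_generated k (F : jfield R k) :
  (forall g, symplectic g -> pullback g F F) -> generated (listed fr0) v F.
Proof.
move=> /fixed_pullback hF.
have in0 I : I \in listed fr0 -> iterated (jemb2 I) by move=> hI; exists [::], I.
have [la lb lc ld] := mem_four (I2a fr0) (I2b fr0) (I2c fr0) (I2d fr0).
have [ea eb ec ed] := map_I2 jemb2 fr0.
have [||||||s [hs [P [Q [Q0 FE]]]]] := invariants_generated FFP DP hfr b0 bd0
    (GS := iterated) _ _ _ _ _ _ iterated_fixed hF.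
- by move=> x; rewrite -horizontal0; exact: iterated_nab.
- by move=> x; rewrite -horizontal1; exact: iterated_nab.
- by rewrite ea; exact: (in0 _ la).
- by rewrite eb; exact: (in0 _ lb).
- by rewrite ec; exact: (in0 _ lc).
- by rewrite ed; exact: (in0 _ ld).
have hJ (i : 'I_(size s)) : exists JI : seq 'I_2 * jfield R 2, JI.2 \in listed fr0 /\
    point i = jemb (size JI.1).+2 (nablas v JI.1 JI.2).
  by have [J [I hI]] := hs _ (mem_nth 0 (ltn_ord i)); exists (J, I).
have [JI hJI] := choice hJ.
pose m := maxn k (\max_(i < size s) (size (JI i).1).+2).
have km : (k <= m)%N := leq_maxl _ _.
have Jm i : ((size (JI i).1).+2 <= m)%N.
  by rewrite (leq_trans _ (leq_maxr _ _)) // (leq_bigmax i).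
exists (size s), m, (fun i => (JI i).1), (fun i => (JI i).2), P, Q => z.
have zE p : jemb m (eval_expr z p) = mmap jF (@point FF s) p.
  rewrite jemb_eval_expr; congr (mmap jF _ p); apply/funext => i.
  by rewrite jemb_widen //; have [_ <-] := hJI i.
split; [exact: km|exact: Jm|by move=> i; have [] := hJI i| |].
  by rewrite -(fmorph_eq0 (jemb m)) zE.
apply: (fmorph_inj (jemb m)).
by rewrite jemb_widen // [RHS](fmorph_div (jemb m)) !zE.
Qed.

End FiniteOrder.

Theorem theorem6p1 (R : realType) :
  (exists! fr : frame (jfield R 2), is_frame (generic_jet R) fr) /\
  forall fr : frame (jfield R 2), is_frame (generic_jet R) fr ->
    [/\ forall I : jfield R 2, I \in listed fr -> differential_invariant I,
        forall e : 'I_2, invariant_derivation (horizontal fr e)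
      & forall (k : nat) (F : jfield R k),
          differential_invariant F -> generated (listed fr) (horizontal fr) F].
Proof.
have [FF [jF [gen FFP]]] := jet_field_exists R.
have [D DP] := total_derivatives_exist FFP.
split.
  have [fr [hfr uniq]] := generic_frame_uniq FFP (jemb2_generic FFP).
  exists fr; split=> [|fr' /(generic_is_frame FFP) hfr']; last exact: uniq.
  exact/(generic_is_frame FFP).
move=> fr /(generic_is_frame FFP) hfr; split.
- move=> I hI; split; first exact: poly_above2_order2.
  exact/(fixed_pullback FFP DP)/(listed_fixed FFP DP hfr).
- exact: (horizontal_invariant FFP DP hfr).
- by move=> k F [_ hF]; exact: (invariants_are_generated FFP DP hfr hF).
Qed.
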